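(* Let $\lambda>0$, $0<\beta<1$, and let $h_\lambda(\cdot,t)$ denote the probability density of the inverse tempered stable subordinator $E_\lambda(t)$. Then the following hold. (a) For $0<\beta<1$ and $t>0$, $$\lim_{x\to 0^+}h_\lambda(x,t)=\frac{\sin(\beta\pi)}{\pi}\,\lambda^\beta\,\Gamma(1+\beta)\,\Gamma(-\beta,\lambda t).$$ (b) For $0<\beta<1$, $t>0$ and every integer $k\ge 0$, $$\frac{\partial^k}{\partial x^k}h_\lambda(x,t)\Big|_{x=0}=\frac{e^{-\lambda t}}{\pi}\int_0^\infty\frac{e^{-ty}}{y+\lambda}\left[\big(\lambda^{2\beta}+y^{2\beta}-2\lambda^\beta y^\beta\cos(\beta\pi)\big)^{k/2}\big(\lambda^\beta\sin(k\alpha)-y^\beta\sin(k\alpha-\beta\pi)\big)\right]dy,$$ where $\alpha=\alpha(y)\in(0,\pi)$ is determined by $\tan\alpha=\dfrac{y^\beta\sin(\beta\pi)}{\lambda^\beta-y^\beta\cos(\beta\pi)}$ (with $\alpha=\pi/2$ if the denominator vanishes). (c) If $\beta=1/m$ with $m\ge 2$ an integer, then $h_\lambda$ satisfies $$\sum_{j=1}^{m}(-1)^j\binom{m}{j}\lambda^{1-\frac{j}{m}}\frac{\partial^j}{\partial x^j}h_\lambda(x,t)=\frac{\partial}{\partial t}h_\lambda(x,t)+h_\lambda(x,0)\,\delta_0(t).$$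
   Context: For $0<\beta<1$ and $\lambda>0$, the tempered $\beta$-stable subordinator $D_\lambda=(D_\lambda(t))_{t\ge 0}$ with tempering parameter $\lambda$ is the (strictly increasing) subordinator started at $0$ with Laplace transform $\mathbb{E}(e^{-sD_\lambda(t)})=e^{-t((s+\lambda)^{\beta}-\lambda^{\beta})}$ for $s>0$. The inverse tempered stable (ITS) subordinator is $E_\lambda(t)=\inf\{u>0: D_\lambda(u)>t\}$, $t\ge 0$, and $h_\lambda(x,t)$, $x>0$, denotes the density in $x$ of the random variable $E_\lambda(t)$. For $a\in\mathbb{R}$ and $u>0$, $\Gamma(a,u)=\int_u^\infty y^{a-1}e^{-y}\,dy$ is the incomplete gamma function. Derivatives of $h_\lambda$ at $x=0$ are understood as limits of the derivatives as $x\to0^+$. In (c), $x>0$, $h_\lambda(x,0)$ is the initial value $\lim_{t\to0^+}h_\lambda(x,t)$, $\delta_0$ is the Dirac delta at $t=0$ (Laplace transform in $t$ equal to $1$), and the equation is understood as an identity of Laplace transforms in $t$, where $\partial_t h_\lambda$ has Laplace transform $s\,\mathcal{L}_t(h_\lambda(x,t))(s)-h_\lambda(x,0)$. *)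

(* Defs.v *)
From HB Require Import structures.
From mathcomp Require Import all_boot all_order all_algebra.
From mathcomp Require Import all_classical all_reals all_analysis.

Set Implicit Arguments.
Unset Strict Implicit.
Unset Printing Implicit Defensive.

Import Order.TTheory GRing.Theory Num.Theory.
Import numFieldNormedType.Exports.

Local Open Scope classical_set_scope.
Local Open Scope ring_scope.

Section processes.
Context d (T : measurableType d) (R : realType) (P : probability T R).

(* Processes are indexed by R; only times t >= 0 are constrained. *)

Definition increment (D : R -> {RV P >-> R}) (s t : R) : T -> R :=
  fun w => D t w - D s w.

Definition independent_increments (D : R -> {RV P >-> R}) :=
  forall (n : nat) (t : nat -> R) (A : nat -> set R),
    0 <= t 0%N -> (forall i, t i <= t i.+1) ->
    (forall i, measurable (A i)) ->
    P (\bigcap_(i < n) (increment D (t i) (t i.+1) @^-1` A i)) =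
    (\prod_(i < n) P (increment D (t i) (t i.+1) @^-1` A i))%E.

Definition stationary_increments (D : R -> {RV P >-> R}) :=
  forall (s t : R) (A : set R), 0 <= s -> 0 <= t -> measurable A ->
    P (increment D s (s + t) @^-1` A) = P (D t @^-1` A).

(* Almost all paths are monotone, so left limits exist automatically and
   right-continuity amounts to the cadlag property. *)
Definition strictly_increasing_subordinator (D : R -> {RV P >-> R}) :=
  [/\ {ae P, forall w, D 0 w = 0},
      independent_increments D,
      stationary_increments D,
      {ae P, forall w, forall s t : R, 0 <= s -> s < t -> D s w < D t w} &
      {ae P, forall w, forall t : R, 0 <= t -> D u w @[u --> t^'+] --> D t w}].

Definition tempered_stable_subordinator (lambda beta : R)
    (D : R -> {RV P >-> R}) :=
  strictly_increasing_subordinator D /\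
  forall s t : R, 0 < s -> 0 <= t ->
    ('E_P[fun w => expR (- s * D t w)] =
     (expR (- t * ((s + lambda) `^ beta - lambda `^ beta)))%:E)%E.

(* The infimum is taken in the extended reals, where the infimum of the empty
   set is +oo.  Equality is almost sure because, with path properties that hold
   only almost surely, the pointwise infimum need not be measurable. *)
Definition inverse_subordinator (D E : R -> {RV P >-> R}) :=
  forall t : R, 0 <= t ->
    {ae P, forall w,
      (E t w)%:E = ereal_inf [set u%:E | u in [set u | 0 < u /\ t < D u w]]}.

(* f is a version, continuous on ]0, +oo[, of the density of X, which is
   concentrated on ]0, +oo[.  Continuity selects a unique version there;
   the values of f outside ]0, +oo[ are irrelevant. *)
Definition continuous_density_pos (X : {RV P >-> R}) (f : R -> R) :=
  [/\ forall x : R, 0 < x -> 0 <= f x,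
      forall x : R, 0 < x -> {for x, continuous f} &
      forall A : set R, measurable A ->
        (P (X @^-1` A) =
         \int[lebesgue_measure]_(x in A `&` `]0%R, +oo[) (f x)%:E)%E].

End processes.

Section special_functions_and_transforms.
Context (R : realType).

Definition gamma_fun (a : R) : R :=
  \int[lebesgue_measure]_(y in `]0, +oo[) (y `^ (a - 1) * expR (- y)).

Definition inc_gamma (a u : R) : R :=
  \int[lebesgue_measure]_(y in `]u, +oo[) (y `^ (a - 1) * expR (- y)).

Definition laplace_integrable (f : R -> R) (s : R) :=
  (@lebesgue_measure R).-integrable `]0, +oo[
    (fun t => (expR (- s * t) * f t)%:E).

Definition laplace (f : R -> R) (s : R) : R :=
  \int[lebesgue_measure]_(t in `]0, +oo[) (expR (- s * t) * f t).

(* The Laplace transform of the Dirac delta at 0, seen as a measure on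
   [0, +oo[; it is equal to 1. *)
Definition laplace_dirac0 (s : R) : R :=
  \int[dirac (0 : R)]_(t in `[0, +oo[) expR (- s * t).

Definition is_alpha (lambda beta y a : R) :=
  0 < a < pi /\
  let den := lambda `^ beta - y `^ beta * cos (beta * pi) in
  if den == 0 then a = pi / 2
  else tan a = y `^ beta * sin (beta * pi) / den.

Definition deriv0_integrand (lambda beta t : R) (k : nat) (alpha : R -> R)
    (y : R) : R :=
  expR (- t * y) / (y + lambda) *
  ((lambda `^ (2 * beta) + y `^ (2 * beta)
      - 2 * lambda `^ beta * y `^ beta * cos (beta * pi)) `^ (k%:R / 2) *
   (lambda `^ beta * sin (k%:R * alpha y)
      - y `^ beta * sin (k%:R * alpha y - beta * pi))).

(* h(x, 0), the initial value at t = 0 *)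
Definition initial_value (h : R -> R -> R) (x : R) : R :=
  lim (h x t @[t --> 0^'+]).

End special_functions_and_transforms.

(* Main.v *)
(* For x > 0 the event {E_lambda(t) < x} agrees with {D_lambda(x) > t} up to the
   event {E_lambda(t) = x}, so a primitive in x of h_lambda(x, t) is the tail
   P(D_lambda(x) > t), whose Laplace transform in t is
   (1 - exp(-x ((s + lambda)^beta - lambda^beta))) / s.  Cauchy's formula on the
   two rays W = r exp(+-i theta), theta = pi / (1 + beta), writes the exponential as
     (1/pi) int_0^oo Im(W / (s + lambda - W) exp(x (lambda^beta - W^beta))) dr / r,
   and uniqueness of the Laplace transform identifies the tail with
     (1/pi) int_0^oo Im(W / (lambda - W)
                         exp(x (lambda^beta - W^beta) + t (W - lambda))) dr / r.
   The angle is chosen so that cos theta < 0 < cos(beta theta): both exponentials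
   decay, hence one may differentiate under the integral in x and in t and let
   x -> 0+, each x-derivative producing a factor lambda^beta - W^beta.

   (b) At x = 0 the ray can be rotated onto the negative axis, where
   lambda^beta - W^beta = rho exp(-i alpha).  (a) is the case k = 0, after writing
   1 / (r + lambda) as a Laplace integral.  (c) is the binomial identity
   sum_j (-1)^j C(m, j) lambda^(1 - j/m) (lambda^beta - W^beta)^j = W for
   beta = 1/m; removing the term j = 0 leaves W - lambda, the symbol of d/dt.

   A holomorphic f satisfies d/dp f = i r d/dr f in polar coordinates, so the
   derivative in p of int f(r e^(ip)) dr / r is a boundary term: this is the only
   form of Cauchy's theorem that is needed. *)

Require Import Defs.
From HB Require Import structures.
From mathcomp Require Import all_boot all_order all_algebra.
From mathcomp Require Import all_classical all_reals all_analysis.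
From mathcomp Require Import measurable_realfun complex ring lra.

Set Implicit Arguments.
Unset Strict Implicit.
Unset Printing Implicit Defensive.

Import Order.TTheory GRing.Theory Num.Theory.
Import numFieldNormedType.Exports ComplexField.Normc.

Local Open Scope classical_set_scope.
Local Open Scope ring_scope.

(** * Calculus and dominated convergence for real integrals *)

Section real_analysis.
Context {R : realType}.
Local Notation mu := (@lebesgue_measure R).

(** The cut itself cannot carry the integral while [x > 0]: along it the factor in [x] has modulus
    [exp (x * (lambda^beta - r^beta * cos (beta * pi)))], which grows as soon as [beta > 1/2]. Hence
    an intermediate ray for positive [x], and a second rotation, from this ray to the cut, once
    [x = 0] has removed that factor and the decay in [t] suffices alone. On conjugate rays the
    integrand takes conjugate values, so a contour is one real integral of an imaginary part against
    [dr / r]. The limits at 0 rest on two different majorants. For [x] bounded below, the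
    exponential in [r^beta] dominates uniformly in [t >= 0], so that [t = 0] may be inserted; for
    [t] bounded below, the exponential in [r] dominates uniformly over bounded [x >= 0], so that
    [x = 0] may be inserted. At [t = 0] the integral for the tail equals [pi] whatever [x] is; its
    derivative, the initial value of the density, is therefore 0, which settles both boundary terms
    in (c): the one in the transform of the time derivative and the Dirac term. *)

Lemma is_derive1_derivable (f : R -> R) (x l : R) :
  is_derive x 1 f l -> derivable f x 1.
Proof. by case. Qed.

Lemma is_derive1_derive1 (f : R -> R) (x l : R) :
  is_derive x 1 f l -> derive1 f x = l.
Proof. by case=> _ <-; rewrite derive1E. Qed.

Lemma is_derive1_continuous (f : R -> R) (x l : R) :
  is_derive x 1 f l -> {for x, continuous f}.
Proof.
by move=> [dh _]; apply: differentiable_continuous; exact/derivable1_diffP.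
Qed.

Lemma is_derive_under_integral d (Y : measurableType d)
    (nu : {measure set Y -> \bar R}) (f df : R -> Y -> R) (B : set Y)
    (a u v : R) (G : Y -> R) :
  measurable B -> u < a < v ->
  (forall x, u < x < v -> nu.-integrable B (EFin \o f x)) ->
  (forall x y, u < x < v -> B y -> is_derive x 1 (f ^~ y) (df x y)) ->
  nu.-integrable B (EFin \o G) ->
  (forall x y, u < x < v -> B y -> `|df x y| <= G y) ->
  is_derive a 1 (fun x => \int[nu]_(y in B) f x y) (\int[nu]_(y in B) df a y).
Proof.
move=> mB Ia intf dfE intG hG.
have toI x : `]u, v[%classic x -> u < x < v by rewrite /= in_itv.
have Ia' : `]u, v[%classic a by rewrite /= in_itv.
(* [G] may be negative off [B]; its absolute value is a majorant that is nonnegative everywhere. *)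
have intG' : nu.-integrable B (EFin \o (fun y => `|G y|)).
  exact: (integrable_abse intG).
have pE x y : u < x < v -> B y -> partial1of2 f x y = df x y.
  by move=> xuv By; rewrite /partial1of2 (is_derive1_derive1 (dfE x y xuv By)).
have h1 x y : `]u, v[%classic x -> B y -> derivable (f ^~ y) x 1.
  by move=> /toI xuv By; exact: (is_derive1_derivable (dfE x y xuv By)).
have h2 x y : `]u, v[%classic x -> B y -> `|partial1of2 f x y| <= `|G y|.
  by move=> /toI xuv By; rewrite pE// (le_trans (hG _ _ xuv By))// ler_norm.
have h0 x : `]u, v[%classic x -> nu.-integrable B (EFin \o f x).
  by move=> /toI; exact: intf.
apply: DeriveDef.
  exact: (derivable_under_integral mB Ia' h0 h1 _ intG' h2).
rewrite -derive1E (differentiation_under_integral mB Ia' h0 h1 _ intG' h2)//.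
by apply: eq_Rintegral => y /[!inE] By; rewrite pE.
Qed.

Lemma Rintegral_FTC2 (f F : R -> R) (a b : R) : a < b ->
  (forall x, a <= x <= b -> is_derive x 1 F (f x)) ->
  (forall x, a <= x <= b -> {for x, continuous f}) ->
  \int[mu]_(x in `[a, b]) f x = F b - F a.
Proof.
move=> ab dF cf; rewrite /Rintegral (@continuous_FTC2 _ f F)//.
- apply: continuous_in_subspaceT => x /[!inE]/=; rewrite in_itv /=; exact: cf.
- split.
  + move=> x; rewrite in_itv /= => /andP[ax xb].
    by apply: (is_derive1_derivable (dF _ _)); rewrite !ltW.
  + apply: cvg_at_right_filter; apply: (is_derive1_continuous (dF _ _)).
    by rewrite lexx ltW.
  + apply: cvg_at_left_filter; apply: (is_derive1_continuous (dF _ _)).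
    by rewrite lexx ltW.
- move=> x; rewrite in_itv /= => /andP[ax xb].
  by apply: is_derive1_derive1; apply: dF; rewrite !ltW.
Qed.

Lemma is_derive_lipschitz (f df : R -> R) (a b M : R) : a <= b ->
  (forall x, a <= x <= b -> is_derive x 1 f (df x)) ->
  (forall x, a <= x <= b -> `|df x| <= M) ->
  `|f b - f a| <= M * (b - a).
Proof.
move=> ab dfE hM.
have [||c + ->] := @MVT_segment R f df a b ab.
- by move=> x; rewrite in_itv/= => /andP[ax xb]; apply: dfE; rewrite !ltW.
- apply: continuous_in_subspaceT => x /[!inE]/=; rewrite in_itv /= => xab.
  exact: (is_derive1_continuous (dfE _ xab)).
rewrite in_itv/= => /hM cM.
by rewrite normrM (ger0_norm (_ : 0 <= b - a)) ?subr_ge0// ler_wpM2r// subr_ge0.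
Qed.

Lemma continuous_itvcc_integrable (f : R -> R) (a b : R) :
  (forall x, a <= x <= b -> {for x, continuous f}) ->
  mu.-integrable `[a, b] (EFin \o f).
Proof.
move=> cf; apply: continuous_compact_integrable; first exact: segment_compact.
apply: continuous_in_subspaceT => x /[!inE]/=; rewrite in_itv /=; exact: cf.
Qed.

Lemma continuous_itvoy_measurable (f : R -> R) (a : R) :
  (forall x, a < x -> {for x, continuous f}) ->
  measurable_fun `]a, +oo[ f.
Proof.
move=> cf; apply: open_continuous_measurable_fun; first by rewrite set_itvoy; exact: open_gt.
by move=> x /[!inE]/=; rewrite in_itv /= andbT; exact: cf.
Qed.

Lemma le_Rintegrable d (Y : measurableType d)
    (nu : {measure set Y -> \bar R}) (D : set Y) (f G : Y -> R) :
  measurable D -> measurable_fun D f -> nu.-integrable D (EFin \o G) ->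
  (forall x, D x -> `|f x| <= G x) -> nu.-integrable D (EFin \o f).
Proof.
move=> mD mf iG fG; apply: le_integrable iG => //.
  exact/measurable_EFinP.
by move=> x Dx /=; rewrite lee_fin (le_trans (fG _ Dx))// ler_norm.
Qed.

Lemma Rintegral_dominated_cvg d (Y : measurableType d)
    (nu : {measure set Y -> \bar R}) (D : set Y)
    (f_ : nat -> Y -> R) (f G : Y -> R) :
  measurable D -> (forall n, measurable_fun D (f_ n)) ->
  (forall x, D x -> f_ n x @[n --> \oo] --> f x) ->
  nu.-integrable D (EFin \o G) ->
  (forall n x, D x -> `|f_ n x| <= G x) ->
  nu.-integrable D (EFin \o f) /\
  \int[nu]_(x in D) f_ n x @[n --> \oo] --> \int[nu]_(x in D) f x.
Proof.
move=> mD mf cf iG fG.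
have mf' n : measurable_fun D (EFin \o f_ n) by exact/measurable_EFinP.
have cf' x : D x -> (EFin \o f_ n) x @[n --> \oo] --> (EFin \o f) x.
  by move=> Dx; apply: cvg_EFin; [exact: nearW|exact: cf].
have mfl : measurable_fun D (EFin \o f).
  by apply: (emeasurable_fun_cvg (fun n => EFin \o f_ n)).
have [i _ c] := @dominated_convergence _ _ _ nu D mD (fun n => EFin \o f_ n)
  (EFin \o f) (EFin \o G) mf' mfl (aeW _ cf') iG
  (aeW nu (fun x n Dx => fG n x Dx)).
split=> //; apply: fine_cvg.
rewrite fineK; last exact: integrable_fin_num.
exact: c.
Qed.

Lemma Rintegral_cvg_at_right d (Y : measurableType d)
    (nu : {measure set Y -> \bar R}) (D : set Y)
    (f : R -> Y -> R) (f0 G : Y -> R) (p q : R) :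
  measurable D -> p < q -> (forall x, p < x < q -> measurable_fun D (f x)) ->
  (forall y, D y -> f x y @[x --> p^'+] --> f0 y) ->
  nu.-integrable D (EFin \o G) ->
  (forall x y, p < x < q -> D y -> `|f x y| <= G y) ->
  nu.-integrable D (EFin \o f0) /\
  \int[nu]_(y in D) f x y @[x --> p^'+] --> \int[nu]_(y in D) f0 y.
Proof.
move=> mD pq mf cf iG fG.
have key u : (forall n, p < u n) -> u n @[n --> \oo] --> p ->
    nu.-integrable D (EFin \o f0) /\
    \int[nu]_(y in D) f (u n) y @[n --> \oo] --> \int[nu]_(y in D) f0 y.
  move=> up ulim.
  (* The hypotheses hold on []p, q[] only, so the first [N] terms, which may exceed [q], are
     dropped. *)
  have [N _ hN] : \forall n \near \oo, u n < q by exact: (cvgr_lt p).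
  have uq n : p < u (n + N)%N < q by rewrite up hN//= leq_addl.
  have [|y Dy|n y Dy|i c] := @Rintegral_dominated_cvg _ _ nu D (fun n => f (u (n + N)%N)) f0 G mD _ _ iG.
  - by move=> n; exact: mf.
  - apply: (@cvg_at_rightP _ (f ^~ y) p _).1; first exact: cf.
    split; first by move=> n; case/andP: (uq n).
    by rewrite (cvg_shiftn N).
  - exact: fG.
  split=> //; rewrite -(cvg_shiftn N); exact: c.
split; last by apply/cvg_at_rightP => u [up ulim]; exact: (key u up ulim).2.
(* Integrability of the limit comes from any one sequence that tends to [p] from above. *)
apply: (key (fun n => p + n.+1%:R^-1) _ _).1.
  by move=> n; rewrite ltrDl.
rewrite -[X in _ --> X]addr0; apply: cvgD; first exact: cvg_cst.
exact: cvg_harmonic.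
Qed.

(** Dominated convergence for the restrictions of [f], with [|f|] as majorant. Rotations take place
    on these segments, away from infinity and from the singularity of [dr / r] at 0; the integrals
    over the half-line are recovered from them. *)
Lemma Rintegral_exhaustion (f : R -> R) :
  mu.-integrable `]0, +oo[ (EFin \o f) ->
  \int[mu]_(x in `[n.+1%:R^-1, n.+1%:R]) f x @[n --> \oo] -->
  \int[mu]_(x in `]0, +oo[) f x.
Proof.
move=> fi.
have mf : measurable_fun `](0:R), +oo[ f by move/integrableP: fi => [/measurable_EFinP].
pose A n : set R := `[n.+1%:R^-1, n.+1%:R]%classic.
have sub n : A n `<=` `](0:R), +oo[.
  by move=> x; rewrite /A /= !in_itv/= => /andP[+ _]; rewrite andbT; apply: lt_le_trans.
have E n : \int[mu]_(x in A n) f x = \int[mu]_(x in `](0:R), +oo[) (f \_ (A n)) x.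
  rewrite Rintegral_mkcond [RHS]Rintegral_mkcond; congr Rintegral.
  apply/funext => x; rewrite !patchE.
  case: ifPn => [/set_mem/sub xA|_]; first by rewrite mem_set.
  by case: ifPn.
under eq_fun do rewrite E.
apply: (@Rintegral_dominated_cvg _ _ mu `](0:R), +oo[ _ f (fun x => `|f x|) _ _ _ _ _).2.
- exact: measurable_itv.
- move=> n; apply: measurable_funTS.
  apply: (iffLR (measurable_restrictT f _)); first exact: measurable_itv.
  exact: (measurable_funS _ (sub n) mf).
- move=> x; rewrite /= in_itv/= andbT => x0.
  apply: cvg_near_cst; near=> n; rewrite patchE mem_set// /A /= in_itv/=.
  have xn : x <= n%:R by near: n; exact: nbhs_infty_ger.
  have xVn : x^-1 <= n%:R by near: n; exact: nbhs_infty_ger.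
  rewrite invf_ple ?posrE//.
  by rewrite (le_trans xn) ?(le_trans xVn) ?ler_nat.
- exact: (integrable_abse fi).
- by move=> n x _; rewrite patchE; case: ifPn; rewrite ?normr0.
Unshelve. all: by end_near. Qed.

End real_analysis.

(** * Complex-valued functions of a real variable *)

Section complex_calculus.
Context {R : realType}.
Local Notation C := R[i].
Implicit Types (z w l : C) (f g : R -> C).

Lemma cReD z w : complex.Re (z + w) = complex.Re z + complex.Re w.
Proof. by case: z => ? ?; case: w. Qed.
Lemma cImD z w : complex.Im (z + w) = complex.Im z + complex.Im w.
Proof. by case: z => ? ?; case: w. Qed.
Lemma cReN z : complex.Re (- z) = - complex.Re z.
Proof. by case: z. Qed.
Lemma cImN z : complex.Im (- z) = - complex.Im z.
Proof. by case: z. Qed.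
Lemma cReM z w : complex.Re (z * w) =
  complex.Re z * complex.Re w - complex.Im z * complex.Im w.
Proof. by case: z => ? ?; case: w. Qed.
Lemma cImM z w : complex.Im (z * w) =
  complex.Re z * complex.Im w + complex.Im z * complex.Re w.
Proof. by case: z => ? ?; case: w. Qed.
Lemma cReV z : complex.Re z^-1 =
  complex.Re z / (complex.Re z ^+ 2 + complex.Im z ^+ 2).
Proof. by case: z. Qed.
Lemma cImV z : complex.Im z^-1 =
  - complex.Im z / (complex.Re z ^+ 2 + complex.Im z ^+ 2).
Proof. by case: z => a b; rewrite mulNr. Qed.

Lemma complexP z w : complex.Re z = complex.Re w ->
  complex.Im z = complex.Im w -> z = w.
Proof. by case: z => ? ?; case: w => ? ? /= -> ->. Qed.

Lemma sqr_normc_ReIm z :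
  (normc z) ^+ 2 = complex.Re z ^+ 2 + complex.Im z ^+ 2.
Proof. by case: z => a b /=; rewrite sqr_sqrtr// addr_ge0// sqr_ge0. Qed.

Lemma normc_ge0 z : 0 <= normc z.
Proof. by case: z => a b /=; exact: sqrtr_ge0. Qed.

Lemma normr_Re_le z : `|complex.Re z| <= normc z.
Proof.
rewrite -(@ler_pXn2r _ 2)// ?nnegrE ?normc_ge0// sqr_normc_ReIm.
by rewrite real_normK ?num_real// lerDl sqr_ge0.
Qed.

Lemma normr_Im_le z : `|complex.Im z| <= normc z.
Proof.
rewrite -(@ler_pXn2r _ 2)// ?nnegrE ?normc_ge0// sqr_normc_ReIm.
by rewrite real_normK ?num_real// lerDr sqr_ge0.
Qed.

Lemma normc_eq0 z : (normc z == 0) = (z == 0).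
Proof. by apply/eqP/eqP => [/eq0_normc//|->]; rewrite normc0. Qed.

Lemma normc_gt0 z : (0 < normc z) = (z != 0).
Proof. by rewrite lt_def normc_ge0 andbT normc_eq0. Qed.

Lemma normcR (x : R) : normc x%:C%C = `|x|.
Proof. by rewrite /= expr0n addr0 sqrtr_sqr. Qed.

Lemma normci : normc 'i%C = 1 :> R.
Proof. by rewrite /= expr0n expr1n add0r sqrtr1. Qed.

Lemma normcX z n : normc (z ^+ n) = normc z ^+ n.
Proof. by elim: n => [|n IH]; rewrite ?expr0 ?normc1// !exprS normcM IH. Qed.

Definition cexp z : C :=
  ((expR (complex.Re z) * cos (complex.Im z)) +i*
   (expR (complex.Re z) * sin (complex.Im z)))%C.

Lemma cexpD z w : cexp (z + w) = cexp z * cexp w.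
Proof.
apply: complexP; rewrite ?(cReM, cImM) /= cReD cImD expRD ?cosD ?sinD; ring.
Qed.

Lemma cexp0 : cexp 0 = 1.
Proof. by apply: complexP; rewrite /= expR0 ?cos0 ?sin0; ring. Qed.

Lemma normc_cexp z : normc (cexp z) = expR (complex.Re z).
Proof.
rewrite /= -[RHS]ger0_norm ?expR_ge0// -sqrtr_sqr; congr Num.sqrt.
by rewrite !exprMn -mulrDr cos2Dsin2 mulr1.
Qed.

Lemma cexpMn z n : cexp (z *+ n) = cexp z ^+ n.
Proof.
by elim: n => [|n IH]; rewrite ?mulr0n ?cexp0// mulrS exprS cexpD IH.
Qed.

(** A derivative in a real variable, taken componentwise, so that the calculus of real functions
    carries over without complex differentiability. *)
Definition cderiv f x l :=
  is_derive x (1 : R) (fun y => complex.Re (f y)) (complex.Re l) /\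
  is_derive x (1 : R) (fun y => complex.Im (f y)) (complex.Im l).

Definition ccont f x :=
  {for x, continuous (fun y => complex.Re (f y))} /\
  {for x, continuous (fun y => complex.Im (f y))}.

Lemma cderiv_ccont f x l : cderiv f x l -> ccont f x.
Proof. by case=> ? ?; split; exact: is_derive1_continuous. Qed.

Lemma cderiv_cst z x : cderiv (fun=> z) x 0.
Proof. by split; exact: is_derive_cst. Qed.

Lemma cderivD f g x l m : cderiv f x l -> cderiv g x m ->
  cderiv (fun y => f y + g y) x (l + m).
Proof.
move=> [? ?] [? ?]; split; rewrite ?(cReD, cImD).
- under eq_fun do rewrite cReD; exact: is_deriveD.
- under eq_fun do rewrite cImD; exact: is_deriveD.
Qed.

Lemma is_derive1M (h k : R -> R) (x a b : R) :
  is_derive x 1 h a -> is_derive x 1 k b ->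
  is_derive x 1 (fun y => h y * k y) (a * k x + h x * b).
Proof.
move=> dh dk; have := is_deriveM dh dk => d.
by apply: is_derive_eq; rewrite /GRing.scale /= addrC mulrC.
Qed.

Lemma is_derive1B (h k : R -> R) (x a b : R) :
  is_derive x 1 h a -> is_derive x 1 k b ->
  is_derive x 1 (fun y => h y - k y) (a - b).
Proof. by move=> dh dk; exact: (is_deriveB dh dk). Qed.

Lemma is_derive1D (h k : R -> R) (x a b : R) :
  is_derive x 1 h a -> is_derive x 1 k b ->
  is_derive x 1 (fun y => h y + k y) (a + b).
Proof. by move=> dh dk; exact: (is_deriveD dh dk). Qed.

Lemma is_derive1N (h : R -> R) (x a : R) :
  is_derive x 1 h a -> is_derive x 1 (fun y => - h y) (- a).
Proof. by move=> dh; exact: (is_deriveN dh). Qed.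

Lemma cderivM f g x l m : cderiv f x l -> cderiv g x m ->
  cderiv (fun y => f y * g y) x (l * g x + f x * m).
Proof.
move=> [f1 f2] [g1 g2]; split.
- under eq_fun do rewrite cReM.
  apply: (is_derive_eq (is_derive1B (is_derive1M f1 g1) (is_derive1M f2 g2))).
  rewrite cReD !cReM; ring.
- under eq_fun do rewrite cImM.
  apply: (is_derive_eq (is_derive1D (is_derive1M f1 g2) (is_derive1M f2 g1))).
  rewrite cImD !cImM; ring.
Qed.

Lemma is_derive1V (h : R -> R) (x a : R) : h x != 0 ->
  is_derive x 1 h a -> is_derive x 1 (fun y => (h y)^-1) (- (h x) ^- 2 *: a).
Proof. by move=> h0 dh; exact: (is_deriveV h0 dh). Qed.

Lemma cderivV f x l : f x != 0 -> cderiv f x l ->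
  cderiv (fun y => (f y)^-1) x (- l / (f x) ^+ 2).
Proof.
move=> fx0 [f1 f2].
have n0 : complex.Re (f x) ^+ 2 + complex.Im (f x) ^+ 2 != 0.
  by rewrite -sqr_normc_ReIm expf_neq0// normc_eq0.
have dn : is_derive x (1 : R) (fun y => complex.Re (f y) ^+ 2 + complex.Im (f y) ^+ 2)
    (2 * (complex.Re (f x) * complex.Re l + complex.Im (f x) * complex.Im l)).
  under eq_fun do rewrite !expr2.
  apply: (is_derive_eq (is_derive1D (is_derive1M f1 f1) (is_derive1M f2 f2))).
  by ring.
have dV := @is_derive1V (fun y => complex.Re (f y) ^+ 2 + complex.Im (f y) ^+ 2) x _ n0 dn.
split.
- under eq_fun do rewrite cReV.
  apply: (is_derive_eq (is_derive1M f1 dV)).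
  rewrite /GRing.scale /= !(cReM, cReN, cReV, cImV, cImN, cImM, expr2) /=.
  move: n0 {dn dV f1 f2 fx0}.
  move: (complex.Re (f x)) (complex.Im (f x)) (complex.Re l) (complex.Im l).
  move=> a b u v; rewrite !expr2 => n0.
  (* The denominator brought in by [(f x) ^+ 2] is the fourth power of the modulus, that is the
     square of the quantity that [n0] shows to be nonzero. *)
  have -> : (a * a - b * b) * (a * a - b * b) + (a * b + b * a) * (a * b + b * a) =
    (a * a + b * b) ^+ 2 by ring.
  by field.
- under eq_fun do rewrite cImV.
  apply: (is_derive_eq (is_derive1M (is_derive1N f2) dV)).
  rewrite /GRing.scale /= !(cReM, cReN, cReV, cImV, cImN, cImM, expr2) /=.
  move: n0 {dn dV f1 f2 fx0}.
  move: (complex.Re (f x)) (complex.Im (f x)) (complex.Re l) (complex.Im l).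
  move=> a b u v; rewrite !expr2 => n0.
  have -> : (a * a - b * b) * (a * a - b * b) + (a * b + b * a) * (a * b + b * a) =
    (a * a + b * b) ^+ 2 by ring.
  by field.
Qed.

Lemma cderiv_cexp f x l : cderiv f x l ->
  cderiv (fun y => cexp (f y)) x (l * cexp (f x)).
Proof.
move=> [f1 f2].
have e1 : is_derive x (1 : R) (fun y => expR (complex.Re (f y)))
    (expR (complex.Re (f x)) * complex.Re l).
  exact: (is_derive1_comp (is_derive_expR _) f1).
have c1 : is_derive x (1 : R) (fun y => cos (complex.Im (f y)))
    (- sin (complex.Im (f x)) * complex.Im l).
  exact: (is_derive1_comp (is_derive_cos _) f2).
have s1 : is_derive x (1 : R) (fun y => sin (complex.Im (f y)))
    (cos (complex.Im (f x)) * complex.Im l).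
  exact: (is_derive1_comp (is_derive_sin _) f2).
split => /=.
- apply: (is_derive_eq (is_derive1M e1 c1)).
  rewrite cReM/=; ring.
- apply: (is_derive_eq (is_derive1M e1 s1)).
  rewrite cImM/=; ring.
Qed.

Lemma ccontD f g x : ccont f x -> ccont g x -> ccont (fun y => f y + g y) x.
Proof.
move=> [f1 f2] [g1 g2]; split; rewrite /prop_for /continuous_at.
- rewrite cReD; under eq_fun do rewrite cReD; exact: cvgD.
- rewrite cImD; under eq_fun do rewrite cImD; exact: cvgD.
Qed.

Lemma ccontN f x : ccont f x -> ccont (fun y => - f y) x.
Proof.
move=> [f1 f2]; split; rewrite /prop_for /continuous_at.
- rewrite cReN; under eq_fun do rewrite cReN; exact: cvgN.
- rewrite cImN; under eq_fun do rewrite cImN; exact: cvgN.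
Qed.

Lemma ccontM f g x : ccont f x -> ccont g x -> ccont (fun y => f y * g y) x.
Proof.
move=> [f1 f2] [g1 g2]; split; rewrite /prop_for /continuous_at.
- by rewrite cReM; under eq_fun do rewrite cReM; apply: cvgB; exact: cvgM.
- by rewrite cImM; under eq_fun do rewrite cImM; apply: cvgD; exact: cvgM.
Qed.

Lemma ccont_cst z x : ccont (fun=> z) x.
Proof. by split; exact: cst_continuous. Qed.

Lemma ccontV f x : f x != 0 -> ccont f x -> ccont (fun y => (f y)^-1) x.
Proof.
move=> fx0 [f1 f2].
have n0 : complex.Re (f x) ^+ 2 + complex.Im (f x) ^+ 2 != 0.
  by rewrite -sqr_normc_ReIm expf_neq0// normc_eq0.
have cn : (fun y => (complex.Re (f y) ^+ 2 + complex.Im (f y) ^+ 2)^-1) @ x -->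
  (complex.Re (f x) ^+ 2 + complex.Im (f x) ^+ 2)^-1.
  by apply: cvgV => //; apply: cvgD; rewrite expr2;
    under eq_fun do rewrite expr2; exact: cvgM.
split; rewrite /prop_for /continuous_at.
- by rewrite cReV; under eq_fun do rewrite cReV; exact: cvgM.
- by rewrite cImV; under eq_fun do rewrite cImV; apply: cvgM => //; exact: cvgN.
Qed.

Lemma ccont_cexp f x : ccont f x -> ccont (fun y => cexp (f y)) x.
Proof.
move=> [f1 f2].
have e1 : expR (complex.Re (f y)) @[y --> x] --> expR (complex.Re (f x)).
  exact: (continuous_comp f1 (@continuous_expR _ _)).
have e2 : cos (complex.Im (f y)) @[y --> x] --> cos (complex.Im (f x)).
  exact: (continuous_comp f2 (@continuous_cos _ _)).
have e3 : sin (complex.Im (f y)) @[y --> x] --> sin (complex.Im (f x)).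
  exact: (continuous_comp f2 (@continuous_sin _ _)).
by split; exact: cvgM.
Qed.

End complex_calculus.

(** * Holomorphy in polar coordinates *)

Section polar_holomorphy.
Context {R : realType}.
Local Notation C := R[i].
Implicit Types (f g : R -> R -> C) (r p a b : R).

(** Cauchy-Riemann equations in the coordinate [ln r + i p]: [f'] is the derivative in that
    logarithm, that is [r] times the derivative in [r], or [W d/dW f] for a function of
    [W = r exp (i p)]. *)
Definition polar_hol f (f' : R -> R -> C) r p :=
  cderiv (f ^~ p) r (f' r p / r%:C%C) /\ cderiv (f r) p ('i%C * f' r p).

(** What differentiating under the integral in [p] and integrating back in [r] require on a sector.
    A single [M] bounds both [f] and [f'], which is why several witnesses below add two bounds. *)
Definition polar_regular r0 r1 a b f := exists f' : R -> R -> C, exists M : R,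
  forall r p, r0 <= r <= r1 -> a < p < b ->
  [/\ polar_hol f f' r p, normc (f r p) <= M, normc (f' r p) <= M &
      ccont (f' ^~ p) r].

(** The logarithm on its Riemann surface: [p] is any real number, so [polar_pow] has no branch cut
    and arguments past [pi] are legitimate. *)
Definition polar_log r p : C := (ln r +i* p)%C.

Definition polar_pow (c r p : R) : C := cexp (c%:C%C * polar_log r p).

Lemma polar_holD f f' g g' r p : polar_hol f f' r p -> polar_hol g g' r p ->
  polar_hol (fun r p => f r p + g r p) (fun r p => f' r p + g' r p) r p.
Proof.
move=> [f1 f2] [g1 g2]; split; rewrite ?mulrDl ?mulrDr; exact: cderivD.
Qed.

Lemma polar_holM f f' g g' r p : polar_hol f f' r p -> polar_hol g g' r p ->
  polar_hol (fun r p => f r p * g r p)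
    (fun r p => f' r p * g r p + f r p * g' r p) r p.
Proof.
move=> [f1 f2] [g1 g2]; split.
- have := cderivM f1 g1; congr cderiv; ring.
- have := cderivM f2 g2; congr cderiv; ring.
Qed.

Lemma polar_holV f f' r p : f r p != 0 -> polar_hol f f' r p ->
  polar_hol (fun r p => (f r p)^-1) (fun r p => - f' r p / (f r p) ^+ 2) r p.
Proof.
move=> f0 [f1 f2]; split.
- have := cderivV f0 f1; congr cderiv; ring.
- have := cderivV f0 f2; congr cderiv; ring.
Qed.

Lemma polar_hol_cexp f f' r p : polar_hol f f' r p ->
  polar_hol (fun r p => cexp (f r p)) (fun r p => f' r p * cexp (f r p)) r p.
Proof.
move=> [f1 f2]; split.
- have := cderiv_cexp f1; congr cderiv; ring.
- have := cderiv_cexp f2; congr cderiv; ring.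
Qed.

Lemma polar_hol_log r p : 0 < r -> polar_hol polar_log (fun _ _ => 1) r p.
Proof.
move=> r0; split.
- have -> : (1 : C) / r%:C%C = (r^-1)%:C%C by rewrite div1r fmorphV.
  by split => /=; [exact: is_derive1_ln|exact: is_derive_cst].
- rewrite mulr1; split => /=; [exact: is_derive_cst|exact: is_derive_id].
Qed.

Section regular.
Variables (r0 r1 a b : R) (r00 : 0 < r0).
Local Notation reg := (polar_regular r0 r1 a b).

Lemma regular_cst (z : C) : reg (fun _ _ => z).
Proof.
exists (fun _ _ => 0), (normc z) => r p hr hp; split=> //.
- by split; rewrite ?mul0r ?mulr0; exact: cderiv_cst.
- by rewrite normc0 normc_ge0.
- exact: ccont_cst.
Qed.

Lemma polar_regular_ccont f r p : r0 <= r <= r1 -> a < p < b ->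
  reg f -> ccont (f ^~ p) r.
Proof.
by move=> hr hp [f' [M /(_ _ _ hr hp)[[/cderiv_ccont]]]].
Qed.

Lemma regularD f g : reg f -> reg g -> reg (fun r p => f r p + g r p).
Proof.
move=> [f' [M hf]] [g' [N hg]].
exists (fun r p => f' r p + g' r p), (M + N) => r p hr hp.
have [f1 f2 f3 f4] := hf _ _ hr hp; have [g1 g2 g3 g4] := hg _ _ hr hp.
split; first exact: polar_holD.
- by rewrite (le_trans (le_normcD _ _))// lerD.
- by rewrite (le_trans (le_normcD _ _))// lerD.
- exact: ccontD.
Qed.

Lemma regularM f g : reg f -> reg g -> reg (fun r p => f r p * g r p).
Proof.
move=> [f' [M hf]] [g' [N hg]].
exists (fun r p => f' r p * g r p + f r p * g' r p), (M * N + M * N) => r p hr hp.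
have [f1 f2 f3 f4] := hf _ _ hr hp; have [g1 g2 g3 g4] := hg _ _ hr hp.
have MN : 0 <= M * N by rewrite mulr_ge0// (le_trans (normc_ge0 _) f2, le_trans (normc_ge0 _) g2).
split; first exact: polar_holM.
- by rewrite normcM (le_trans (ler_pM _ _ f2 g2)) ?normc_ge0// lerDl.
- rewrite (le_trans (le_normcD _ _))// !normcM lerD//.
  + by rewrite (le_trans (ler_pM _ _ f3 g2)) ?normc_ge0.
  + by rewrite (le_trans (ler_pM _ _ f2 g3)) ?normc_ge0.
- apply: ccontD; apply: ccontM => //.
  + by case: g1 => /cderiv_ccont.
  + by case: f1 => /cderiv_ccont.
Qed.

Lemma regularN f : reg f -> reg (fun r p => - f r p).
Proof.
move=> rf; under eq_fun do under eq_fun do rewrite -mulN1r.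
by apply: regularM => //; exact: regular_cst.
Qed.

Lemma regularX f n : reg f -> reg (fun r p => f r p ^+ n).
Proof.
move=> rf; elim: n => [|n IH]; first exact: regular_cst.
by under eq_fun do under eq_fun do rewrite exprS; exact: regularM.
Qed.

Lemma regularV (c : R) f : 0 < c ->
  (forall r p, r0 <= r <= r1 -> a < p < b -> c <= normc (f r p)) ->
  reg f -> reg (fun r p => (f r p)^-1).
Proof.
move=> c0 hc [f' [M hf]].
exists (fun r p => - f' r p / (f r p) ^+ 2), (M / c ^+ 2 + c^-1) => r p hr hp.
have [f1 f2 f3 f4] := hf _ _ hr hp.
have cf := hc _ _ hr hp.
have f0 : f r p != 0 by rewrite -normc_gt0 (lt_le_trans c0 cf).
have M0 : 0 <= M by exact: le_trans (normc_ge0 _) f2.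
split; first exact: polar_holV.
- by rewrite normcV ler_wpDl// ?divr_ge0 ?sqr_ge0// lef_pV2// posrE// (lt_le_trans c0 cf).
- rewrite normcM normcV normcN normcX ler_wpDr ?invr_ge0 ?(ltW c0)//.
  rewrite ler_pM ?normc_ge0 ?invr_ge0 ?exprn_ge0 ?normc_ge0//.
  rewrite lef_pV2 ?posrE ?exprn_gt0// ?(lt_le_trans c0 cf)//.
  by rewrite lerXn2r// ?nnegrE ?normc_ge0 ?(ltW c0).
- apply: ccontM; first exact: ccontN.
  apply: ccontV; first by rewrite expf_neq0.
  under eq_fun do rewrite expr2.
  by apply: ccontM; case: f1 => /cderiv_ccont.
Qed.

Lemma regular_cexp f : reg f -> reg (fun r p => cexp (f r p)).
Proof.
move=> [f' [M hf]].
exists (fun r p => f' r p * cexp (f r p)), (expR M + M * expR M) => r p hr hp.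
have [f1 f2 f3 f4] := hf _ _ hr hp.
have M0 : 0 <= M by exact: le_trans (normc_ge0 _) f2.
have eM : normc (cexp (f r p)) <= expR M.
  rewrite normc_cexp ler_expR (le_trans _ f2)//.
  by rewrite (le_trans (ler_norm _))// normr_Re_le.
split; first exact: polar_hol_cexp.
- by rewrite (le_trans eM)// lerDl mulr_ge0// expR_ge0.
- by rewrite normcM ler_wpDl ?expR_ge0// ler_pM ?normc_ge0.
- by apply: ccontM => //; apply: ccont_cexp; case: f1 => /cderiv_ccont.
Qed.

Lemma regular_log : reg polar_log.
Proof.
exists (fun _ _ => 1), (1 + `|ln r0| + `|ln r1| + `|a| + `|b|) => r p hr hp.
have /andP[rr0 rr1] := hr; have /andP[ap bp] := hp.
have rp : 0 < r by exact: lt_le_trans rr0.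
split.
- exact: polar_hol_log.
- rewrite -[polar_log r p]/((ln r +i* p)%C).
  have -> : (ln r +i* p)%C = (ln r)%:C%C + 'i%C * p%:C%C :> C.
    by apply: complexP; rewrite /= ?(mul0r, mulr0, mul1r, addr0, add0r, subr0).
  rewrite (le_trans (le_normcD _ _))// normcM normci mul1r !normcR.
  have l1 : `|ln r| <= `|ln r0| + `|ln r1|.
    have h0 : ln r0 <= ln r by rewrite ler_ln// posrE.
    have h1 : ln r <= ln r1 by rewrite ler_ln// posrE// (lt_le_trans rp rr1).
    move: h0 h1; case: (ler0P (ln r)); case: (ler0P (ln r0)); case: (ler0P (ln r1)); lra.
  have l2 : `|p| <= `|a| + `|b|.
    move: ap bp; case: (ler0P p); case: (ler0P a); case: (ler0P b); lra.
  lra.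
- rewrite normc1.
  by rewrite -!addrA lerDl !addr_ge0.
- exact: ccont_cst.
Qed.

Lemma regular_pow c : reg (polar_pow c).
Proof.
apply: regular_cexp; apply: regularM; [exact: regular_cst|exact: regular_log].
Qed.

End regular.

End polar_holomorphy.

(** * Rotation of a ray between two arcs *)

Section rotation.
Context {R : realType}.
Local Notation C := R[i].
Local Notation mu := (@lebesgue_measure R).

(** The relations of [polar_hol] turn the [p]-derivative of the integral into the variation of
    [Re f] from [r0] to [r1]; the final estimate thus sees [f] only on the two arcs, through [dl].
    The open interval []a, b[] makes the derivative available at the end points [p0] and [p1]. *)
Lemma rotation_bound (f : R -> R -> C) (r0 r1 a b p0 p1 dl : R) :
  0 < r0 < r1 -> a < p0 -> p0 <= p1 -> p1 < b ->
  polar_regular r0 r1 a b f ->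
  (forall p, p0 <= p <= p1 -> normc (f r0 p) <= dl /\ normc (f r1 p) <= dl) ->
  `|\int[mu]_(r in `[r0, r1]) (complex.Im (f r p1) / r)
    - \int[mu]_(r in `[r0, r1]) (complex.Im (f r p0) / r)|
  <= 2 * dl * (p1 - p0).
Proof.
move=> /andP[r00 r01] ap0 p01 p1b rf hdl.
have [f' [M hf]] := rf.
have rpos r : r0 <= r <= r1 -> 0 < r by move=> /andP[+ _]; exact: lt_le_trans.
have cinv r : r0 <= r <= r1 -> {for r, continuous (fun r : R => r^-1)}.
  by move=> /rpos rp; apply: inv_continuous; rewrite gt_eqF.
have cIm p : a < p < b -> forall r, r0 <= r <= r1 ->
    {for r, continuous (fun r => complex.Im (f r p) / r)}.
  move=> hp r hr; apply: cvgM; last exact: cinv.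
  by have [[/cderiv_ccont[]]] := hf _ _ hr hp.
have dJ p : a < p < b -> is_derive p 1
    (fun p => \int[mu]_(r in `[r0, r1]) (complex.Im (f r p) / r))
    (complex.Re (f r1 p) - complex.Re (f r0 p)).
  move=> hp.
  have <- : \int[mu]_(r in `[r0, r1]) (complex.Re (f' r p) / r) =
      complex.Re (f r1 p) - complex.Re (f r0 p).
    apply: (@Rintegral_FTC2 _ _ (fun r => complex.Re (f r p))) => // r hr.
      have [[[d1 _] _] _ _ _] := hf _ _ hr hp.
      apply: (is_derive_eq d1).
      by rewrite -fmorphV cReM/= mulr0 subr0.
    apply: cvgM; last exact: cinv.
    by have [_ _ _ []] := hf _ _ hr hp.
  apply: (@is_derive_under_integral _ _ _ mu (fun p r => complex.Im (f r p) / r)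
    (fun p r => complex.Re (f' r p) / r) _ p a b (fun=> M / r0)) => //.
  - by move=> q hq; apply: continuous_itvcc_integrable; exact: cIm.
  - move=> q r hq; rewrite /= in_itv/= => hr.
    have [[_ [_ d2]] _ _ _] := hf _ _ hr hq.
    have := is_derive1M d2 (is_derive_cst (r^-1) q 1) => d3.
    by apply: (is_derive_eq d3); rewrite mulr0 addr0 cImM/= mul0r mul1r add0r.
  - by apply: continuous_itvcc_integrable => r _; exact: cst_continuous.
  - move=> q r hq; rewrite /= in_itv/= => hr.
    have [_ _ h3 _] := hf _ _ hr hq.
    rewrite normrM normfV ler_pM//.
      exact: le_trans (normr_Re_le _) h3.
    have rp := rpos _ hr; rewrite gtr0_norm// lef_pV2//; by case/andP: hr.
apply: (@is_derive_lipschitz _ (fun p => \int[mu]_(r in `[r0, r1]) (complex.Im (f r p) / r)) _ _ _ _ p01).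
- move=> p /andP[h1 h2]; apply: dJ.
  by rewrite (lt_le_trans ap0 h1) (le_lt_trans h2 p1b).
- move=> p /hdl[h1 h2]; rewrite mulrDl mul1r (le_trans (ler_normB _ _))//.
  by rewrite lerD// (le_trans (normr_Re_le _)).
Qed.

End rotation.

(** * Integrable majorants on the half-line *)

Section decay.
Context {R : realType}.
Local Notation mu := (@lebesgue_measure R).
Local Notation Rpos := (`](0 : R), +oo[%classic).

Lemma integrable_oneDsqrV : mu.-integrable Rpos (fun r => ((1 + r ^+ 2)^-1)%:E).
Proof.
have int0 : mu.-integrable `[(0 : R), +oo[%classic (fun r => ((1 + r ^+ 2)^-1)%:E).
  apply/integrableP; split.
    apply/measurable_EFinP; apply: measurable_funTS.
    exact: (continuous_measurable_fun (@continuous_oneDsqrV R)).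
  rewrite (_ : (\int[_]_(x in _) _)%E = (pi / 2)%:E) ?ltry//.
  rewrite -integral0y_oneDsqr; apply: eq_integral => r _ /=.
  by rewrite ger0_norm// invr_ge0 addr_ge0 ?sqr_ge0.
apply: integrableS int0 => //; by apply: subset_itvr; rewrite bnd_simp.
Qed.

Lemma integrable_le_oneDsqrV (f : R -> R) (K : R) :
  (forall r, 0 < r -> {for r, continuous f}) ->
  (forall r, 0 < r -> `|f r| <= K / (1 + r ^+ 2)) ->
  mu.-integrable Rpos (EFin \o f).
Proof.
move=> cf hf; apply: (@le_Rintegrable _ _ _ mu Rpos f (fun r => K / (1 + r ^+ 2))) => //.
- exact: continuous_itvoy_measurable.
- rewrite (_ : EFin \o _ = (fun r => K%:E * ((1 + r ^+ 2)^-1)%:E)%E); last first.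
    by apply/funext => r; rewrite /= EFinM.
  exact: integrableZl integrable_oneDsqrV.
- by move=> r; rewrite /= in_itv/= andbT; exact: hf.
Qed.

(** Let [M = N + 2], the two extra powers paying for [1 + r ^ 2]. For [r <= 1] the polynomial is at
    most [2 ^ M] and the exponential at most 1. For [r > 1] one has [1 + r <= 2 * r], and the single
    term of order [k + 1] of the exponential series, with [(k + 1) * g >= M], absorbs [r ^ M]. The
    two summands of [K] are these two bounds. *)
Lemma expRN_powR_decay (a g : R) (N : nat) : 0 < a -> 0 < g ->
  exists2 K, 0 < K & forall r, 0 < r ->
    (1 + r) ^+ N * expR (- (a * r `^ g)) <= K / (1 + r ^+ 2).
Proof.
move=> a0 g0.
have [M MN] : exists M, M = N.+2 by exists N.+2.
have [k hk] : exists k : nat, M%:R <= k.+1%:R * g.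
  exists (Num.truncn (M%:R / g)).
  by rewrite -ler_pdivrMr// ltW// truncnS_gt.
have ak0 : 0 < a ^+ k.+1 by rewrite exprn_gt0.
have pA : 0 < 2 ^+ M :> R by exact: exprn_gt0.
have kf0 : 0 < (k.+1)`!%:R :> R by rewrite ltr0n fact_gt0.
have pB : 0 < 2 ^+ M * (k.+1)`!%:R / a ^+ k.+1 by rewrite divr_gt0// mulr_gt0.
pose K : R := 2 ^+ M + 2 ^+ M * (k.+1)`!%:R / a ^+ k.+1.
have K0 : 0 < K by exact: addr_gt0.
exists K => // r r0; rewrite ler_pdivlMr; last by rewrite ltr_wpDr ?sqr_ge0.
have h2 : 1 + r ^+ 2 <= (1 + r) ^+ 2 by nra.
have -> : (1 + r) ^+ N * expR (- (a * r `^ g)) * (1 + r ^+ 2) =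
  (1 + r) ^+ N * (1 + r ^+ 2) * expR (- (a * r `^ g)) by ring.
have h1 : (1 + r) ^+ N * (1 + r ^+ 2) <= (1 + r) ^+ M.
  by rewrite MN -[N.+2]addn2 exprD ler_wpM2l// exprn_ge0// addr_ge0// ltW.
rewrite (le_trans (ler_wpM2r (expR_ge0 _) h1))//.
have [r1|r1] := leP r 1.
  rewrite (@le_trans _ _ (2 ^+ M))//; last first.
    by rewrite lerDl ltW.
  rewrite -[leRHS]mulr1 ler_pM ?exprn_ge0 ?expR_ge0//.
  - by rewrite addr_ge0 ?ltW.
  - by rewrite lerXn2r ?nnegrE ?addr_ge0 ?(ltW r0)//; lra.
  - by rewrite -expR0 ler_expR oppr_le0 mulr_ge0 ?(ltW a0) ?powR_ge0.
rewrite (@le_trans _ _ (2 ^+ M * (k.+1)`!%:R / a ^+ k.+1))//; last first.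
  by rewrite lerDr ltW.
have av0 : 0 <= a * r `^ g by rewrite mulr_ge0 ?(ltW a0) ?powR_ge0.
have := @expR_ge1Dxn _ _ k av0 => he.
have rM : r ^+ M <= (r `^ g) ^+ k.+1.
  rewrite -!powR_mulrn ?powR_ge0 ?(ltW r0)// -powRrM mulrC ler_powR//.
  exact: ltW.
rewrite expRN ler_pdivrMr ?expR_gt0//.
rewrite (@le_trans _ _ (2 ^+ M * r ^+ M))//.
  rewrite -exprMn lerXn2r ?nnegrE ?addr_ge0 ?mulr_ge0 ?(ltW r0)//; lra.
rewrite -!mulrA ler_wpM2l ?exprn_ge0// (le_trans rM)//.
rewrite -ler_pdivrMl// mulrC ler_pdivlMl//.
move: he; rewrite exprMn => he; apply: le_trans he.
by rewrite mulrA lerDr ler01.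
Qed.

Lemma integrable_le_expRN_powR (f : R -> R) (K a g : R) (N : nat) :
  0 < a -> 0 < g ->
  (forall r, 0 < r -> {for r, continuous f}) ->
  (forall r, 0 < r -> `|f r| <= K * ((1 + r) ^+ N * expR (- (a * r `^ g)))) ->
  mu.-integrable Rpos (EFin \o f).
Proof.
move=> a0 g0 cf hf; have [L L0 hL] := @expRN_powR_decay a g N a0 g0.
apply: (@integrable_le_oneDsqrV _ (`|K| * L)) => // r r0.
rewrite (le_trans (hf _ r0))// -mulrA.
rewrite (@le_trans _ _ (`|K| * ((1 + r) ^+ N * expR (- (a * r `^ g)))))//.
  rewrite ler_wpM2r ?ler_norm// mulr_ge0 ?expR_ge0// exprn_ge0// addr_ge0//.
  exact: ltW.
by rewrite ler_wpM2l// hL.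
Qed.

Lemma integrable_expRN_powR (K a g : R) (N : nat) : 0 < a -> 0 < g ->
  mu.-integrable Rpos
    (EFin \o (fun r => K * ((1 + r) ^+ N * expR (- (a * r `^ g))))).
Proof.
move=> a0 g0; apply: (@integrable_le_expRN_powR _ `|K| a g N) => // r r0.
  apply: cvgM; first exact: cvg_cst.
  apply: cvgM.
    apply: (@continuous_comp _ _ _ (fun r : R => 1 + r) (fun y => y ^+ N)).
      by apply: cvgD; [exact: cvg_cst|exact: cvg_id].
    exact: exprn_continuous.
  apply: (@continuous_comp _ _ _ (fun r : R => - (a * r `^ g)) expR).
    apply: cvgN; apply: cvgM; first exact: cvg_cst.
    exact: (is_derive1_continuous (is_derive1_powR g r0)).
  exact: continuous_expR.
rewrite normrM [X in _ * X]ger0_norm// mulr_ge0 ?expR_ge0// exprn_ge0//.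
by rewrite addr_ge0// ltW.
Qed.

End decay.

(** * Distance from a positive point to a ray, and the contour angle *)

Section polar_facts.
Context {R : realType}.
Local Notation C := R[i].
Implicit Types r p c s : R.

Lemma polar_powE c r p : 0 < r -> polar_pow c r p =
  ((r `^ c * cos (c * p)) +i* (r `^ c * sin (c * p)))%C.
Proof.
move=> r0; rewrite /polar_pow /polar_log /cexp; apply: complexP => /=;
  by rewrite !mul0r subr0 addr0 /powR gt_eqF.
Qed.

Lemma normc_polar_pow c r p : 0 < r -> normc (polar_pow c r p) = r `^ c.
Proof.
move=> r0; rewrite /polar_pow normc_cexp /polar_log /= mul0r subr0.
by rewrite /powR gt_eqF.
Qed.

Lemma polar_powD c d r p :
  polar_pow (c + d) r p = polar_pow c r p * polar_pow d r p.
Proof. by rewrite /polar_pow rmorphD mulrDl cexpD. Qed.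

Lemma polar_pow_natmul n c r p :
  polar_pow (c *+ n) r p = polar_pow c r p ^+ n.
Proof. by rewrite /polar_pow -cexpMn rmorphMn mulrnAl. Qed.

Lemma polar_pow1E r p : 0 < r ->
  polar_pow 1 r p = ((r * cos p) +i* (r * sin p))%C.
Proof. by move=> r0; rewrite polar_powE// powRr1 ?ltW// mul1r. Qed.

(** The distance to the point of polar coordinates [(r, p)] splits into a radial and an angular
    part, both nonnegative for positive [s]. The first serves away from the pole, the second at
    angles bounded away from 0; when [cos p <= 0] the distance is at least [s] and at least [r]. *)
Lemma sqr_normc_sub_polar s r p : 0 < r ->
  normc (s%:C%C - polar_pow 1 r p) ^+ 2 =
  (s - r) ^+ 2 + 2 * s * r * (1 - cos p).
Proof.
move=> r0; rewrite sqr_normc_ReIm cReD cImD cReN cImN polar_pow1E//=.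
rewrite sub0r sqrrN exprMn sin2cos2; ring.
Qed.

Lemma normc_sub_polar_ge s r p : 0 < s -> 0 < r ->
  `|s - r| <= normc (s%:C%C - polar_pow 1 r p).
Proof.
move=> s0 r0; rewrite -(@ler_pXn2r _ 2)// ?nnegrE ?normc_ge0//.
rewrite sqr_normc_sub_polar// real_normK ?num_real// lerDl.
by rewrite mulr_ge0 ?subr_ge0 ?cos_le1// !mulr_ge0// ltW.
Qed.

Lemma normc_sub_polar_ge_sin s r p : 0 < r ->
  r * `|sin p| <= normc (s%:C%C - polar_pow 1 r p).
Proof.
move=> r0; rewrite -[X in X * _](gtr0_norm r0) -normrM.
rewrite (le_trans _ (normr_Im_le _))// cImD cImN polar_pow1E//=.
by rewrite sub0r normrN.
Qed.

Lemma normc_sub_polar_ge_cos s r p : 0 < s -> 0 < r -> cos p <= 0 ->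
  s <= normc (s%:C%C - polar_pow 1 r p) /\
  r <= normc (s%:C%C - polar_pow 1 r p).
Proof.
move=> s0 r0 cp; split; rewrite -(@ler_pXn2r _ 2)// ?nnegrE ?normc_ge0 ?ltW//.
all: rewrite sqr_normc_sub_polar//.
all: have : 0 <= - (s * r * cos p) by rewrite oppr_ge0 mulr_ge0_le0// mulr_ge0 ?ltW.
all: nra.
Qed.

(** The derivative of [q - sin q] is at most [1 - cos 1] on [[0, 1]]. The bound converts a small
    angle [p] into the distance [r * |sin p|] to the real axis. *)
Lemma sin_ge_linear p : 0 <= p <= 1 -> cos 1 * p <= sin p.
Proof.
move=> /andP[p0 p1].
have := @is_derive_lipschitz R (fun q => q - sin q) (fun q => 1 - cos q) 0 p (1 - cos 1) p0.
rewrite sin0 subrr !subr0 => h.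
have hp : `|p - sin p| <= (1 - cos 1) * p.
  apply: h => q /andP[q0 qp].
  rewrite ger0_norm ?subr_ge0 ?cos_le1// lerD2l lerN2.
  have q1 : q <= 1 by exact: le_trans p1.
  have pi2 := @pi_ge2 R.
  move: q1; rewrite le_eqVlt => /predU1P[->//|q1].
  by rewrite ltW// ltr_cos// in_itv/=; apply/andP; split=> //; lra.
by have := le_trans (ler_norm _) hp; lra.
Qed.

End polar_facts.

Lemma powR_le_oneD {R : realType} (c r : R) : 0 <= c -> c <= 1 -> 0 <= r -> r `^ c <= 1 + r.
Proof.
move=> c0 c1 r0; have [r1|r1] := leP r 1.
  rewrite (@le_trans _ _ 1)//; last by rewrite lerDl.
  by rewrite -[leRHS](congr1 (@^~ c) (powR1 R)) ge0_ler_powR// ?nnegrE.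
by rewrite (le_trans (ler1_powR (ltW r1) c1))// lerDr.
Qed.

Lemma normc_subr_polar_pow_le {R : realType} (c l r p : R) :
  0 <= c -> c <= 1 -> 0 <= l -> 0 < r ->
  normc (l%:C%C - polar_pow c r p) <= (l + 1) * (1 + r).
Proof.
move=> c0 c1 l0 r0; rewrite (le_trans (le_normcD _ _))// normcN normcR.
rewrite normc_polar_pow// ger0_norm//.
have := powR_le_oneD c0 c1 (ltW r0).
have : 0 <= l * r by rewrite mulr_ge0// ltW.
by rewrite mulrDr mulr1 mulrDl mul1r; lra.
Qed.

Lemma sinM_pi_gt0 {R : realType} (c : R) : 0 < c -> c < 1 -> 0 < sin (c * pi).
Proof. by move=> c0 c1; rewrite sin_gt0_pi// mulr_gt0 ?pi_gt0//= gtr_pMl ?pi_gt0. Qed.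

Section angle.
Context {R : realType}.
Variable beta : R.
Hypotheses (b0 : 0 < beta) (b1 : beta < 1).

(** Any angle strictly between [pi / 2] and the smaller of [pi] and [pi / (2 * beta)] would do. With
    this choice [beta * th = pi - th], so that [cos (beta * th) = - cos th]: the coefficients of
    decay in [r ^ beta] and in [r] are equal. *)
Definition contour_angle : R := pi / (1 + beta).
Local Notation th := contour_angle.

Lemma contour_angle_gt : pi / 2 < th.
Proof.
have h : 0 < 1 + beta by move: b0; lra.
by rewrite ltr_pM2l ?pi_gt0// ltf_pV2 ?posrE//; move: b1; lra.
Qed.

Lemma contour_angle_lt : th < pi.
Proof. by rewrite ltr_pdivrMr ?addr_gt0// ltr_pMr ?pi_gt0// ltrDl. Qed.

Lemma contour_angle_gt0 : 0 < th.
Proof. by rewrite divr_gt0 ?pi_gt0 ?addr_gt0. Qed.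

Lemma contour_angleM_lt : beta * th < pi / 2.
Proof.
have h : 0 < 1 + beta by move: b0; lra.
by rewrite /contour_angle mulrCA ltr_pM2l ?pi_gt0// ltr_pdivrMr//; move: b1; lra.
Qed.

Lemma cos_contour_lt0 : cos th < 0.
Proof.
rewrite -cos_pihalf ltr_cos ?contour_angle_gt// in_itv/=; apply/andP; split.
- by rewrite divr_ge0 ?pi_ge0.
- have := @pi_ge0 R; lra.
- exact: ltW contour_angle_gt0.
- exact: ltW contour_angle_lt.
Qed.

Lemma cosM_contour_gt0 : 0 < cos (beta * th).
Proof.
apply: cos_gt0_pihalf; rewrite contour_angleM_lt andbT.
have h : 0 <= beta * th by rewrite mulr_ge0 ?(ltW b0) ?(ltW contour_angle_gt0).
by apply: lt_le_trans h; rewrite oppr_lt0 divr_gt0 ?pi_gt0.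
Qed.

Lemma cosM_contour_le p : 0 <= p <= th -> cos (beta * th) <= cos (beta * p).
Proof.
move=> /andP[p0 pth].
have h : beta * p <= beta * th by rewrite ler_wpM2l// ltW.
move: h; rewrite le_eqVlt => /predU1P[->//|h].
have h2 := contour_angleM_lt.
have h3 := @pi_ge0 R.
have h4 : 0 <= beta * p by rewrite mulr_ge0// ltW.
by rewrite ltW// ltr_cos// in_itv/=; apply/andP; split; lra.
Qed.

End angle.

(** * Values on the real axis and first-order vanishing at a point *)

Section cauchy_aux.
Context {R : realType}.
Local Notation C := R[i].
Local Notation mu := (@lebesgue_measure R).

Lemma cImD0 (z w : C) : complex.Im z = 0 -> complex.Im w = 0 ->
  complex.Im (z + w) = 0.
Proof. by move=> z0 w0; rewrite cImD z0 w0 addr0. Qed.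

Lemma cImN0 (z : C) : complex.Im z = 0 -> complex.Im (- z) = 0.
Proof. by move=> z0; rewrite cImN z0 oppr0. Qed.

Lemma cImM0 (z w : C) : complex.Im z = 0 -> complex.Im w = 0 ->
  complex.Im (z * w) = 0.
Proof. by move=> z0 w0; rewrite cImM z0 w0 mulr0 mul0r addr0. Qed.

Lemma cImZ (a : R) (z : C) : complex.Im (a%:C%C * z) = a * complex.Im z.
Proof. by rewrite cImM /= mul0r addr0. Qed.

Lemma cReZ (a : R) (z : C) : complex.Re (a%:C%C * z) = a * complex.Re z.
Proof. by rewrite cReM /= mul0r subr0. Qed.

Lemma cImV0 (z : C) : complex.Im z = 0 -> complex.Im z^-1 = 0.
Proof. by move=> z0; rewrite cImV z0 oppr0 mul0r. Qed.

Lemma cIm_cexp0 (z : C) : complex.Im z = 0 -> complex.Im (cexp z) = 0.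
Proof. by move=> z0; rewrite /= z0 sin0 mulr0. Qed.

Lemma cexpR (x : R) : cexp x%:C%C = (expR x)%:C%C.
Proof. by apply: complexP; rewrite /= ?cos0 ?sin0 ?mulr1 ?mulr0. Qed.

Lemma normc_le_ReIm (z : C) :
  normc z <= `|complex.Re z| + `|complex.Im z|.
Proof.
rewrite [X in normc X](_ : z = (complex.Re z)%:C%C + 'i%C * (complex.Im z)%:C%C).
  by rewrite (le_trans (le_normcD _ _))// normcM normci mul1r !normcR.
by apply: complexP; rewrite ?cReD ?cImD ?cReM ?cImM /= ?(mul0r, mulr0, mul1r, subr0, addr0, add0r).
Qed.

Lemma ccont_polar_pow_arg (c r p : R) : 0 < r -> ccont (polar_pow c r) p.
Proof.
move=> r0; apply: ccont_cexp; apply: ccontM; first exact: ccont_cst.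
exact: (cderiv_ccont (proj2 (polar_hol_log p r0))).
Qed.

(** A point is reached from [(s, 0)] along the positive axis and then along an arc, at rates
    [M / r0] and [M]. Applied to a numerator that vanishes at a pole, this is the cancellation that
    keeps the quotient bounded. *)
Lemma polar_regular_lipschitz (g : R -> R -> C) (r0 r1 a b s : R) :
  0 < r0 -> r0 <= s <= r1 -> a < 0 < b -> polar_regular r0 r1 a b g ->
  g s 0 = 0 ->
  exists2 M, 0 <= M & forall r p, r0 <= r <= r1 -> 0 <= p < b ->
    normc (g r p) <= M * (`|r - s| + p).
Proof.
move=> r00 hs /andP[a0 b0] [g' [M hg]] gs0.
have M0 : 0 <= M.
  have ab : a < 0 < b by rewrite a0 b0.
  have [_ h _ _] := hg s 0 hs ab; exact: le_trans (normc_ge0 _) h.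
have rpos r : r0 <= r <= r1 -> 0 < r by move=> /andP[+ _]; exact: lt_le_trans.
have h0 : a < 0 < b by rewrite a0 b0.
have hquot r p : r0 <= r <= r1 -> normc (g' r p) <= M ->
    normc (g' r p / r%:C%C) <= M / r0.
  move=> hr hM; rewrite normcM normcV normcR gtr0_norm ?rpos//.
  rewrite ler_pM ?normc_ge0 ?invr_ge0 ?(ltW (rpos _ hr))//.
  by rewrite lef_pV2 ?posrE ?(rpos _ hr)//; case/andP: hr.
(* The mean value inequality is used on real functions, so [P] runs over the real and the imaginary
   part; the final factor 2 adds the two. *)
have lr (P : C -> R) : (P = @complex.Re R \/ P = @complex.Im R) ->
    forall r, r0 <= r <= r1 -> `|P (g r 0)| <= M / r0 * `|r - s|.
  move=> hP r hr.
  have dP q : r0 <= q <= r1 -> is_derive q 1 (fun q => P (g q 0)) (P (g' q 0 / q%:C%C)).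
    by move=> hq; have [[[? ?] _] _ _ _] := hg _ _ hq h0; case: hP => ->.
  have bP q : r0 <= q <= r1 -> `|P (g' q 0 / q%:C%C)| <= M / r0.
    move=> hq; have [_ _ h _] := hg _ _ hq h0.
    apply: le_trans (hquot _ _ hq h); case: hP => ->; [exact: normr_Re_le|exact: normr_Im_le].
  have Pgs : P (g s 0) = 0 by rewrite gs0; case: hP => ->.
  have [rs|sr] := leP r s.
    have := @is_derive_lipschitz R (fun q => P (g q 0)) (fun q => P (g' q 0 / q%:C%C)) r s (M / r0) rs.
    rewrite Pgs sub0r normrN distrC (ger0_norm (_ : 0 <= s - r)) ?subr_ge0//; apply.
    - move=> q /andP[rq qs]; apply: dP; case/andP: hr => [r0r _]; case/andP: hs => [_ s1].
      by rewrite (le_trans r0r)// (le_trans qs).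
    - move=> q /andP[rq qs]; apply: bP; case/andP: hr => [r0r _]; case/andP: hs => [_ s1].
      by rewrite (le_trans r0r)// (le_trans qs).
  have := @is_derive_lipschitz R (fun q => P (g q 0)) (fun q => P (g' q 0 / q%:C%C)) s r (M / r0) (ltW sr).
  rewrite Pgs subr0 (ger0_norm (_ : 0 <= r - s)) ?subr_ge0 ?(ltW sr)//; apply.
  - move=> q /andP[rq qs]; apply: dP; case/andP: hr => [_ r1r]; case/andP: hs => [s1 _].
    by rewrite (le_trans s1)// (le_trans qs).
  - move=> q /andP[rq qs]; apply: bP; case/andP: hr => [_ r1r]; case/andP: hs => [s1 _].
    by rewrite (le_trans s1)// (le_trans qs).
have lp (P : C -> R) : (P = @complex.Re R \/ P = @complex.Im R) ->
    forall r p, r0 <= r <= r1 -> 0 <= p < b -> `|P (g r p)| <= M / r0 * `|r - s| + M * p.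
  move=> hP r p hr /andP[p0 pb].
  have hq q : 0 <= q <= p -> a < q < b.
    by move=> /andP[q0 qp]; rewrite (lt_le_trans a0)//= (le_lt_trans qp).
  have h : `|P (g r p) - P (g r 0)| <= M * (p - 0).
    apply: (@is_derive_lipschitz R (fun q => P (g r q)) (fun q => P ('i%C * g' r q))) => // q /hq ab.
      by have [[_ [? ?]] _ _ _] := hg _ _ hr ab; case: hP => ->.
    have [_ _ h _] := hg _ _ hr ab.
    have e : normc ('i%C * g' r q) <= M by rewrite normcM normci mul1r.
    by apply: le_trans e; case: hP => ->; [exact: normr_Re_le|exact: normr_Im_le].
  rewrite subr0 in h.
  rewrite -[P (g r p)](subrK (P (g r 0))) addrC (le_trans (ler_normD _ _))// lerD//.
  exact: lr.
exists (2 * (M / r0 + M)).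
  by rewrite mulr_ge0// addr_ge0// divr_ge0// ltW.
move=> r p hr hp; rewrite (le_trans (normc_le_ReIm _))//.
have := lp _ (or_introl erefl) _ _ hr hp; have := lp _ (or_intror erefl) _ _ hr hp.
have A0 : 0 <= M / r0 by rewrite divr_ge0// ltW.
have p0 : 0 <= p by case/andP: hp.
have n0 : 0 <= `|r - s| by [].
have n1 : 0 <= M * `|r - s| by rewrite mulr_ge0.
have n2 : 0 <= M / r0 * p by rewrite mulr_ge0.
rewrite mulrDr; lra.
Qed.

Lemma powRD_gt0 (a r s : R) : 0 < a -> a `^ (r + s) = a `^ r * a `^ s.
Proof. by move=> a0; rewrite powRD// (gt_eqF a0) implybT. Qed.

Lemma powRN_harmonic_cvg0 (a : R) : 0 < a ->
  (n.+1%:R : R) `^ (- a) @[n --> \oo] --> (0 : R).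
Proof.
move=> a0; apply/cvgr0Pnorm_le => e e0; near=> n.
have e1 : 0 < e `^ (- a^-1) by exact: powR_gt0.
have h : e `^ (- a^-1) <= n%:R by near: n; exact: nbhs_infty_ger.
have h1 : e `^ (- a^-1) <= n.+1%:R by rewrite (le_trans h)// ler_nat.
rewrite ger0_norm ?powR_ge0// powRN.
rewrite -[leRHS]invrK lef_pV2 ?posrE ?invr_gt0 ?powR_gt0//.
have -> : e^-1 = (e `^ (- a^-1)) `^ a.
  by rewrite -powRrM mulNr mulVf ?gt_eqF// powR_inv1// ltW.
by rewrite ge0_ler_powR// ?nnegrE ?ltW.
Unshelve. all: by end_near. Qed.

End cauchy_aux.

(** * A kernel with a pole and an elementary primitive *)

Section sqrt_kernel.
Context {R : realType}.
Local Notation C := R[i].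
Local Notation mu := (@lebesgue_measure R).
Variables (sg th : R).
Local Notation S := (sin (th / 2)).
Local Notation W := (@polar_pow R 1).
Hypotheses (s0 : 0 < sg) (S0 : 0 < S).

(** The integral that stands in for a residue. The power 1/2 makes the kernel of order [r ^ (1/2)]
    at 0 and [r ^ (-1/2)] at infinity, hence integrable against [dr / r], and gives it an elementary
    primitive. *)
Definition sqrt_kernel (r : R) : C :=
  (sg `^ 2^-1)%:C%C * polar_pow 2^-1 r th * (sg%:C%C - W r th)^-1.

(** An exponential of the logarithm, so that positivity holds for every argument and the derivative
    follows from the chain rule. *)
Let sqrt_fun (r : R) := expR (2^-1 * ln r).
Let sqrt_funE (r : R) : 0 < r -> sqrt_fun r = r `^ 2^-1 /\ sqrt_fun r ^+ 2 = r.
Proof.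
move=> r0; rewrite /sqrt_fun /powR gt_eqF//; split=> //.
by rewrite expr2 -expRD -mulrDl -div1r -splitr mul1r lnK// posrE.
Qed.

(** With [r = sg * exp (2 * v)] this is [sinh v / S]. It runs over the whole line, so its arctangent
    increases by [pi]: this is the [pi] of the Cauchy formula. *)
Let u r := (sqrt_fun r / sqrt_fun sg - sqrt_fun sg / sqrt_fun r) / (2 * S).

Lemma is_derive_sqrt_kernel (r : R) : 0 < r ->
  is_derive r 1 (fun r => atan (u r)) (complex.Im (sqrt_kernel r) / r).
Proof.
move=> r0.
have q0 : 0 < sqrt_fun r by exact: expR_gt0.
have sq0 : 0 < sqrt_fun sg by exact: expR_gt0.
have [qE q2] := sqrt_funE r0; have [sE s2] := sqrt_funE s0.
have dq : is_derive r 1 sqrt_fun (sqrt_fun r * (2^-1 / r)).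
  apply: (is_derive1_comp (is_derive_expR _)).
  have d := is_derive1M (is_derive_cst (2^-1 : R) r 1) (is_derive1_ln r0).
  by apply: (is_derive_eq d); rewrite mul0r add0r.
have du : is_derive r 1 u ((sqrt_fun r * (2^-1 / r)) *
    ((sqrt_fun sg)^-1 + sqrt_fun sg / sqrt_fun r ^+ 2) / (2 * S)).
  have d1 := is_derive1M dq (is_derive_cst (sqrt_fun sg)^-1 r 1).
  have dV := @is_derive1V R sqrt_fun r _ (lt0r_neq0 q0) dq.
  have d2 := is_derive1M (is_derive_cst (sqrt_fun sg) r 1) dV.
  have d3 := is_derive1M (is_derive1B d1 d2) (is_derive_cst (2 * S)^-1 r 1).
  apply: (is_derive_eq d3).
  rewrite /GRing.scale/= mulr0 addr0 mul0r add0r mulr0 addr0; congr (_ * _).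
  by ring.
have da := is_derive1_comp (is_derive1_atan (u r)) du.
apply: (is_derive_eq da).
(* Half-angle formulas express everything through [S] and [cos (th / 2)], whose square is then
   eliminated. *)
have thE : th = (th / 2) *+ 2 by rewrite -mulr_natr divfK.
have c2 : cos th = 1 - 2 * S ^+ 2 by rewrite {1}thE cos_mulr2n cos2sin2; ring.
have s2' : sin th = 2 * S * cos (th / 2) by rewrite {1}thE sin_mulr2n; ring.
have NE : normc (sg%:C%C - W r th) ^+ 2 = (sg - r) ^+ 2 + 4 * sg * r * S ^+ 2.
  rewrite sqr_normc_sub_polar// c2; ring.
have N1 : (sg - r) ^+ 2 + 4 * sg * r * S ^+ 2 != 0.
  by rewrite gt_eqF// ltr_wpDl ?sqr_ge0// !mulr_gt0// exprn_gt0.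
have -> : complex.Im (sqrt_kernel r) = sqrt_fun sg * sqrt_fun r * S * (sg + r) /
    ((sg - r) ^+ 2 + 4 * sg * r * S ^+ 2).
  rewrite -NE sqr_normc_ReIm /sqrt_kernel cImM cReM cImM cReV cImV.
  rewrite !cReD !cImD !cReN !cImN polar_pow1E// polar_powE//= -qE -sE.
  rewrite (mulrC 2^-1 th) -/S c2 s2'.
  move: (((sg - r * (1 - 2 * S ^+ 2)) ^+ 2 + (0 - r * (2 * S * cos (th / 2))) ^+ 2)^-1) => Z.
  have e := cos2Dsin2 (th / 2).
  have {}e : cos (th / 2) ^+ 2 = 1 - S ^+ 2 by move: e; lra.
  move: (cos (th / 2)) e => co e.
  transitivity (sqrt_fun sg * sqrt_fun r * Z * (2 * r * S * co ^+ 2 + S * (sg - r * (1 - 2 * S ^+ 2)))).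
    ring.
  rewrite e; ring.
rewrite /u; move: N1 q0 sq0; move: s2 q2.
move: (sqrt_fun r) (sqrt_fun sg) => q s s2 q2.
rewrite -s2 -q2 => N1 q0 sq0.
have S0' := S0.
by field; apply/and4P; split=> //; exact: lt0r_neq0.
Qed.

Let sqrt_cvgy : sqrt_fun n.+1%:R @[n --> \oo] --> +oo.
Proof.
apply/cvgryPge => A; near=> n.
have h : expR (2 * A) <= n%:R by near: n; exact: nbhs_infty_ger.
have h1 : expR (2 * A) <= n.+1%:R by rewrite (le_trans h)// ler_nat.
have h2 : 2 * A <= ln n.+1%:R by rewrite -[leLHS]expRK ler_ln ?posrE ?expR_gt0//.
rewrite /sqrt_fun (@le_trans _ _ (1 + 2^-1 * ln n.+1%:R)) ?expR_ge1Dx//; lra.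
Unshelve. all: by end_near. Qed.

Let atan_u_cvg :
  atan (u n.+1%:R) @[n --> \oo] --> pi / 2 /\
  atan (u n.+1%:R^-1) @[n --> \oo] --> - (pi / 2).
Proof.
have sq0 : 0 < sqrt_fun sg by exact: expR_gt0.
have uV (n : nat) : u n.+1%:R^-1 =
    - ((sqrt_fun n.+1%:R * sqrt_fun sg - (sqrt_fun n.+1%:R * sqrt_fun sg)^-1) / (2 * S)).
  have e : sqrt_fun n.+1%:R^-1 = (sqrt_fun n.+1%:R)^-1.
    by rewrite /sqrt_fun lnV ?posrE// mulrN expRN.
  rewrite /u e invrK invfM; field; rewrite !gt_eqF ?expR_gt0//.
(* Both ends reduce to this form. With [s] the square root of [sg], the coefficients are [1 / s] and
   [s] at [n + 1]; at the inverse radius they trade places and the sign changes. *)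
have grow (A B : R) : 0 < A -> 0 < B ->
    (A * sqrt_fun n.+1%:R - B / sqrt_fun n.+1%:R) / (2 * S) @[n --> \oo] --> +oo.
  move=> A0 B0; apply/cvgryPge => M; near=> n.
  have q1 : 1 <= sqrt_fun n.+1%:R by near: n; move/cvgryPge : sqrt_cvgy; exact.
  have q2 : (M * (2 * S) + B) / A <= sqrt_fun n.+1%:R.
    by near: n; move/cvgryPge : sqrt_cvgy; exact.
  rewrite ler_pdivlMr ?mulr_gt0//.
  move: q2; rewrite ler_pdivrMr// mulrC => q2.
  have : B / sqrt_fun n.+1%:R <= B.
    by rewrite ler_pdivrMr ?(lt_le_trans ltr01)// ler_pMr.
  lra.
have sqV0 : 0 < (sqrt_fun sg)^-1 by rewrite invr_gt0.
split.
  apply: (cvg_comp (fun n : nat => u n.+1%:R) _ _ (@cvgy_atan R)).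
  rewrite (_ : (fun n : nat => _) = (fun n : nat => ((sqrt_fun sg)^-1 * sqrt_fun n.+1%:R -
      sqrt_fun sg / sqrt_fun n.+1%:R) / (2 * S))); first exact: grow.
  by apply/funext => n; rewrite /u; ring.
under eq_fun do rewrite uV atanN.
apply: cvgN.
apply: (cvg_comp (fun n : nat => (sqrt_fun n.+1%:R * sqrt_fun sg -
  (sqrt_fun n.+1%:R * sqrt_fun sg)^-1) / (2 * S)) _ _ (@cvgy_atan R)).
rewrite (_ : (fun n : nat => _) = (fun n : nat => (sqrt_fun sg * sqrt_fun n.+1%:R -
    (sqrt_fun sg)^-1 / sqrt_fun n.+1%:R) / (2 * S))); first exact: grow.
by apply/funext => n; rewrite invfM; ring.
Unshelve. all: by end_near. Qed.

Lemma continuous_sqrt_kernel (r : R) : 0 < r ->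
  {for r, continuous (fun r => complex.Im (sqrt_kernel r) / r)}.
Proof.
move=> r0; apply: cvgM; last by apply: inv_continuous; rewrite gt_eqF.
have [_ //] : ccont sqrt_kernel r.
have cP c : ccont (polar_pow c ^~ th) r.
  apply: ccont_cexp; apply: ccontM; first exact: ccont_cst.
  exact: (cderiv_ccont (proj1 (polar_hol_log th r0))).
apply: ccontM.
  by apply: ccontM; [exact: ccont_cst|exact: cP].
apply: ccontV; last first.
  by apply: ccontD; [exact: ccont_cst|apply: ccontN; exact: cP].
rewrite -normc_eq0 -sqrf_eq0 sqr_normc_sub_polar//.
have thE : th = (th / 2) *+ 2 by rewrite -mulr_natr divfK.
have -> : 1 - cos th = 2 * S ^+ 2 by rewrite {1}thE cos_mulr2n cos2sin2; ring.
by rewrite gt_eqF// ltr_wpDl ?sqr_ge0// !mulr_gt0// exprn_gt0.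
Qed.

Lemma Rintegral_sqrt_kernel_cvg :
  \int[mu]_(r in `[n.+1%:R^-1, n.+1%:R]) (complex.Im (sqrt_kernel r) / r)
    @[n --> \oo] --> pi.
Proof.
have [c1 c2] := atan_u_cvg.
have -> : (pi : R) = pi / 2 - - (pi / 2) by rewrite opprK -splitr.
apply: cvg_trans (cvgB c1 c2); apply: near_eq_cvg; near=> n.
have n1 : 1 < n.+1%:R :> R.
  by rewrite ltr1n ltnS; near: n; exact: nbhs_infty_gt.
have np : 0 < n.+1%:R^-1 :> R by rewrite invr_gt0.
have lt1 : n.+1%:R^-1 < n.+1%:R :> R by rewrite (@lt_trans _ _ 1)// invf_lt1.
symmetry; apply: (@Rintegral_FTC2 R _ (fun r => atan (u r)) _ _ lt1).
- move=> r /andP[h _]; apply: is_derive_sqrt_kernel; exact: lt_le_trans h.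
- move=> r /andP[h _]; apply: continuous_sqrt_kernel; exact: lt_le_trans h.
Unshelve. all: by end_near. Qed.

End sqrt_kernel.

(** * Cauchy formula on the two rays of angle pi / (1 + beta) *)

Section cauchy_formula.
Context {R : realType}.
Local Notation C := R[i].
Local Notation mu := (@lebesgue_measure R).
Local Notation Rpos := (`](0 : R), +oo[%classic).
Variables (beta L x sg : R).
Hypotheses (b0 : 0 < beta) (b1 : beta < 1) (x0 : 0 < x) (s0 : 0 < sg).
Local Notation th := (contour_angle beta).
Local Notation W := (@polar_pow R 1).

Definition stable_factor (x L r p : R) : C :=
  cexp (x%:C%C * (L%:C%C - polar_pow beta r p)).

Local Notation F := (stable_factor x L).
Let c : R := expR (x * (L - sg `^ beta)).
Let k : R := c * sg `^ 2^-1.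

(* Rotating the ray to angle 0 meets the pole W = sg.  Subtracting the multiple k
   of W^(-1/2) that agrees with F at sg removes it; the integral of the
   subtracted term is explicit (sqrt_kernel). *)
Let g r p : C := F r p - k%:C%C * polar_pow (- 2^-1) r p.
Let V r p : C := (sg%:C%C - W r p)^-1.
Let f1 r p : C := W r p * g r p * V r p.

Lemma normc_stable_factor r p : 0 < r ->
  normc (F r p) = expR (x * L) * expR (- (x * cos (beta * p) * r `^ beta)).
Proof.
move=> r0; rewrite normc_cexp -expRD polar_powE//=; congr expR; ring.
Qed.

Lemma normc_stable_factor_le r p : 0 < r -> 0 <= p <= th ->
  normc (F r p) <= expR (x * L) * expR (- (x * cos (beta * th) * r `^ beta)).
Proof.
move=> r0 hp; rewrite normc_stable_factor// ler_wpM2l ?expR_ge0// ler_expR lerN2.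
by rewrite ler_wpM2r ?powR_ge0// ler_wpM2l ?(ltW x0)// cosM_contour_le.
Qed.

Let reg_g r0 r1 a b : 0 < r0 -> polar_regular r0 r1 a b g.
Proof.
move=> r00; apply: regularD.
  apply: regular_cexp; apply: regularM; first exact: regular_cst.
  apply: regularD; first exact: regular_cst.
  by apply: regularN => //; exact: regular_pow.
apply: regularN => //; apply: regularM; first exact: regular_cst.
exact: regular_pow.
Qed.

(** The pole lies on the ray of angle 0. Dropping the radial part of the distance leaves an angular
    lower bound that degenerates as [e] tends to 0, so the sector must stay off the axis. *)
Lemma regular_sub_polarV r0 r1 e : 0 < r0 -> 0 < e < pi ->
  polar_regular r0 r1 e pi V.
Proof.
move=> r00 /andP[e0 epi].
have ce : cos e < 1.
  by rewrite -cos0 ltr_cos// in_itv/= ?lexx ?pi_ge0// (ltW e0) ltW.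
apply: (@regularV _ _ _ _ _ (Num.sqrt (2 * sg * r0 * (1 - cos e)))) => //.
- by rewrite sqrtr_gt0 mulr_gt0 ?subr_gt0// !mulr_gt0.
- move=> r p /andP[r0r _] /andP[ep ppi].
  have rp : 0 < r by exact: lt_le_trans r0r.
  have cp : cos p <= cos e.
    rewrite ltW// ltr_cos// in_itv/=; apply/andP; split; rewrite ?ltW//.
    exact: lt_trans ep.
  rewrite -(@ler_pXn2r _ 2)// ?nnegrE ?sqrtr_ge0 ?normc_ge0//.
  rewrite sqr_normc_sub_polar// sqr_sqrtr; last first.
    by rewrite mulr_ge0 ?subr_ge0 ?(ltW ce)// !mulr_ge0// ltW.
  rewrite ler_wpDl ?sqr_ge0// ler_pM ?subr_ge0 ?(ltW ce)//.
  + by rewrite !mulr_ge0// ltW.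
  + by rewrite ler_wpM2l// mulr_ge0// ltW.
  + by rewrite lerD2l lerN2.
- apply: regularD; first exact: regular_cst.
  by apply: regularN => //; exact: regular_pow.
Qed.

Let reg_f1 r0 r1 e : 0 < r0 -> 0 < e < pi -> polar_regular r0 r1 e pi f1.
Proof.
move=> r00 he; apply: regularM; last exact: regular_sub_polarV.
by apply: regularM; [exact: regular_pow|exact: reg_g].
Qed.

Let K1 := expR (x * L).

Let normc_g r p : 0 < r -> 0 <= p <= th ->
  normc (g r p) <= K1 * expR (- (x * cos (beta * th) * r `^ beta)) + k * r `^ (- 2^-1).
Proof.
move=> r0 hp; rewrite (le_trans (le_normcD _ _))// normcN lerD//.
  exact: normc_stable_factor_le.
rewrite normcM normcR normc_polar_pow// ger0_norm//.
by rewrite mulr_ge0 ?expR_ge0 ?powR_ge0.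
Qed.

Let k0 : 0 <= k.
Proof. by rewrite mulr_ge0 ?expR_ge0 ?powR_ge0. Qed.

Let normc_f1 r p B : 0 < B -> 0 < r -> B <= `|sg - r| -> 0 <= p <= th ->
  normc (f1 r p) <= r / B *
   (K1 * expR (- (x * cos (beta * th) * r `^ beta)) + k * r `^ (- 2^-1)).
Proof.
move=> B0 r0 hB hp; rewrite !normcM normcV normc_polar_pow// powRr1 ?(ltW r0)//.
rewrite mulrAC ler_pM//.
- by rewrite mulr_ge0 ?invr_ge0 ?normc_ge0// ltW.
- exact: normc_ge0.
- rewrite ler_wpM2l ?(ltW r0)// lef_pV2 ?posrE//.
    exact: le_trans hB (normc_sub_polar_ge p s0 r0).
  exact: lt_le_trans B0 (le_trans hB (normc_sub_polar_ge p s0 r0)).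
- exact: normc_g.
Qed.

(** On the small arc, [W * V] is of order [r] and [g] of order [r ^ (-1/2)], so the product is of
    order [r ^ (1/2)]. On the large arc, [W * V] is bounded and [g] is a decaying exponential plus a
    multiple of [r ^ (-1/2)]. Hence [a] is the minimum of [beta] and 1/2, and [K] adds the constants
    of the two arcs. *)
Let boundary : exists K a : R, exists N : nat, 0 < a /\ forall n, (N <= n)%N ->
  forall p, 0 <= p <= th ->
    normc (f1 n.+1%:R^-1 p) <= K * n.+1%:R `^ (- a) /\
    normc (f1 n.+1%:R p) <= K * n.+1%:R `^ (- a).
Proof.
pose cb := cos (beta * th).
have s0' : 0 < sg by exact: s0.
have cb0 : 0 < x * cb by rewrite mulr_gt0// cosM_contour_gt0.
pose K := (2 / sg) * (K1 + k) + 2 * (K1 / (x * cb) + k).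
pose a := Num.min beta 2^-1.
have a0 : 0 < a by rewrite lt_min b0/=.
have K10 : 0 <= K1 by exact: expR_ge0.
have kA : 0 <= (2 / sg) * (K1 + k) by rewrite mulr_ge0 ?divr_ge0 ?addr_ge0// ltW.
have kB : 0 <= 2 * (K1 / (x * cb) + k).
  by rewrite mulr_ge0 ?addr_ge0// divr_ge0// ltW.
(* From this index on, [|sg - r|] is at least [sg / 2] on the small arc and at least [r / 2] on the
   large one. *)
pose N := (Num.truncn (2 / sg + 2 * sg)).+1.
have hN n : (N <= n)%N -> 2 / sg <= n.+1%:R :> R /\ 2 * sg <= n.+1%:R :> R.
  move=> Nn.
  have h : 2 / sg + 2 * sg < n.+1%:R :> R.
    by rewrite (lt_le_trans (truncnS_gt _))// ler_nat (leq_trans Nn).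
  have h1 : 0 < 2 / sg by rewrite divr_gt0.
  have h2 : 0 < 2 * sg by rewrite mulr_gt0.
  by split; lra.
exists K, a, N; split=> // n Nn p hp.
have [n1 n2] := hN _ Nn.
have np : 0 < n.+1%:R :> R by [].
have n3 : 1 <= n.+1%:R :> R by rewrite ler1n.
have hhalf : n.+1%:R `^ (- 2^-1) <= n.+1%:R `^ (- a) :> R.
  by rewrite ler_powR// lerN2 ge_min lexx orbT.
have hbeta : n.+1%:R `^ (- beta) <= n.+1%:R `^ (- a) :> R.
  by rewrite ler_powR// lerN2 ge_min lexx.
have pa : 0 < n.+1%:R `^ (- a) :> R by exact: powR_gt0.
split.
- have i1 : n.+1%:R^-1 <= sg / 2.
    by rewrite -[leRHS]invrK lef_pV2 ?posrE ?invr_gt0 ?divr_gt0// invf_div.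
  have rp : 0 < n.+1%:R^-1 :> R by rewrite invr_gt0.
  apply: le_trans (normc_f1 (_ : 0 < sg / 2) rp _ hp) _; first by rewrite divr_gt0.
    by move: s0' i1; move: (n.+1%:R^-1) => q ? ?; rewrite ger0_norm; lra.
  rewrite (@le_trans _ _ (2 / sg * (K1 + k) * n.+1%:R `^ (- a)))//; last first.
    by rewrite ler_wpM2r ?(ltW pa)// lerDl.
  rewrite invf_div (mulrC n.+1%:R^-1) -[leLHS]mulrA -[leRHS]mulrA ler_wpM2l ?divr_ge0 ?(ltW s0)//.
  rewrite mulrDr [leRHS]mulrDl.
  have e1 : n.+1%:R^-1 = n.+1%:R `^ (- 2^-1) * n.+1%:R `^ (- 2^-1) :> R.
    rewrite -powRD_gt0//.
    by rewrite -opprD -[in RHS]div1r -splitr -powR_inv1// ltW.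
  have e2 : n.+1%:R^-1 `^ (- 2^-1) = n.+1%:R `^ (2^-1) :> R.
    by rewrite -powR_inv1 ?(ltW np)// -powRrM mulN1r opprK.
  have e3 : n.+1%:R^-1 * n.+1%:R^-1 `^ (- 2^-1) = n.+1%:R `^ (- 2^-1) :> R.
    rewrite e2 {1}e1 -mulrA -powRD_gt0//.
    by rewrite addNr powRr0 mulr1.
  apply: lerD.
    rewrite mulrCA ler_wpM2l// (le_trans _ hhalf)//.
    have : expR (- (x * cos (beta * th) * n.+1%:R^-1 `^ beta)) <= 1.
      by rewrite -expR0 ler_expR oppr_le0 mulr_ge0 ?powR_ge0// ltW.
    move: (expR _) (expR_ge0 (- (x * cos (beta * th) * n.+1%:R^-1 `^ beta))) => E E0 E1.
    rewrite e1 -mulrA ger_pMr ?powR_gt0// mulr_ile1 ?powR_ge0//.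
    by rewrite -[leRHS](powRr0 n.+1%:R) ler_powR// oppr_le0.
  by rewrite mulrCA e3 ler_wpM2l.
- apply: le_trans (normc_f1 (_ : 0 < n.+1%:R / 2) np _ hp) _; first by rewrite divr_gt0.
    by move: s0' n2; move: (n.+1%:R) => q ? ?; rewrite ler0_norm; lra.
  rewrite (@le_trans _ _ (2 * (K1 / (x * cb) + k) * n.+1%:R `^ (- a)))//; last first.
    by rewrite ler_wpM2r ?(ltW pa)// lerDr.
  rewrite [X in X * _](_ : _ = 2); last by field; rewrite gt_eqF.
  rewrite -[leRHS]mulrA ler_wpM2l// [leRHS]mulrDl.
  apply: lerD; last by rewrite ler_wpM2l.
  rewrite -[leRHS]mulrA ler_wpM2l// (@le_trans _ _ ((x * cb)^-1 * n.+1%:R `^ (- beta)))//; last first.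
    by rewrite ler_wpM2l// invr_ge0 ltW.
  (* The inequality [exp (- y) <= 1 / y] with [y = x * cb * (n + 1) ^ beta]: this is where the
     exponent [beta] of the decay comes from. *)
  rewrite powRN -invfM expRN lef_pV2 ?posrE ?expR_gt0 ?(mulr_gt0 cb0) ?powR_gt0//.
  by rewrite (le_trans _ (expR_ge1Dx _))// lerDr.
Qed.

(** At angle 0 the function is real, so the imaginary part tends to 0 pointwise except at the pole
    [sg], which is removed as a null set. Since [g] vanishes at [(sg, 0)], it is at most a multiple
    of [|r - sg| + p], and the distance to the pole is bounded below by a multiple of the same sum;
    the quotient is bounded and the convergence dominated. *)
Let small_angle r0 r1 : 0 < r0 -> r0 <= sg <= r1 ->
  \int[mu]_(r in `[r0, r1]) (complex.Im (f1 r p) / r) @[p --> 0^'+] --> (0 : R).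
Proof.
move=> r00 hs.
pose D : set R := `[r0, r1]%classic `\ sg.
have mD : measurable D by apply: measurableD; [exact: measurable_itv|exact: measurable_set1].
have rpos r : r0 <= r <= r1 -> 0 < r by move=> /andP[+ _]; exact: lt_le_trans.
have p1 : 1 < pi :> R by have := @pi_ge2 R; lra.
have he (p : R) : 0 < p -> p < 1 -> 0 < p / 2 < pi.
  by move=> *; apply/andP; split; lra.
have hep (p : R) : 0 < p -> p < 1 -> p / 2 < p < pi.
  by move=> *; apply/andP; split; lra.
have mf p : 0 < p < 1 -> measurable_fun `[r0, r1]%classic (fun r => complex.Im (f1 r p) / r).
  move=> /andP[p0 p1'].
  suff : mu.-integrable `[r0, r1] (EFin \o (fun r => complex.Im (f1 r p) / r)).
    by move=> /integrableP[/measurable_EFinP].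
  apply: continuous_itvcc_integrable => r hr; apply: cvgM.
    by have [] := polar_regular_ccont hr (hep _ p0 p1') (reg_f1 r1 r00 (he _ p0 p1')).
  by apply: inv_continuous; rewrite gt_eqF// rpos.
have E p : 0 < p < 1 -> \int[mu]_(r in `[r0, r1]) (complex.Im (f1 r p) / r) =
    \int[mu]_(r in D) (complex.Im (f1 r p) / r).
  move=> hp; rewrite /Rintegral integral_setD1//.
  apply/measurable_EFinP; exact: (measurable_funS (measurable_itv `[r0, r1]) (@subDsetl _ _ _) (mf _ hp)).
have gs0 : g sg 0 = 0.
  rewrite /g /k /stable_factor !polar_powE// !mulr0 !cos0 !sin0 !mulr1 !mulr0.
  have e (y : R) : (y +i* 0)%C = y%:C%C by [].
  rewrite !e -rmorphB -rmorphM cexpR -/c -rmorphM -rmorphB /=.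
  by rewrite -mulrA -powRD_gt0// subrr powRr0 mulr1 subrr.
have hN1 : (-1 : R) < (0 : R) < 1 by rewrite ltrN10 ltr01.
have [M M0 hM] := polar_regular_lipschitz r00 hs hN1 (@reg_g r0 r1 (-1) 1 r00) gs0.
have c1 : 0 < cos 1 :> R by exact: cos1_gt0.
(* Makes [ka * |r - sg|] and [ka * p] both at most the distance [|sg - W|], the second through
   [cos 1 * p <= sin p] and [r0 <= r]. *)
pose ka := Num.min 1 (r0 * cos 1).
have ka0 : 0 < ka by rewrite lt_min ltr01 mulr_gt0.
have bound r p : 0 < p < 1 -> D r -> `|complex.Im (f1 r p) / r| <= 2 * M / ka.
  move=> /andP[p0 p1'] [/=]; rewrite in_itv/= => hr rs.
  have rp := rpos _ hr.
  have d1 := normc_sub_polar_ge p s0 rp.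
  have d2 := normc_sub_polar_ge_sin sg p rp.
  have rs0 : 0 < `|r - sg| by rewrite normr_gt0 subr_eq0; apply/eqP.
  have d0 : 0 < normc (sg%:C%C - W r p).
    by rewrite (lt_le_trans _ d1)// distrC.
  rewrite normrM normfV (gtr0_norm rp).
  have rV0 : 0 <= r^-1 by rewrite invr_ge0 ltW.
  apply: (le_trans (ler_wpM2r rV0 (normr_Im_le (f1 r p)))).
  rewrite /f1 !normcM normcV normc_polar_pow// powRr1 ?(ltW rp)//.
  rewrite [leLHS](_ : _ = normc (g r p) / normc (sg%:C%C - W r p)); last first.
    by move: (normc _) (normc _)^-1 => A B; field; rewrite gt_eqF.
  rewrite ler_pdivrMr//.
  have hp : 0 <= p < 1 by rewrite (ltW p0).
  rewrite (le_trans (hM _ _ hr hp))//.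
  rewrite [leRHS](_ : _ = M * (2 * normc (sg%:C%C - W r p) / ka)); last by ring.
  rewrite ler_wpM2l// ler_pdivlMr// mulrC.
  have sp : cos 1 * p <= `|sin p|.
    by rewrite (le_trans _ (ler_norm _))// sin_ge_linear// !ltW.
  have h1 : ka * `|r - sg| <= `|r - sg| by rewrite ger_pMl// ge_min lexx.
  have h2 : ka * p <= r0 * cos 1 * p by rewrite ler_wpM2r ?(ltW p0)// ge_min lexx orbT.
  have h3 : r0 * cos 1 * p <= r * `|sin p|.
    rewrite -mulrA ler_pM ?(ltW r00) ?mulr_ge0 ?(ltW c1) ?(ltW p0)//.
    by case/andP: hr.
  rewrite distrC in d1; rewrite mulrDr; lra.
have lim r : D r -> complex.Im (f1 r p) / r @[p --> 0^'+] --> (0 : R).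
  move=> [/=]; rewrite in_itv/= => hr rs; have rp := rpos _ hr.
  have e0 : sg%:C%C - W r 0 != 0.
    rewrite -normc_gt0 (lt_le_trans _ (normc_sub_polar_ge 0 s0 rp))//.
    by rewrite normr_gt0 subr_eq0; apply/eqP => /esym.
  have : ccont (f1 r) 0.
    apply: ccontM; last first.
      apply: ccontV => //; apply: ccontD; first exact: ccont_cst.
      by apply: ccontN; exact: ccont_polar_pow_arg.
    apply: ccontM; first exact: ccont_polar_pow_arg.
    apply: ccontD.
      apply: ccont_cexp; apply: ccontM; first exact: ccont_cst.
      apply: ccontD; first exact: ccont_cst.
      by apply: ccontN; exact: ccont_polar_pow_arg.
    apply: ccontN; apply: ccontM; first exact: ccont_cst.
    exact: ccont_polar_pow_arg.
  move=> [_ h].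
  have I0 : complex.Im (f1 r 0) = 0.
    have P0 a : complex.Im (polar_pow a r 0) = 0.
      by rewrite polar_powE//= mulr0 sin0 mulr0.
    apply: cImM0; last first.
      by apply: cImV0; apply: cImD0 => //; apply: cImN0; exact: P0.
    apply: cImM0; first exact: P0.
    apply: cImD0.
      apply: cIm_cexp0; apply: cImM0 => //; apply: cImD0 => //.
      by apply: cImN0; exact: P0.
    by apply: cImN0; apply: cImM0 => //; exact: P0.
  move: h; rewrite /prop_for /continuous_at I0 => h.
  rewrite -[X in _ --> X](mul0r r^-1); apply: cvgM; last exact: cvg_cst.
  exact: cvg_at_right_filter h.
have [||||_] := @Rintegral_cvg_at_right R _ _ mu D (fun p r => complex.Im (f1 r p) / r)
  (fun=> 0) (fun=> 2 * M / ka) 0 1 mD ltr01.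
- move=> p hp; exact: (measurable_funS (measurable_itv `[r0, r1]) (@subDsetl _ _ _) (mf _ hp)).
- by move=> r Dr; exact: lim.
- have iE : mu.-integrable `[r0, r1] (EFin \o (fun=> 2 * M / ka)).
    by apply: continuous_itvcc_integrable => r _; exact: cst_continuous.
  apply: integrableS iE => //; exact: subDsetl.
- by move=> p r hp Dr; exact: bound.
rewrite [X in _ --> X](_ : _ = 0); last by rewrite Rintegral_cst// mul0r.
apply: cvg_trans; apply: near_eq_cvg; near=> p.
rewrite E//; apply/andP; split; near: p.
- exact: nbhs_right_gt.
- by apply: nbhs_right_lt.
Unshelve. all: by end_near. Qed.

Let thpi : 0 < th / 2 /\ th / 2 < th /\ th < pi.
Proof.
have h1 := contour_angle_gt0 b0; have h2 := contour_angle_lt b0.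
by split; [lra|split; lra].
Qed.

(** The pole sits on the ray of angle 0, so the rotation stops at a small [p > 0], inside the sector
    []p / 2, pi[] where [f1] is regular, and [small_angle] accounts for the rest up to an arbitrary
    [e]. *)
Let rotated r0 r1 dl : 0 < r0 -> r0 <= sg <= r1 -> r0 < r1 ->
  (forall p, 0 <= p <= th -> normc (f1 r0 p) <= dl /\ normc (f1 r1 p) <= dl) ->
  `|\int[mu]_(r in `[r0, r1]) (complex.Im (f1 r th) / r)| <= 2 * dl * th.
Proof.
move=> r00 hs r01 hdl; have [t0 [t1 t2]] := thpi.
have tp : 0 < th by exact: contour_angle_gt0.
have dl0 : 0 <= dl.
  have [h _] := hdl 0 (introT andP (conj (lexx _) (ltW tp))).
  exact: le_trans (normc_ge0 _) h.
apply/ler_addgt0Pr => e e0.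
have /cvgr0Pnorm_le/(_ _ e0) h := small_angle r00 hs.
near ((0 : R)^'+) => p.
have p0 : 0 < p by near: p; exact: nbhs_right_gt.
have pth : p < th by near: p; exact: nbhs_right_lt.
have he : `|\int[mu]_(r in `[r0, r1]) (complex.Im (f1 r p) / r)| <= e by near: p.
have h2 : 0 < p / 2 < pi by apply/andP; split; lra.
have p2p : p / 2 < p by lra.
have r0r1 : 0 < r0 < r1 by rewrite r00.
have H : `|\int[mu]_(r in `[r0, r1]) (complex.Im (f1 r th) / r) -
  \int[mu]_(r in `[r0, r1]) (complex.Im (f1 r p) / r)| <= 2 * dl * (th - p).
  apply: (rotation_bound r0r1 p2p (ltW pth) t2 (reg_f1 r1 r00 h2)).
  move=> q /andP[pq qt]; apply: hdl; rewrite qt andbT.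
  exact: le_trans (ltW p0) pq.
rewrite -[X in `|X|](subrK (\int[mu]_(r in `[r0, r1]) (complex.Im (f1 r p) / r))).
rewrite (le_trans (ler_normD _ _))// lerD// (le_trans H)//.
by rewrite ler_wpM2l ?mulr_ge0// gerBl ltW.
Unshelve. all: by end_near. Qed.

Definition cauchy_integrand (r : R) : R :=
  complex.Im (W r th * F r th / (sg%:C%C - W r th)) / r.

Lemma ccont_polar_pow (a r p : R) : 0 < r -> ccont (polar_pow a ^~ p) r.
Proof.
move=> r0; apply: ccont_cexp; apply: ccontM; first exact: ccont_cst.
exact: (cderiv_ccont (proj1 (polar_hol_log p r0))).
Qed.

Lemma ccont_stable_factor (r p : R) : 0 < r -> ccont (F ^~ p) r.
Proof.
move=> r0; apply: ccont_cexp; apply: ccontM; first exact: ccont_cst.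
apply: ccontD; first exact: ccont_cst.
by apply: ccontN; exact: ccont_polar_pow.
Qed.

Lemma sub_contour_neq0 (r : R) : 0 < r -> sg%:C%C - W r th != 0.
Proof.
move=> r0; rewrite -normc_gt0.
exact: lt_le_trans s0 (normc_sub_polar_ge_cos s0 r0 (ltW (cos_contour_lt0 b0 b1))).1.
Qed.

Lemma ccont_sub_contourV (r : R) : 0 < r ->
  ccont (fun r => (sg%:C%C - W r th)^-1) r.
Proof.
move=> r0; apply: ccontV; first exact: sub_contour_neq0.
by apply: ccontD; [exact: ccont_cst|apply: ccontN; exact: ccont_polar_pow].
Qed.

Lemma continuous_cauchy_integrand (r : R) : 0 < r ->
  {for r, continuous cauchy_integrand}.
Proof.
move=> r0; apply: cvgM; last by apply: inv_continuous; rewrite gt_eqF.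
have [_ //] : ccont (fun r => W r th * F r th / (sg%:C%C - W r th)) r.
apply: ccontM; last exact: ccont_sub_contourV.
by apply: ccontM; [exact: ccont_polar_pow|exact: ccont_stable_factor].
Qed.

Lemma integrable_cauchy_integrand :
  mu.-integrable Rpos (EFin \o cauchy_integrand).
Proof.
apply: (@integrable_le_expRN_powR _ _ (expR (x * L) / sg) (x * cos (beta * th)) beta 0) => //.
- by rewrite mulr_gt0// cosM_contour_gt0.
- exact: continuous_cauchy_integrand.
move=> r r0; rewrite /cauchy_integrand normrM normfV (gtr0_norm r0).
have rV0 : 0 <= r^-1 by rewrite invr_ge0 ltW.
apply: (le_trans (ler_wpM2r rV0 (normr_Im_le _))).
rewrite !normcM normcV normc_polar_pow// powRr1 ?(ltW r0)//.
rewrite [leLHS](_ : _ = normc (F r th) / normc (sg%:C%C - W r th)); last first.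
  by move: (normc _) (normc _)^-1 => A B; field; rewrite gt_eqF.
rewrite expr0 mul1r mulrAC ler_pM ?normc_ge0 ?invr_ge0 ?normc_ge0//.
  by apply: normc_stable_factor_le => //; rewrite lexx ltW ?contour_angle_gt0.
have [h _] := normc_sub_polar_ge_cos s0 r0 (ltW (cos_contour_lt0 b0 b1)).
by rewrite lef_pV2 ?posrE// (lt_le_trans s0).
Qed.

(** On each segment the integrand is that of [f1] plus [c] times the reference kernel: [k] contains
    the factor [sg ^ (1/2)] for this purpose, and [W * W ^ (-1/2) = W ^ (1/2)]. The rotation sends
    the first integral to 0; the second tends to [pi], in place of a residue. *)
Theorem cauchy_formula : \int[mu]_(r in Rpos) cauchy_integrand r = pi * c.
Proof.
have S0 : 0 < sin (th / 2).
  have [t0 [t1 t2]] := thpi.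
  by apply: sin_gt0_pi; rewrite t0 (lt_trans t1).
have [K [a [N [a0 hN]]]] := boundary.
have cref := Rintegral_sqrt_kernel_cvg s0 S0.
have cex := Rintegral_exhaustion integrable_cauchy_integrand.
pose I n := \int[mu]_(r in `[n.+1%:R^-1, n.+1%:R]) (complex.Im (f1 r th) / r).
have tp : 0 < th by exact: contour_angle_gt0.
have I0 : I n @[n --> \oo] --> (0 : R).
  have cb : 2 * th * K * n.+1%:R `^ (- a) @[n --> \oo] --> (0 : R).
    rewrite -[X in _ --> X](mulr0 (2 * th * K)); apply: cvgM; first exact: cvg_cst.
    exact: powRN_harmonic_cvg0.
  apply/cvgr0Pnorm_le => e e0; near=> n.
  apply: (@le_trans _ _ (2 * th * K * n.+1%:R `^ (- a))); last first.
    rewrite (le_trans (ler_norm _))//; near: n.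
    by move/cvgr0Pnorm_le : cb; exact.
  have h1 : sg <= n%:R by near: n; exact: nbhs_infty_ger.
  have h2 : sg^-1 <= n%:R by near: n; exact: nbhs_infty_ger.
  have n1 : (0 < n)%N by near: n; exact: nbhs_infty_gt.
  have h3 : (N <= n)%N by near: n; exact: nbhs_infty_ge.
  have n2 : 1 < n.+1%:R :> R by rewrite ltr1n ltnS.
  have h4 : n%:R <= n.+1%:R :> R by rewrite ler_nat.
  rewrite [leRHS](_ : _ = 2 * (K * n.+1%:R `^ (- a)) * th); last by ring.
  apply: rotated.
  - by rewrite invr_gt0.
  - by rewrite (le_trans h1)// andbT -[leRHS]invrK lef_pV2 ?posrE ?invr_gt0// (le_trans h2).
  - by rewrite (@lt_trans _ _ 1)// invf_lt1.
  - by move=> p hp; exact: hN.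
have E n : \int[mu]_(r in `[n.+1%:R^-1, n.+1%:R]) cauchy_integrand r =
    I n + c * \int[mu]_(r in `[n.+1%:R^-1, n.+1%:R]) (complex.Im (sqrt_kernel sg th r) / r).
  have np : 0 < n.+1%:R^-1 :> R by rewrite invr_gt0.
  have rpos (r : R) : n.+1%:R^-1 <= r <= n.+1%:R -> 0 < r.
    by move=> /andP[h _]; exact: lt_le_trans h.
  have i1 : mu.-integrable `[n.+1%:R^-1, n.+1%:R] (EFin \o cauchy_integrand).
    by apply: continuous_itvcc_integrable => r /rpos; exact: continuous_cauchy_integrand.
  have i2 : mu.-integrable `[n.+1%:R^-1, n.+1%:R]
      (EFin \o (fun r => complex.Im (sqrt_kernel sg th r) / r)).
    by apply: continuous_itvcc_integrable => r /rpos; exact: continuous_sqrt_kernel.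
  have i3 : mu.-integrable `[n.+1%:R^-1, n.+1%:R]
      (EFin \o (fun r => c * (complex.Im (sqrt_kernel sg th r) / r))).
    rewrite (_ : _ \o _ = (fun r => c%:E * (complex.Im (sqrt_kernel sg th r) / r)%:E)%E).
      exact: integrableZl.
    by apply/funext => r /=; rewrite EFinM.
  suff -> : I n = \int[mu]_(r in `[n.+1%:R^-1, n.+1%:R]) cauchy_integrand r -
      c * \int[mu]_(r in `[n.+1%:R^-1, n.+1%:R]) (complex.Im (sqrt_kernel sg th r) / r).
    by rewrite subrK.
  rewrite -RintegralZl// -RintegralB//; apply: eq_Rintegral => r rI.
  have r0 : 0 < r by apply: rpos; move: rI; rewrite inE/= in_itv.
  have e : f1 r th =
      W r th * F r th / (sg%:C%C - W r th) - c%:C%C * sqrt_kernel sg th r.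
    rewrite /f1 /g /sqrt_kernel /V /k rmorphM/=.
    have h : 2^-1 = 1 + - 2^-1 :> R by lra.
    have pE : polar_pow 2^-1 r th = W r th * polar_pow (- 2^-1) r th.
      by rewrite {1}h; exact: polar_powD.
    rewrite pE; move: (W r th) (polar_pow (- 2^-1) r th) => w q.
    by move: (F r th) (sg%:C%C - w)^-1 => y z; ring.
  by rewrite e cImD cImN cImZ mulrBl mulrA.
have h : \int[mu]_(r in `[n.+1%:R^-1, n.+1%:R]) cauchy_integrand r
    @[n --> \oo] --> pi * c.
  rewrite (_ : (fun n : nat => _) = (fun n => I n +
      c * \int[mu]_(r in `[n.+1%:R^-1, n.+1%:R]) (complex.Im (sqrt_kernel sg th r) / r))).
    rewrite -[pi * c]add0r [pi * c]mulrC; apply: cvgD => //.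
    by apply: cvgM; first exact: cvg_cst.
  by apply/funext => n; exact: E.
exact: (cvg_unique (@Rhausdorff R) cex h).
Unshelve. all: by end_near. Qed.

End cauchy_formula.

(** * Contour integrals depending on x and t *)

Section contour_integral.
Context {R : realType}.
Local Notation C := R[i].
Local Notation mu := (@lebesgue_measure R).
Local Notation Rpos := (`](0 : R), +oo[%classic).
Variables (beta L la : R).
Hypotheses (b0 : 0 < beta) (b1 : beta < 1) (L0 : 0 <= L) (la0 : 0 < la).
Local Notation th := (contour_angle beta).
Implicit Types (A B : R -> C) (x t r s : R).

Definition ray r : C := polar_pow 1 r th.
Definition ray_symbol r : C := L%:C%C - polar_pow beta r th.
Definition ray_exp x t r : C :=
  cexp (x%:C%C * ray_symbol r + t%:C%C * (ray r - la%:C%C)).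

Definition contour_integrand A x t r : R := complex.Im (A r * ray_exp x t r) / r.

Definition contour_integral A x t : R :=
  \int[mu]_(r in Rpos) contour_integrand A x t r.

(** The factor [r] compensates the weight [1 / r] at 0, and polynomial growth is absorbed by the
    exponentials. The class is stable under the factors that derivatives in [x], derivatives in [t]
    and Laplace transforms in [t] produce: the symbol, [ray r - la] and the resolvent. *)
Definition tame A := (forall r, 0 < r -> ccont A r) /\
  exists K, exists N : nat, 0 <= K /\
    forall r, 0 < r -> normc (A r) <= K * r * (1 + r) ^+ N.

Let cb : R := cos (beta * th).
Let d : R := - cos th.

Let cb0 : 0 < cb. Proof. exact: cosM_contour_gt0. Qed.
Let d0 : 0 < d. Proof. by rewrite oppr_gt0; exact: cos_contour_lt0. Qed.

Lemma ccont_ray_symbol r : 0 < r -> ccont ray_symbol r.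
Proof.
move=> r0; apply: ccontD; first exact: ccont_cst.
by apply: ccontN; exact: ccont_polar_pow.
Qed.

Lemma ccont_ray r : 0 < r -> ccont ray r.
Proof. exact: ccont_polar_pow. Qed.

Lemma ccont_ray_exp x t r : 0 < r -> ccont (ray_exp x t) r.
Proof.
move=> r0; apply: ccont_cexp; apply: ccontD; apply: ccontM.
- exact: ccont_cst.
- exact: ccont_ray_symbol.
- exact: ccont_cst.
- by apply: ccontD; [exact: ccont_ray|apply: ccont_cst].
Qed.

Lemma normc_ray_symbol_le r : 0 < r -> normc (ray_symbol r) <= (L + 1) * (1 + r).
Proof. by move=> r0; exact: normc_subr_polar_pow_le (ltW b0) (ltW b1) L0 r0. Qed.

Lemma normc_ray_subr_le r : 0 < r -> normc (ray r - la%:C%C) <= (la + 1) * (1 + r).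
Proof.
move=> r0; rewrite (le_trans (le_normcD _ _))// normcN normcR normc_polar_pow//.
rewrite powRr1 ?(ltW r0)// (gtr0_norm la0).
have : 0 <= la * r by rewrite mulr_ge0// ltW.
rewrite mulrDr mulr1 mulrDl mul1r; lra.
Qed.

Lemma normc_ray_exp x t r : 0 < r -> normc (ray_exp x t r) =
  expR (x * L) * expR (- (t * la)) *
  (expR (- (x * cb * r `^ beta)) * expR (- (t * d * r))).
Proof.
move=> r0; rewrite normc_cexp -!expRD; congr expR.
rewrite cReD !cReZ /ray_symbol /ray !cReD !cReN !polar_powE//= powRr1 ?(ltW r0)// mul1r.
rewrite /d /cb; ring.
Qed.

Lemma tameM A B K : tame A -> 0 <= K -> (forall r, 0 < r -> ccont B r) ->
  (forall r, 0 < r -> normc (B r) <= K * (1 + r)) ->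
  tame (fun r => A r * B r).
Proof.
move=> [cA [K' [N [K'0 hA]]]] K0 cB hB; split.
  by move=> r r0; apply: ccontM; [exact: cA|exact: cB].
exists (K' * K), N.+1; split; first exact: mulr_ge0.
move=> r r0; rewrite normcM (le_trans (ler_pM _ _ (hA _ r0) (hB _ r0))) ?normc_ge0//.
rewrite exprSr le_eqVlt; apply/orP; left; apply/eqP; ring.
Qed.

Lemma tame_symbol A : tame A -> tame (fun r => A r * ray_symbol r).
Proof.
move=> tA; apply: (@tameM A ray_symbol (L + 1)) => //.
- by rewrite addr_ge0.
- exact: ccont_ray_symbol.
- exact: normc_ray_symbol_le.
Qed.

Lemma tame_symbolX A k : tame A -> tame (fun r => A r * ray_symbol r ^+ k).
Proof.
move=> tA; elim: k => [|k IH].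
  by under eq_fun do rewrite expr0 mulr1.
by under eq_fun do rewrite exprSr mulrA; exact: tame_symbol.
Qed.

Lemma tame_ray A : tame A -> tame (fun r => A r * (ray r - la%:C%C)).
Proof.
move=> tA; apply: (@tameM A (fun r => ray r - la%:C%C) (la + 1)) => //.
- by rewrite addr_ge0// ltW.
- by move=> r r0; apply: ccontD; [exact: ccont_ray|exact: ccont_cst].
- exact: normc_ray_subr_le.
Qed.

Lemma tame_resolvent A s : 0 < s -> tame A ->
  tame (fun r => A r * (s%:C%C - ray r)^-1).
Proof.
move=> s0 tA; apply: (@tameM A (fun r => (s%:C%C - ray r)^-1) s^-1) => //.
- by rewrite invr_ge0 ltW.
- move=> r r0; exact: ccont_sub_contourV.
- move=> r r0; rewrite normcV.
  have [h _] := normc_sub_polar_ge_cos s0 r0 (ltW (cos_contour_lt0 b0 b1)).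
  rewrite (@le_trans _ _ s^-1)//.
    by rewrite lef_pV2 ?posrE// (lt_le_trans s0).
  by rewrite ler_pMr ?invr_gt0// lerDl ltW.
Qed.

Lemma tame_ray_id : tame ray.
Proof.
split; first exact: ccont_ray.
exists 1, 0; split=> // r r0.
by rewrite normc_polar_pow// powRr1 ?(ltW r0)// mul1r expr0 mulr1.
Qed.

Lemma continuous_contour_integrand A x t r : tame A -> 0 < r ->
  {for r, continuous (contour_integrand A x t)}.
Proof.
move=> [cA _] r0; apply: cvgM; last by apply: inv_continuous; rewrite gt_eqF.
have [_ //] : ccont (fun r => A r * ray_exp x t r) r.
by apply: ccontM; [exact: cA|exact: ccont_ray_exp].
Qed.

Lemma measurable_contour_integrand A x t : tame A ->
  measurable_fun Rpos (contour_integrand A x t).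
Proof.
move=> tA; apply: continuous_itvoy_measurable => r r0.
exact: continuous_contour_integrand.
Qed.

Lemma contour_integrand_bound A : tame A -> exists K, exists N : nat, 0 <= K /\
  forall r x t, 0 < r -> `|contour_integrand A x t r| <=
    K * (1 + r) ^+ N * (expR (x * L) * expR (- (t * la)) *
  (expR (- (x * cb * r `^ beta)) * expR (- (t * d * r)))).
Proof.
move=> [_ [K [N [K0 hA]]]]; exists K, N; split=> // r x t r0.
rewrite normrM normfV (gtr0_norm r0) ler_pdivrMr//.
rewrite (le_trans (normr_Im_le _))// normcM normc_ray_exp//.
rewrite [leRHS]mulrAC ler_wpM2r ?mulr_ge0 ?expR_ge0//.
by rewrite [leRHS]mulrAC; exact: hA.
Qed.

(** The decay comes from [r ^ beta] with [x >= x0], so [t = 0] is included. The factor in [t] is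
    kept outside [G]: multiplied by [exp (- s * t)], the majorant is then a product of a function of
    [r] and a function of [t], the form used for Fubini. *)
Lemma contour_integrand_dominated_x A x0 x1 : tame A -> 0 < x0 ->
  exists2 G : R -> R, mu.-integrable Rpos (EFin \o G) &
    forall x t r, x0 <= x <= x1 -> 0 <= t -> 0 < r ->
      `|contour_integrand A x t r| <= expR (- (t * la)) * G r.
Proof.
move=> tA x00; have [K [N [K0 hK]]] := contour_integrand_bound tA.
pose G r := K * expR (x1 * L) * ((1 + r) ^+ N * expR (- (x0 * cb * r `^ beta))).
exists G; first by apply: integrable_expRN_powR => //; exact: mulr_gt0.
move=> x t r /andP[x0x xx1] t0 r0; rewrite (le_trans (hK _ _ _ r0))//.
have P0 : 0 <= (1 + r) ^+ N by rewrite exprn_ge0// addr_ge0// ltW.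
have e1 : expR (x * L) <= expR (x1 * L) by rewrite ler_expR ler_wpM2r.
have e2 : expR (- (t * d * r)) <= 1.
  by rewrite -expR0 ler_expR oppr_le0 !mulr_ge0// ltW.
have e3 : expR (- (x * cb * r `^ beta)) <= expR (- (x0 * cb * r `^ beta)).
  by rewrite ler_expR lerN2 ler_wpM2r ?powR_ge0// ler_wpM2r// ltW.
rewrite [leLHS](_ : _ = expR (- (t * la)) * (K * (1 + r) ^+ N *
  (expR (x * L) * (expR (- (x * cb * r `^ beta)) * expR (- (t * d * r)))))); last by ring.
rewrite ler_wpM2l ?expR_ge0// /G.
rewrite [leRHS](_ : _ = K * (1 + r) ^+ N * (expR (x1 * L) * (expR (- (x0 * cb * r `^ beta)) * 1))); last by ring.
rewrite ler_wpM2l ?mulr_ge0// ler_pM ?mulr_ge0 ?expR_ge0//.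
by rewrite ler_pM ?expR_ge0.
Qed.

End contour_integral.

(** * Derivatives and boundary limits of contour integrals *)

Section contour_integral_calculus.
Context {R : realType}.
Local Notation C := R[i].
Local Notation mu := (@lebesgue_measure R).
Local Notation Rpos := (`](0 : R), +oo[%classic).
Variables (beta L la : R).
Hypotheses (b0 : 0 < beta) (b1 : beta < 1) (L0 : 0 <= L) (la0 : 0 < la).
Local Notation th := (contour_angle beta).
Local Notation ray := (ray beta).
Local Notation ray_symbol := (ray_symbol beta L).
Local Notation ray_exp := (ray_exp beta L la).
Local Notation contour_integrand := (contour_integrand beta L la).
Local Notation contour_integral := (contour_integral beta L la).
Implicit Types (A : R -> C) (x t r s : R).

(** Here the decay comes from [- t0 * (- cos th) * r], so [x = 0] is included. The exponent 1 on [r]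
    only fits the common form of the majorants. *)
Lemma contour_integrand_dominated_t A t0 x1 : tame A -> 0 < t0 ->
  exists2 G : R -> R, mu.-integrable Rpos (EFin \o G) &
    forall x t r, 0 <= x <= x1 -> t0 <= t -> 0 < r ->
      `|contour_integrand A x t r| <= G r.
Proof.
move=> tA t00; have [K [N [K0 hK]]] := contour_integrand_bound beta L la tA.
pose d := - cos th.
have d0 : 0 < d by rewrite oppr_gt0; exact: cos_contour_lt0.
have cb0 := cosM_contour_gt0 b0 b1.
exists (fun r => K * expR (x1 * L) * ((1 + r) ^+ N * expR (- (t0 * d * r `^ 1)))).
  by apply: integrable_expRN_powR => //; exact: mulr_gt0.
move=> x t r /andP[x0 xx1] t0t r0; rewrite (le_trans (hK _ _ _ r0))//.
have tp : 0 <= t by rewrite (le_trans (ltW t00)).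
have P0 : 0 <= (1 + r) ^+ N by rewrite exprn_ge0// addr_ge0// ltW.
have e1 : expR (x * L) <= expR (x1 * L) by rewrite ler_expR ler_wpM2r.
have e2 : expR (- (t * la)) <= 1.
  by rewrite -expR0 ler_expR oppr_le0 mulr_ge0// ltW.
have e3 : expR (- (x * cos (beta * th) * r `^ beta)) <= 1.
  by rewrite -expR0 ler_expR oppr_le0 !mulr_ge0 ?powR_ge0// ltW.
have e4 : expR (- (t * - cos th * r)) <= expR (- (t0 * d * r `^ 1)).
  rewrite powRr1 ?(ltW r0)// ler_expR lerN2 ler_wpM2r ?(ltW r0)//.
  by rewrite ler_wpM2r// ltW.
rewrite [leRHS](_ : _ = K * (1 + r) ^+ N *
    (expR (x1 * L) * 1 * (1 * expR (- (t0 * d * r `^ 1))))); last by ring.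
rewrite ler_wpM2l ?mulr_ge0// ler_pM ?mulr_ge0 ?expR_ge0//.
  by rewrite ler_pM ?expR_ge0.
by rewrite ler_pM ?expR_ge0.
Qed.

Lemma integrable_contour_integrand A x t : tame A -> 0 < x -> 0 <= t ->
  mu.-integrable Rpos (EFin \o contour_integrand A x t).
Proof.
move=> tA x0 t0.
have [G iG hG] := contour_integrand_dominated_x la b0 b1 L0 x tA x0.
apply: (@le_Rintegrable _ _ _ mu Rpos _ G) => //.
  exact: measurable_contour_integrand.
move=> r; rewrite /= in_itv/= andbT => r0.
have xx : x <= x <= x by rewrite lexx.
have h := hG x t r xx t0 r0.
have g0 : 0 <= G r.
  by rewrite -(pmulr_rge0 _ (expR_gt0 (- (t * la)))) (le_trans _ h).
by rewrite (le_trans h)// ler_piMl// -expR0 ler_expR oppr_le0 mulr_ge0// ltW.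
Qed.

Lemma cderiv_id_mul (z : C) x : cderiv (fun y : R => y%:C%C * z) x z.
Proof.
have h : cderiv (fun y : R => y%:C%C : C) x 1.
  by split => /=; [exact: is_derive_id|exact: is_derive_cst].
by have := cderivM h (cderiv_cst z x); rewrite mul1r mulr0 addr0.
Qed.

Lemma cderiv_ray_exp_x x t r :
  cderiv (fun x => ray_exp x t r) x (ray_symbol r * ray_exp x t r).
Proof.
apply: cderiv_cexp.
have := cderivD (cderiv_id_mul (ray_symbol r) x)
  (cderiv_cst (t%:C%C * (ray r - la%:C%C)) x).
by rewrite addr0.
Qed.

Lemma cderiv_ray_exp_t x t r :
  cderiv (fun t => ray_exp x t r) t ((ray r - la%:C%C) * ray_exp x t r).
Proof.
apply: cderiv_cexp.
have := cderivD (cderiv_cst (x%:C%C * ray_symbol r) t)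
  (cderiv_id_mul (ray r - la%:C%C) t).
by rewrite add0r.
Qed.

Lemma is_derive_contour_integrand_x A x t r :
  is_derive x 1 (fun x => contour_integrand A x t r)
    (contour_integrand (fun r => A r * ray_symbol r) x t r).
Proof.
have [_ h] := cderivM (cderiv_cst (A r) x) (cderiv_ray_exp_x x t r).
have d := is_derive1M h (is_derive_cst (r^-1) x 1).
by apply: (is_derive_eq d); rewrite mulr0 addr0 mul0r add0r mulrA.
Qed.

Lemma is_derive_contour_integrand_t A x t r :
  is_derive t 1 (fun t => contour_integrand A x t r)
    (contour_integrand (fun r => A r * (ray r - la%:C%C)) x t r).
Proof.
have [_ h] := cderivM (cderiv_cst (A r) t) (cderiv_ray_exp_t x t r).
have d := is_derive1M h (is_derive_cst (r^-1) t 1).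
by apply: (is_derive_eq d); rewrite mulr0 addr0 mul0r add0r mulrA.
Qed.

Let Rpos_gt0 r : Rpos r -> 0 < r.
Proof. by rewrite /= in_itv/= andbT. Qed.

(** The case [t = 0] is included because the initial value of the density is computed as a
    derivative in [x] at [t = 0]. The interval []x / 2, 2 * x[] keeps the variable bounded below. *)
Lemma is_derive_contour_integral_x A x t : tame A -> 0 < x -> 0 <= t ->
  is_derive x 1 (fun x => contour_integral A x t)
    (contour_integral (fun r => A r * ray_symbol r) x t).
Proof.
move=> tA x0 t0.
have tA' : tame (fun r => A r * ray_symbol r) by exact: tame_symbol.
have x20 : 0 < x / 2 by rewrite divr_gt0.
have [G iG hG] := contour_integrand_dominated_x la b0 b1 L0 (x * 2) tA' x20.
have e1 : expR (- (t * la)) <= 1.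
  by rewrite -expR0 ler_expR oppr_le0 mulr_ge0// ltW.
apply: (@is_derive_under_integral _ _ _ mu (fun x r => contour_integrand A x t r)
  (fun x r => contour_integrand (fun r => A r * ray_symbol r) x t r) Rpos x (x / 2) (x * 2) G) => //.
- by apply/andP; split; lra.
- move=> y /andP[hy _]; apply: integrable_contour_integrand => //.
  exact: lt_trans hy.
- by move=> y r _ _; exact: is_derive_contour_integrand_x.
- move=> y r /andP[hy1 hy2] /Rpos_gt0 r0.
  have hy : x / 2 <= y <= x * 2 by rewrite !ltW.
  have h := hG y t r hy t0 r0.
  have g0 : 0 <= G r.
    by rewrite -(pmulr_rge0 _ (expR_gt0 (- (t * la)))) (le_trans _ h).
  by rewrite (le_trans h)// ler_piMl.
Qed.

Lemma is_derive_contour_integral_t A x t : tame A -> 0 < x -> 0 < t ->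
  is_derive t 1 (contour_integral A x)
    (contour_integral (fun r => A r * (ray r - la%:C%C)) x t).
Proof.
move=> tA x0 t0.
have tA' : tame (fun r => A r * (ray r - la%:C%C)) by exact: tame_ray.
have t20 : 0 < t / 2 by rewrite divr_gt0.
have [G iG hG] := contour_integrand_dominated_t x tA' t20.
apply: (@is_derive_under_integral _ _ _ mu (fun t r => contour_integrand A x t r)
  (fun t r => contour_integrand (fun r => A r * (ray r - la%:C%C)) x t r) Rpos t (t / 2) (t * 2) G) => //.
- by apply/andP; split; lra.
- move=> y /andP[hy _]; apply: integrable_contour_integrand => //.
  by rewrite ltW// (lt_trans t20).
- by move=> y r _ _; exact: is_derive_contour_integrand_t.
- move=> y r /andP[hy1 hy2] /Rpos_gt0 r0.
  by apply: hG; rewrite ?lexx ?andbT ?ltW.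
Qed.

Lemma contour_integral_cvg_t0 A x : tame A -> 0 < x ->
  contour_integral A x t @[t --> 0^'+] --> contour_integral A x 0.
Proof.
move=> tA x0.
have [G iG hG] := contour_integrand_dominated_x la b0 b1 L0 x tA x0.
apply: (@Rintegral_cvg_at_right R _ _ mu Rpos (contour_integrand A x)
  (contour_integrand A x 0) G 0 1 _ ltr01 _ _ iG _).2 => //.
- by move=> t _; exact: measurable_contour_integrand.
- move=> r /Rpos_gt0 r0.
  have := is_derive1_continuous (is_derive_contour_integrand_t A x 0 r).
  exact: cvg_at_right_filter.
- move=> t r /andP[t0 _] /Rpos_gt0 r0.
  have xx : x <= x <= x by rewrite lexx.
  have h := hG x t r xx (ltW t0) r0.
  have g0 : 0 <= G r.
    by rewrite -(pmulr_rge0 _ (expR_gt0 (- (t * la)))) (le_trans _ h).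
  by rewrite (le_trans h)// ler_piMl// -expR0 ler_expR oppr_le0 mulr_ge0 ?ltW.
Qed.

Lemma contour_integral_cvg_x0 A t : tame A -> 0 < t ->
  contour_integral A x t @[x --> 0^'+] --> contour_integral A 0 t.
Proof.
move=> tA t0.
have [G iG hG] := contour_integrand_dominated_t 1 tA t0.
apply: (@Rintegral_cvg_at_right R _ _ mu Rpos (fun x => contour_integrand A x t)
  (contour_integrand A 0 t) G 0 1 _ ltr01 _ _ iG _).2 => //.
- by move=> x _; exact: measurable_contour_integrand.
- move=> r /Rpos_gt0 r0.
  have := is_derive1_continuous (is_derive_contour_integrand_x A 0 t r).
  exact: cvg_at_right_filter.
- move=> x r /andP[x0 x1] /Rpos_gt0 r0.
  by apply: hG => //; apply/andP; split; exact: ltW.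
Qed.

End contour_integral_calculus.

(** * Laplace transforms *)

Section fubini_pos.
Context {R : realType}.
Local Notation mu := (@lebesgue_measure R).
Local Notation Rpos := (`](0 : R), +oo[%classic).
Local Open Scope ereal_scope.

(** A majorant in product form makes the function, extended by 0 outside the quarter plane,
    integrable for the product measure. *)
Lemma Rintegral_fubini_pos (H : R -> R -> R) (G1 G2 : R -> R) :
  measurable_fun (Rpos `*` Rpos) (fun z : R * R => H z.1 z.2) ->
  mu.-integrable Rpos (EFin \o G1) -> mu.-integrable Rpos (EFin \o G2) ->
  (forall r t, 0 < r -> 0 < t -> `|H r t| <= G1 r * G2 t)%R ->
  (\int[mu]_(r in Rpos) (\int[mu]_(t in Rpos) H r t) =
   \int[mu]_(t in Rpos) (\int[mu]_(r in Rpos) H r t))%R.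
Proof.
move=> mH i1 i2 hH.
have mH1 (r : R) : (0 < r)%R -> measurable_fun Rpos (H r).
  move=> r0; apply: (@measurable_comp _ _ _ _ _ _ (Rpos `*` Rpos)
    (fun z : R * R => H z.1 z.2) Rpos (fun t => (r, t))) => //.
  - exact: measurableX.
  - by move=> _ [t tP <-]; split => //=; rewrite in_itv/= r0.
  - by apply: measurable_funTS; exact: pair1_measurable.
have mH2 (t : R) : (0 < t)%R -> measurable_fun Rpos (H ^~ t).
  move=> t0; apply: (@measurable_comp _ _ _ _ _ _ (Rpos `*` Rpos)
    (fun z : R * R => H z.1 z.2) Rpos (fun r => (r, t))) => //.
  - exact: measurableX.
  - by move=> _ [r rP <-]; split => //=; rewrite in_itv/= t0.
  - by apply: measurable_funTS; exact: pair2_measurable.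
have iZ (c : R) G : mu.-integrable Rpos (EFin \o G) ->
    mu.-integrable Rpos (EFin \o (fun t => c * G t)%R).
  move=> iG; rewrite (_ : _ \o _ = (fun t => c%:E * (G t)%:E)).
    exact: integrableZl.
  by apply/funext => t /=; rewrite EFinM.
have posP (r : R) : (r \in Rpos) = (0 < r)%R.
  by apply/idP/idP; rewrite inE/= in_itv/= andbT.
have mP : measurable (Rpos : set R) by exact: measurable_itv.
have mPP : measurable (Rpos `*` Rpos : set (R * R)) by exact: measurableX.
pose F := (fun z : R * R => (H z.1 z.2)%:E) \_ (Rpos `*` Rpos).
have mF : measurable_fun setT F.
  apply: (iffLR (measurable_restrictT _ mPP)).
  exact/measurable_EFinP.
have FE r t : F (r, t) = if (0 < r)%R && (0 < t)%R then (H r t)%:E else 0.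
  by rewrite /F patchE in_setX/= !posP.
have e1 r : \int[mu]_t `|F (r, t)| = if (0 < r)%R then \int[mu]_(t in Rpos) `|(H r t)%:E| else 0.
  case: ifPn => r0.
    rewrite [RHS]integral_mkcond; apply: eq_integral => t _.
    by rewrite FE r0/= patchE posP; case: ifPn => //; rewrite abse0.
  by apply: integral0_eq => t _; rewrite FE (negbTE r0) abse0.
have iF : (mu \x mu).-integrable setT F.
  apply: (iffRL (@integrable12ltyP _ _ _ _ _ mu mu F mF)).
  pose c := (\int[mu]_(t in Rpos) `|G2 t|)%R.
  have i2' : mu.-integrable Rpos (fun t => `|(G2 t)%:E|) by exact: integrable_abse.
  have ce : \int[mu]_(t in Rpos) `|(G2 t)%:E| = c%:E.
    rewrite /c /Rintegral fineK; first by apply: eq_integral => t _.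
    by apply: integrable_fin_num => //; exact: i2'.
  rewrite (@le_lt_trans _ _ (\int[mu]_(r in Rpos) (`|(G1 r)%:E| * c%:E)))//; last first.
    rewrite integralZr//; last exact: integrable_abse.
    rewrite lte_mul_pinfty ?ltry//.
    - exact: integral_ge0.
    - by rewrite ge0_fin_numE ?integral_ge0//; case/integrableP: i1.
  rewrite [leRHS]integral_mkcond; apply: ge0_le_integral => //.
  - by move=> r _; exact: integral_ge0.
  - have mA : measurable_fun setT (abse \o F) by exact: measurableT_comp.
    have A0 z : 0 <= (abse \o F) z by exact: abse_ge0.
    exact: (@measurable_fun_fubini_tonelli_F _ _ _ _ _ mu _ mA A0).
  - apply: (iffLR (measurable_restrictT _ mP)).
    apply: emeasurable_funM; last exact: measurable_cst.
    by apply: measurableT_comp => //; case/integrableP: i1.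
  - move=> r _; rewrite e1 patchE posP; case: ifPn => // r0.
    rewrite -ce -integralZl//.
    apply: ge0_le_integral => //.
    + by apply: measurableT_comp => //; apply/measurable_EFinP; exact: mH1.
    + apply: emeasurable_funM; first exact: measurable_cst.
      by apply: measurableT_comp => //; case/integrableP: i2.
    + move=> t /=; rewrite in_itv/= andbT => t0.
      by rewrite -EFinM lee_fin -normrM (le_trans (hH _ _ r0 t0))// ler_norm.
have FI := Fubini iF.
have lhs : \int[mu]_r \int[mu]_t F (r, t) =
    \int[mu]_(r in Rpos) \int[mu]_(t in Rpos) (H r t)%:E.
  rewrite [RHS]integral_mkcond; apply: eq_integral => r _.
  rewrite patchE posP; case: ifPn => r0.
    rewrite [RHS]integral_mkcond; apply: eq_integral => t _.
    by rewrite FE r0/= patchE posP.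
  by apply: integral0_eq => t _; rewrite FE (negbTE r0).
have rhs : \int[mu]_t \int[mu]_r F (r, t) =
    \int[mu]_(t in Rpos) \int[mu]_(r in Rpos) (H r t)%:E.
  rewrite [RHS]integral_mkcond; apply: eq_integral => t _.
  rewrite patchE posP; case: ifPn => t0.
    rewrite [RHS]integral_mkcond; apply: eq_integral => r _.
    by rewrite FE t0 andbT patchE posP.
  by apply: integral0_eq => r _; rewrite FE (negbTE t0) andbF.
have iH1 r : (0 < r)%R -> mu.-integrable Rpos (EFin \o H r).
  move=> r0; apply: (@le_Rintegrable R _ _ mu Rpos (H r) (fun t => G1 r * G2 t)%R mP (mH1 r r0)).
    exact: iZ.
  by move=> t /=; rewrite in_itv/= andbT; exact: hH.
have iH2 t : (0 < t)%R -> mu.-integrable Rpos (EFin \o H ^~ t).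
  move=> t0; apply: (@le_Rintegrable R _ _ mu Rpos (H ^~ t) (fun r => G2 t * G1 r)%R mP (mH2 t t0)).
    exact: iZ.
  by move=> r /=; rewrite in_itv/= andbT mulrC => r0; exact: hH.
have fin1 r : (0 < r)%R -> \int[mu]_(t in Rpos) (H r t)%:E =
    (\int[mu]_(t in Rpos) H r t)%R%:E.
  by move=> r0; apply/esym/fineK/integrable_fin_num; [exact: mP|exact: iH1].
have fin2 t : (0 < t)%R -> \int[mu]_(r in Rpos) (H r t)%:E =
    (\int[mu]_(r in Rpos) H r t)%R%:E.
  by move=> t0; apply/esym/fineK/integrable_fin_num; [exact: mP|exact: iH2].
rewrite {1}/Rintegral [in RHS]/Rintegral; congr fine.
transitivity (\int[mu]_(r in Rpos) \int[mu]_(t in Rpos) (H r t)%:E).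
  by apply: eq_integral => r /[!posP] r0; rewrite fin1.
rewrite -lhs FI rhs.
by apply: eq_integral => r /[!posP] r0; rewrite fin2.
Qed.

End fubini_pos.

Section laplace_contour.
Context {R : realType}.
Local Notation C := R[i].
Local Notation mu := (@lebesgue_measure R).
Local Notation Rpos := (`](0 : R), +oo[%classic).

Lemma integrable_expRN (K a : R) : 0 < a ->
  mu.-integrable Rpos (EFin \o (fun t => K * expR (- a * t))).
Proof.
move=> a0; have := @integrable_expRN_powR R K a 1 0 a0 ltr01.
apply: eq_integrable => // t; rewrite inE/= in_itv/= andbT => t0.
by rewrite /= expr0 mul1r powRr1 ?(ltW t0)// mulNr.
Qed.

Lemma expRN_cvg0 (a : R) : 0 < a ->
  expR (- (a * n.+1%:R)) @[n --> \oo] --> (0 : R).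
Proof.
move=> a0; apply/cvgr0Pnorm_le => e e0; near=> n.
have h : (a * e)^-1 <= n%:R by near: n; exact: nbhs_infty_ger.
rewrite ger0_norm ?expR_ge0// expRN.
have np : 0 < a * n.+1%:R by rewrite mulr_gt0.
have h1 : a * n.+1%:R <= expR (a * n.+1%:R).
  by rewrite (le_trans _ (expR_ge1Dx _))// lerDr.
rewrite (@le_trans _ _ (a * n.+1%:R)^-1)//.
  by rewrite lef_pV2 ?posrE ?expR_gt0.
rewrite -[leRHS]invrK lef_pV2 ?posrE ?invr_gt0//.
have : (a * e)^-1 <= n.+1%:R by rewrite (le_trans h)// ler_nat.
by rewrite invfM mulrC ler_pdivrMr// mulrC.
Unshelve. all: by end_near. Qed.

(** The primitive [- (z / p) * cexp (- t * p)] vanishes at infinity since [Re p > 0]. The complex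
    amplitude [z] lets imaginary parts alone cover every case, real exponentials included. *)
Lemma Rintegral_cexpN (z p : C) : 0 < complex.Re p ->
  mu.-integrable Rpos (EFin \o (fun t => complex.Im (z * cexp (t%:C%C * - p)))) /\
  \int[mu]_(t in Rpos) complex.Im (z * cexp (t%:C%C * - p)) = complex.Im (z / p).
Proof.
move=> p0.
have pn0 : p != 0 by apply: contraTneq p0 => ->; rewrite ltxx.
have dE (t : R) : cderiv (fun t : R => cexp (t%:C%C * - p)) t (- p * cexp (t%:C%C * - p)).
  by apply: cderiv_cexp; exact: cderiv_id_mul.
have nE t : normc (cexp (t%:C%C * - p)) = expR (- (complex.Re p * t)).
  by rewrite normc_cexp cReZ cReN; congr expR; ring.
have cE (t : R) : {for t, continuous (fun t : R => complex.Im (z * cexp (t%:C%C * - p)))}.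
  have [_ //] := ccontM (ccont_cst z t) (cderiv_ccont (dE t)).
have iE : mu.-integrable Rpos (EFin \o (fun t => complex.Im (z * cexp (t%:C%C * - p)))).
  apply: (@le_Rintegrable _ _ _ mu _ _ (fun t => normc z * expR (- complex.Re p * t))) => //.
  - by apply: continuous_itvoy_measurable => t _; exact: cE.
  - exact: integrable_expRN.
  - by move=> t _; rewrite (le_trans (normr_Im_le _))// normcM nE mulNr.
split=> //.
have cex := Rintegral_exhaustion iE.
pose G (t : R) := complex.Im (- (z / p) * cexp (t%:C%C * - p)).
have dG (t : R) : is_derive t 1 G (complex.Im (z * cexp (t%:C%C * - p))).
  have [_ d] := cderivM (cderiv_cst (- (z / p)) t) (dE t).
  apply: (is_derive_eq d); congr (complex.Im _).
  by rewrite mul0r add0r mulrA; congr (_ * _); field.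
have lim1 : G n.+1%:R @[n --> \oo] --> (0 : R).
  have h : normc (z / p) * expR (- (complex.Re p * n.+1%:R)) @[n --> \oo] --> (0 : R).
    rewrite -[X in _ --> X](mulr0 (normc (z / p))); apply: cvgM; first exact: cvg_cst.
    exact: expRN_cvg0.
  apply/cvgr0Pnorm_le => e e0; near=> n.
  apply: (@le_trans _ _ (normc (z / p) * expR (- (complex.Re p * n.+1%:R)))).
    by rewrite (le_trans (normr_Im_le _))// normcM nE normcN.
  rewrite (le_trans (ler_norm _))//; near: n.
  by move/cvgr0Pnorm_le : h; exact.
have lim2 : G n.+1%:R^-1 @[n --> \oo] --> - complex.Im (z / p).
  have -> : - complex.Im (z / p) = G 0.
    by rewrite /G mul0r cexp0 mulr1 cImN.
  apply: (@cvg_comp _ _ _ (fun n : nat => n.+1%:R^-1 : R) G).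
    exact: cvg_harmonic.
  exact: (is_derive1_continuous (dG 0)).
apply: (cvg_unique (@Rhausdorff R) cex).
have -> : complex.Im (z / p) = 0 - - complex.Im (z / p) by rewrite sub0r opprK.
apply: cvg_trans (cvgB lim1 lim2); apply: near_eq_cvg; near=> n.
have n1 : 1 < n.+1%:R :> R.
  by rewrite ltr1n ltnS; near: n; exact: nbhs_infty_gt.
have lt1 : n.+1%:R^-1 < n.+1%:R :> R by rewrite (@lt_trans _ _ 1)// invf_lt1.
by symmetry; apply: (@Rintegral_FTC2 R _ G _ _ lt1).
Unshelve. all: by end_near. Qed.

Variables (beta L la : R).
Hypotheses (b0 : 0 < beta) (b1 : beta < 1) (L0 : 0 <= L) (la0 : 0 < la).
Local Notation th := (contour_angle beta).
Local Notation ray := (ray beta).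
Local Notation ray_symbol := (ray_symbol beta L).
Local Notation ray_exp := (ray_exp beta L la).
Local Notation contour_integrand := (contour_integrand beta L la).
Local Notation contour_integral := (contour_integral beta L la).
Implicit Types (A : R -> C) (x t r s : R).

(** Integrating [exp (- s * t) * exp (t * (W - la))] in [t] yields the resolvent [1 / (s + la - W)];
    the real part of [s + la - W] is positive because [cos th < 0]. The transform is again a contour
    integral, at [t = 0], so identities between transforms become algebra on amplitudes. *)
Lemma laplace_contour_integral A x s : tame A -> 0 < x -> 0 < s ->
  laplace_integrable (contour_integral A x) s /\
  laplace (contour_integral A x) s =
  contour_integral (fun r => A r * ((s + la)%:C%C - ray r)^-1) x 0.
Proof.
move=> tA x0 s0.
have posP r : Rpos r -> 0 < r by rewrite /= in_itv/= andbT.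
have [G iG hG] := contour_integrand_dominated_x la b0 b1 L0 x tA x0.
have xx : x <= x <= x by rewrite lexx.
have sl0 : 0 < s + la by rewrite addr_gt0.
have hb r t : 0 < r -> 0 < t ->
    `|expR (- s * t) * contour_integrand A x t r| <= G r * expR (- (s + la) * t).
  move=> r0 t0; rewrite normrM (ger0_norm (expR_ge0 _)).
  rewrite (le_trans (ler_wpM2l (expR_ge0 _) (hG x t r xx (ltW t0) r0)))//.
  rewrite mulrA -expRD mulrC le_eqVlt; apply/orP; left; apply/eqP.
  by congr (_ * expR _); ring.
have iE : mu.-integrable Rpos (EFin \o (fun t => expR (- (s + la) * t))).
  by have := integrable_expRN 1 sl0; apply: eq_integrable => // t _ /=; rewrite mul1r.
have mA : measurable_fun Rpos (fun r => complex.Re (A r * ray_exp x 0 r) / r) /\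
    measurable_fun Rpos (fun r => complex.Im (A r * ray_exp x 0 r) / r).
  split; apply: continuous_itvoy_measurable => r r0;
   apply: cvgM; try by apply: inv_continuous; rewrite gt_eqF.
  - by have [+ _] := ccontM (proj1 tA _ r0) (ccont_ray_exp beta L la x 0 r0).
  - by have [_ +] := ccontM (proj1 tA _ r0) (ccont_ray_exp beta L la x 0 r0).
(* For joint measurability: the amplitude is only known to be continuous in [r], so the integrand is
   separated into functions of [r] alone and explicit functions of both variables. *)
have ciE r t : 0 < r -> contour_integrand A x t r =
    complex.Im (A r * ray_exp x 0 r) / r *
      (expR (t * (r * cos th - la)) * cos (t * (r * sin th))) +
    complex.Re (A r * ray_exp x 0 r) / r *
      (expR (t * (r * cos th - la)) * sin (t * (r * sin th))).
  move=> r0.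
  have -> : contour_integrand A x t r =
      complex.Im (A r * ray_exp x 0 r * cexp (t%:C%C * (ray r - la%:C%C))) / r.
    rewrite /contour_integrand -mulrA; congr (complex.Im (_ * _) / _).
    by rewrite -cexpD; congr cexp; rewrite mul0r addr0.
  rewrite cImM.
  have w1 : complex.Re (t%:C%C * (ray r - la%:C%C)) = t * (r * cos th - la).
    by rewrite cReZ cReD cReN /ray polar_pow1E.
  have w2 : complex.Im (t%:C%C * (ray r - la%:C%C)) = t * (r * sin th).
    by rewrite cImZ cImD cImN /ray polar_pow1E//= subr0.
  have eR (w : C) : complex.Re (cexp w) = expR (complex.Re w) * cos (complex.Im w) by [].
  have eI (w : C) : complex.Im (cexp w) = expR (complex.Re w) * sin (complex.Im w) by [].
  rewrite eR eI w1 w2; ring.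
have cI0 r t : 0 < r -> 0 < t -> `|contour_integrand A x t r| <= G r.
  move=> r0 t0; have h := hG x t r xx (ltW t0) r0.
  have g0 : 0 <= G r.
    by rewrite -(pmulr_rge0 _ (expR_gt0 (- (t * la)))) (le_trans _ h).
  by rewrite (le_trans h)// ler_piMl// -expR0 ler_expR oppr_le0 mulr_ge0 ?ltW.
split.
  apply: (@le_Rintegrable _ _ _ mu Rpos _
    (fun t => \int[mu]_(r in Rpos) G r * expR (- s * t))) => //.
  - apply: continuous_itvoy_measurable => t t0; apply: cvgM.
      apply: (@continuous_comp _ _ _ (fun t : R => - s * t) expR).
        by apply: cvgM; [exact: cvg_cst|exact: cvg_id].
      exact: continuous_expR.
    exact: (is_derive1_continuous (is_derive_contour_integral_t b0 b1 L0 la0 tA x0 t0)).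
  - exact: integrable_expRN.
  - move=> t /posP t0; rewrite normrM (ger0_norm (expR_ge0 _)) mulrC ler_wpM2r ?expR_ge0//.
    have i1 := integrable_contour_integrand b0 b1 L0 la0 tA x0 (ltW t0).
    rewrite (le_trans (le_normr_Rintegral _ i1))//.
    apply: le_Rintegral => //; first exact: (integrable_abse i1).
    by move=> r /posP r0; exact: cI0.
have E1 : laplace (contour_integral A x) s =
    \int[mu]_(t in Rpos) \int[mu]_(r in Rpos) (expR (- s * t) * contour_integrand A x t r).
  apply: eq_Rintegral => t /[!inE] /posP t0.
  rewrite RintegralZl//; apply: integrable_contour_integrand => //; exact: ltW.
rewrite E1 -(@Rintegral_fubini_pos _ (fun r t => expR (- s * t) * contour_integrand A x t r)
  G (fun t => expR (- (s + la) * t))) => //; last first.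
  apply: (@eq_measurable_fun _ _ _ _ _ (fun z : R * R => expR (- s * z.2) *
    (complex.Im (A z.1 * ray_exp x 0 z.1) / z.1 *
      (expR (z.2 * (z.1 * cos th - la)) * cos (z.2 * (z.1 * sin th))) +
    complex.Re (A z.1 * ray_exp x 0 z.1) / z.1 *
      (expR (z.2 * (z.1 * cos th - la)) * sin (z.2 * (z.1 * sin th)))))).
    move=> z /[!inE] -[/posP r0 _] /=; by rewrite ciE.
  have m1 (f : R -> R) : measurable_fun Rpos f ->
      measurable_fun (Rpos `*` Rpos) (fun z : R * R => f z.1).
    move=> mf; apply: (@measurable_comp _ _ _ _ _ _ Rpos f (Rpos `*` Rpos) fst) => //.
    - by move=> _ [z [? _] <-].
    - by apply: measurable_funTS; exact: measurable_fst.
  have mfst : measurable_fun (Rpos `*` Rpos) (fun z : R * R => z.1).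
    by apply: measurable_funTS; exact: measurable_fst.
  have msnd : measurable_fun (Rpos `*` Rpos) (fun z : R * R => z.2).
    by apply: measurable_funTS; exact: measurable_snd.
  have mexp : measurable_fun (Rpos `*` Rpos) (fun z : R * R => expR (z.2 * (z.1 * cos th - la))).
    apply: measurableT_comp; first exact: measurable_expR.
    apply: measurable_funM => //; apply: measurable_funB => //.
    by apply: measurable_funM.
  have marg : measurable_fun (Rpos `*` Rpos) (fun z : R * R => z.2 * (z.1 * sin th)).
    by apply: measurable_funM => //; apply: measurable_funM.
  apply: measurable_funM.
    apply: measurableT_comp; first exact: measurable_expR.
    by apply: measurable_funM.
  apply: measurable_funD; apply: measurable_funM.
  - exact: m1 mA.2.
  - apply: measurable_funM => //; apply: measurableT_comp marg.
    exact: continuous_measurable_fun (@continuous_cos R).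
  - exact: m1 mA.1.
  - apply: measurable_funM => //; apply: measurableT_comp marg.
    exact: continuous_measurable_fun (@continuous_sin R).
apply: eq_Rintegral => r /[!inE] /posP r0.
pose z := A r * ray_exp x 0 r.
pose p := (s + la)%:C%C - ray r.
have Rp : 0 < complex.Re p.
  rewrite /p /ray cReD cReN polar_pow1E//= subr_gt0.
  rewrite (@lt_trans _ _ 0)// pmulr_rlt0//; exact: cos_contour_lt0.
have [iz ez] := Rintegral_cexpN z Rp.
transitivity (\int[mu]_(t in Rpos) (r^-1 * complex.Im (z * cexp (t%:C%C * - p)))).
  apply: eq_Rintegral => t _.
  rewrite /contour_integrand mulrA -cImZ mulrC; congr (_ * complex.Im _).
  rewrite mulrC -mulrA /z -mulrA; congr (_ * _).
  rewrite -cexpR -!cexpD; congr cexp.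
  rewrite /p mul0r addr0 rmorphM/= rmorphD rmorphN/=; ring.
rewrite RintegralZl// ez mulrC /contour_integrand; congr (complex.Im _ / _).
by rewrite /z /p mulrAC.
Qed.

End laplace_contour.

(** * Bounded functions with vanishing Laplace transform *)

Section laplace_uniqueness.
Context {R : realType}.
Local Notation mu := (@lebesgue_measure R).
Local Notation Rpos := (`](0 : R), +oo[%classic).

(* With u t = expR (- q * t), the vanishing transforms say that g is orthogonal to
   every polynomial in u divisible by u.  The powers of 4 u (1 - u), which is
   maximal at the midpoint of ]a, b[ where u = 1/2, concentrate there. *)
Lemma laplace_vanish_not_pos (g : R -> R) (B a b c : R) :
  measurable_fun Rpos g -> (forall t, 0 < t -> `|g t| <= B) ->
  (forall s, 0 < s -> \int[mu]_(t in Rpos) (expR (- s * t) * g t) = 0) ->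
  0 <= a -> a < b -> 0 < c -> ~ (forall t, a < t < b -> c <= g t).
Proof.
move=> mg gB g0 a0 ab c0 gc.
have posP r : Rpos r -> 0 < r by rewrite /= in_itv/= andbT.
pose t0 := (a + b) / 2.
have t0p : 0 < t0 by rewrite /t0; lra.
pose q := ln 2 / t0.
have q0 : 0 < q by rewrite divr_gt0// ln_gt0// ltr1n.
pose u t := expR (- q * t).
pose k t := 4 * u t * (1 - u t).
have u0 t : 0 < u t by exact: expR_gt0.
have u1 t : 0 < t -> u t < 1.
  by move=> tp; rewrite -expR0 ltr_expR mulNr oppr_lt0 mulr_gt0.
have udec t t' : t < t' -> u t' < u t.
  by move=> tt'; rewrite ltr_expR !mulNr ltrN2 ltr_pM2l.
have ut0 : u t0 = 2^-1.
  by rewrite /u /q mulNr divfK ?gt_eqF// expRN lnK// posrE.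
have kE t : k t = 1 - (1 - 2 * u t) ^+ 2 by rewrite /k; ring.
have k01 t : 0 < t -> 0 <= k t <= 1.
  move=> tp; apply/andP; split.
    by rewrite /k !mulr_ge0 ?(ltW (u0 _))// subr_ge0 ltW// u1.
  by rewrite kE gerBl sqr_ge0.
have B0 : 0 <= B by rewrite (le_trans (normr_ge0 (g 1)))// gB.
have cu t : {for t, continuous u}.
  apply: (@continuous_comp _ _ _ (fun t : R => - q * t) expR).
    by apply: cvgM; [exact: cvg_cst|exact: cvg_id].
  exact: continuous_expR.
have ck t : {for t, continuous k}.
  apply: cvgM; first by apply: cvgM; [exact: cvg_cst|exact: cu].
  by apply: cvgB; [exact: cvg_cst|exact: cu].
have mu_ : measurable_fun Rpos u.
  by apply: continuous_itvoy_measurable => t _; exact: cu.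
have mk : measurable_fun Rpos k.
  by apply: continuous_itvoy_measurable => t _; exact: ck.
have iu : mu.-integrable Rpos (EFin \o u).
  have := integrable_expRN 1 q0; apply: eq_integrable => // t _ /=; by rewrite mul1r.
have ints n j : mu.-integrable Rpos (EFin \o (fun t => u t ^+ j.+1 * k t ^+ n * g t)).
  apply: (@le_Rintegrable _ _ _ mu Rpos _ (fun t => B * u t)) => //.
  - by apply: measurable_funM => //; apply: measurable_funM; exact: measurable_funX.
  - rewrite (_ : _ \o _ = (fun t => B%:E * (u t)%:E)%E); first exact: integrableZl.
    by apply/funext => t /=; rewrite EFinM.
  - move=> t /posP tp; rewrite !normrM mulrC ler_pM//; first exact: gB.
    rewrite !normrX (ger0_norm (ltW (u0 _))) (ger0_norm (andP (k01 _ tp)).1).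
    rewrite exprS -mulrA ler_piMr ?(ltW (u0 _))//.
    rewrite mulr_ile1 ?exprn_ge0 ?(ltW (u0 _)) ?(andP (k01 _ tp)).1//.
    + by rewrite exprn_ile1 ?(ltW (u0 _))// ltW// u1.
    + by rewrite exprn_ile1//; case/andP: (k01 _ tp).
(* Since [k = 4 * u - 4 * u ^ 2], one power of [k] is traded for higher powers of [u], so [j] must
   stay general. The exponent [j.+1] keeps the Laplace variable positive. *)
have van n : forall j, \int[mu]_(t in Rpos) (u t ^+ j.+1 * k t ^+ n * g t) = 0.
  elim: n => [|n IH] j.
    have h : \int[mu]_(t in Rpos) (expR (- (j.+1%:R * q) * t) * g t) = 0.
      by apply: g0; rewrite mulr_gt0.
    rewrite -[RHS]h; apply: eq_Rintegral => t _.
    rewrite expr0 mulr1 /u -expRM_natl; congr (expR _ * _).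
    ring.
  have -> : \int[mu]_(t in Rpos) (u t ^+ j.+1 * k t ^+ n.+1 * g t) =
      \int[mu]_(t in Rpos) (4 * (u t ^+ j.+2 * k t ^+ n * g t) -
        4 * (u t ^+ j.+3 * k t ^+ n * g t)).
    apply: eq_Rintegral => t _; rewrite !exprS /k; ring.
  have i4 i : mu.-integrable Rpos (EFin \o (fun t => 4 * (u t ^+ i.+1 * k t ^+ n * g t))).
    rewrite (_ : _ \o _ = (fun t => 4%:E * (u t ^+ i.+1 * k t ^+ n * g t)%:E)%E).
      by apply: integrableZl => //; exact: ints.
    by apply/funext => t /=; rewrite EFinM.
  by rewrite RintegralB// !RintegralZl// !IH mulr0 subrr.
(* As [k = 1 - (1 - 2 * u) ^ 2] and [u] decreases, [k] is at most [k a] before [a] and at most [k b]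
   after [b]. That [r] is positive is seen at [b], because [k a = 0] if [a = 0]. *)
pose r := Num.max (k a) (k b).
have at0 : a < t0 by rewrite /t0; lra.
have t0b : t0 < b by rewrite /t0; lra.
have ua := udec _ _ at0; have ub := udec _ _ t0b; rewrite ut0 in ua ub.
have r0 : 0 < r.
  rewrite lt_max; apply/orP; right; rewrite /k !mulr_gt0// subr_gt0.
  by move: ub; lra.
have r1 : r < 1.
  rewrite gt_max !kE !gtrBl !exprn_even_gt0//=.
  by apply/andP; split; apply/eqP; move: ua ub; lra.
have kmono x y : (1 - 2 * u x) ^+ 2 <= (1 - 2 * u y) ^+ 2 -> k y <= k x.
  by rewrite !kE lerD2l lerN2.
have udecW t t' : t <= t' -> u t' <= u t.
  by rewrite le_eqVlt => /predU1P[->//|/udec/ltW].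
have out t : ~~ (a < t < b) -> k t <= r.
  rewrite negb_and -!leNgt => /orP[ta|bt]; rewrite le_max; apply/orP.
  - left; apply: kmono; have h := udecW _ _ ta.
    move: h ua; move: (u t) (u a) => v w; nra.
  - right; apply: kmono; have h := udecW _ _ bt.
    move: h ub; move: (u t) (u b) => v w; nra.
pose rho := (1 + r) / 2.
have rr : r < rho by rewrite /rho; lra.
have rho1 : rho < 1 by rewrite /rho; lra.
have [eta eta0 heta] : exists2 eta, 0 < eta &
    forall t, t0 - eta <= t <= t0 + eta -> (a < t < b) /\ rho <= k t.
  have kt0 : k t0 = 1 by rewrite kE ut0; field.
  have : \forall t \near t0, rho < k t.
    by apply: (cvgr_gt (k t0) (ck t0)); rewrite kt0.
  move=> /nbhs_ballP[e /= e0 he].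
  pose eta := Num.min (e / 2) ((b - a) / 4).
  exists eta; first by rewrite lt_min !divr_gt0// subr_gt0.
  move=> t /andP[h1 h2].
  have e1 : eta <= e / 2 by rewrite ge_min lexx.
  have e2 : eta <= (b - a) / 4 by rewrite ge_min lexx orbT.
  split.
    by rewrite /t0 in h1 h2 *; apply/andP; split; lra.
  apply/ltW/he; rewrite /ball/= ltr_norml; apply/andP; split; lra.
pose I : set R := `[t0 - eta, t0 + eta]%classic.
pose M := c * u b * (2 * eta).
have M0 : 0 < M by rewrite !mulr_gt0.
pose N := \int[mu]_(t in Rpos) (B * u t).
have N0 : 0 <= N.
  by apply: Rintegral_ge0 => t _; rewrite mulr_ge0// ltW.
(* The vanishing integral of [u * k ^ n * g] is at least that of [lo]: the integrand is at least
   [c * u b * rho ^ n] near [t0], nonnegative elsewhere in []a, b[], and at least [- B * u * r ^ n]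
   outside. *)
have key n : rho ^+ n * M <= r ^+ n * N.
  pose lo t := c * u b * rho ^+ n * \1_I t - r ^+ n * (B * u t).
  have iI : mu.-integrable Rpos (EFin \o (\1_I : R -> R)).
    by apply: (integrableS _ _ _ (integrable_indic_itv (t0 - eta) (t0 + eta) true false)).
  have eI : \int[mu]_(t in Rpos) \1_I t = 2 * eta.
    rewrite /Rintegral integral_indic//; last exact: measurable_itv.
    rewrite setIidl; last first.
      move=> t; rewrite /I/= in_itv/= => /heta[/andP[h _] _].
      by rewrite in_itv/= andbT (le_lt_trans a0).
    have h : mu I = (2 * eta)%:E.
      have -> := lebesgue_measure_itv `[t0 - eta, t0 + eta].
      rewrite /= lte_fin ifT; last by move: eta0; lra.
      by rewrite -EFinD; congr EFin; ring.
    by rewrite [X in fine X]h.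
  have iB : mu.-integrable Rpos (EFin \o (fun t => B * u t)).
    rewrite (_ : _ \o _ = (fun t => B%:E * (u t)%:E)%E); first exact: integrableZl.
    by apply/funext => t /=; rewrite EFinM.
  have i1 : mu.-integrable Rpos (EFin \o (fun t => c * u b * rho ^+ n * \1_I t)).
    rewrite (_ : _ \o _ = (fun t => (c * u b * rho ^+ n)%:E * (\1_I t)%:E)%E).
      exact: integrableZl.
    by apply/funext => t /=; rewrite EFinM.
  have i2 : mu.-integrable Rpos (EFin \o (fun t => r ^+ n * (B * u t))).
    rewrite (_ : _ \o _ = (fun t => (r ^+ n)%:E * (B * u t)%:E)%E).
      exact: integrableZl.
    by apply/funext => t /=; rewrite -EFinM.
  have : \int[mu]_(t in Rpos) lo t <= \int[mu]_(t in Rpos) (u t ^+ 1 * k t ^+ n * g t).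
    apply: le_Rintegral => //.
      rewrite (_ : _ \o _ = (fun t => (c * u b * rho ^+ n * \1_I t)%:E - (r ^+ n * (B * u t))%:E)%E).
        exact: integrableB.
      by apply/funext => t.
    move=> t /posP tp; rewrite expr1 /lo.
    have kn0 : 0 <= k t ^+ n by rewrite exprn_ge0//; case/andP: (k01 _ tp).
    have rB : 0 <= r ^+ n * (B * u t) by rewrite !mulr_ge0 ?exprn_ge0 ?(ltW (u0 _)) ?(ltW r0).
    have [tI|tI] := boolP (t \in I).
      rewrite indicE tI mulr1.
      have [tab kt] : (a < t < b) /\ rho <= k t.
        by apply: heta; move: tI; rewrite inE /I/= in_itv.
      have gt := gc _ tab.
      rewrite (@le_trans _ _ (c * u b * rho ^+ n))//; first by rewrite gerBl.
      rewrite [leLHS](_ : _ = u b * rho ^+ n * c); last by ring.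
      have rh0 : 0 <= rho by rewrite (le_trans (ltW r0))// ltW.
      rewrite ler_pM ?mulr_ge0 ?exprn_ge0 ?(ltW (u0 _)) ?(ltW c0)//.
      rewrite ler_pM ?exprn_ge0 ?(ltW (u0 _))//.
        by apply: udecW; case/andP: tab => _ /ltW.
      by rewrite lerXn2r ?nnegrE// (le_trans rh0).
    rewrite indicE (negbTE tI) mulr0 sub0r.
    have [tab|tab] := boolP (a < t < b).
      rewrite (@le_trans _ _ 0) ?oppr_le0// mulr_ge0 ?mulr_ge0 ?(ltW (u0 _))//.
      by rewrite (le_trans (ltW c0))// gc.
    have kr := out _ tab.
    rewrite lerNl -mulrN (@le_trans _ _ (u t * k t ^+ n * B))//.
      rewrite ler_wpM2l ?mulr_ge0 ?(ltW (u0 _))//.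
      by rewrite (le_trans _ (gB _ tp))// -normrN ler_norm.
    rewrite [leLHS](_ : _ = k t ^+ n * (B * u t)); last by ring.
    rewrite ler_wpM2r ?mulr_ge0 ?(ltW (u0 _))//.
    by rewrite lerXn2r ?nnegrE ?(ltW r0)//; case/andP: (k01 _ tp).
  have e2 : \int[mu]_(t in Rpos) (r ^+ n * (B * u t)) = r ^+ n * N.
    exact: RintegralZl.
  rewrite van RintegralB// e2 RintegralZl// eI subr_le0 => h.
  rewrite /M mulrC (le_trans _ h)// le_eqVlt; apply/orP; left; apply/eqP; ring.
pose dl := rho / r - 1.
have dl0 : 0 < dl by rewrite subr_gt0 ltr_pdivlMr// mul1r.
(* Bernoulli's inequality makes [(rho / r) ^ n] unbounded, while [key] bounds it by [N / M]. *)
have bern n : 1 + n%:R * dl <= (1 + dl) ^+ n.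
  elim: n => [|n IH]; first by rewrite mul0r addr0 expr0.
  have d1 : 0 <= 1 + dl by rewrite addr_ge0// ltW.
  rewrite exprS (le_trans _ (ler_wpM2l d1 IH))//.
  have h : 0 <= n%:R * dl * dl by rewrite !mulr_ge0 ?(ltW dl0).
  rewrite [leRHS](_ : _ = 1 + n.+1%:R * dl + n%:R * dl * dl); last first.
    by rewrite -[n.+1]addn1 natrD; ring.
  by rewrite lerDl.
have rdl : rho / r = 1 + dl by rewrite /dl; ring.
pose m := (Num.truncn (N / M / dl)).+1.
have hm : N / M < m%:R * dl.
  by rewrite -ltr_pdivrMr// truncnS_gt.
have h : (rho / r) ^+ m <= N / M.
  rewrite expr_div_n ler_pdivrMr ?exprn_gt0// mulrAC ler_pdivlMr//.
  by rewrite [leRHS]mulrC; exact: key.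
rewrite rdl in h; have := le_trans (bern m) h.
by apply/negP; rewrite -ltNge (lt_trans hm)// ltrDr.
Qed.

End laplace_uniqueness.

(** * The density as a contour integral *)

Section subordinator_tail.
Context d (T : measurableType d) (R : realType) (P : probability T R).
Local Notation mu := (@lebesgue_measure R).
Local Notation Rpos := (`](0 : R), +oo[%classic).
Implicit Types D E : R -> {RV P >-> R}.

Lemma ae_le_measure (A B : set T) : measurable A -> measurable B ->
  {ae P, forall w, A w -> B w} -> (P A <= P B)%E.
Proof.
move=> mA mB [Z [mZ Z0 hZ]].
have : (P A <= P (B `|` Z))%E.
  apply: le_measure; rewrite ?inE//; first exact: measurableU.
  move=> w Aw; have [Bw|nBw] := pselect (B w); first by left.
  by right; apply: hZ => /= h; exact/nBw/h.
move=> /le_trans; apply; apply: (le_trans (measureU2 _ mB mZ)).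
by rewrite [X in (_ + X)%E]Z0 adde0.
Qed.

Definition tail (X : {RV P >-> R}) (t : R) : R := fine (P [set w | t < X w]).

Lemma measurable_tail_set (X : {RV P >-> R}) (t : R) :
  measurable [set w | t < X w].
Proof.
have -> : [set w | t < X w] = X @^-1` `]t, +oo[%classic.
  by apply/seteqP; split => w /=; rewrite in_itv/= andbT.
by rewrite -[_ @^-1` _]setTI; exact: measurable_funPT.
Qed.

Lemma tailE (X : {RV P >-> R}) (t : R) : (tail X t)%:E = P [set w | t < X w].
Proof. by rewrite /tail fineK// fin_num_measure//; exact: measurable_tail_set. Qed.

Lemma tail_ge0 (X : {RV P >-> R}) (t : R) : 0 <= tail X t.
Proof. by rewrite -lee_fin tailE. Qed.

Lemma tail_le1 (X : {RV P >-> R}) (t : R) : tail X t <= 1.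
Proof. by rewrite -lee_fin tailE probability_le1//; exact: measurable_tail_set. Qed.

Lemma tail_nonincreasing (X : {RV P >-> R}) (s t : R) : s <= t -> tail X t <= tail X s.
Proof.
move=> st; rewrite -lee_fin !tailE; apply: le_measure; rewrite ?inE//.
- exact: measurable_tail_set.
- exact: measurable_tail_set.
- by move=> w /=; exact: le_lt_trans.
Qed.

Lemma measurable_tail (X : {RV P >-> R}) (A : set R) : measurable A ->
  measurable_fun A (tail X).
Proof.
by move=> mA; apply: nonincreasing_measurable => // s t; exact: tail_nonincreasing.
Qed.

(** Tonelli on the region [0 < t < X w], where the inner integral of [exp (- s * t)] is
    elementary. *)
Lemma laplace_tail (X : {RV P >-> R}) (s : R) : 0 < s ->
  {ae P, forall w, 0 < X w} ->
  (\int[mu]_(t in Rpos) (expR (- s * t) * tail X t)%:E =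
   \int[P]_w ((1 - expR (- s * X w)) / s)%:E)%E.
Proof.
move=> s0 X0.
pose f (z : T * R) : \bar R := ((expR (- s * z.2))%:E * (\1_[set z : T * R | 0 < z.2 < X z.1] z)%:E)%E.
have mS : measurable [set z : T * R | 0 < z.2 < X z.1].
  have -> : [set z : T * R | 0 < z.2 < X z.1] =
    (fun z => X z.1 - z.2) @^-1` `]0, +oo[%classic `&` snd @^-1` Rpos.
    apply/seteqP; split => z /=; rewrite !in_itv/= !andbT subr_gt0.
      by move=> /andP[].
    by move=> [-> ->].
  have mX : measurable_fun setT (fun z : T * R => X z.1).
    by apply: measurableT_comp => //; exact: measurable_fst.
  have mB : measurable_fun setT (fun z : T * R => X z.1 - z.2).
    by apply: measurable_funB => //; exact: measurable_snd.
  apply: measurableI.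
    by rewrite -[_ @^-1` _]setTI; exact: mB.
  by rewrite -[_ @^-1` _]setTI; exact: measurable_snd.
have mf : measurable_fun setT f.
  apply: emeasurable_funM; apply/measurable_EFinP.
    apply: measurableT_comp; first exact: measurable_expR.
    by apply: measurable_funM => //; exact: measurable_snd.
  exact: measurable_indic.
have f0 z : (0 <= f z)%E by rewrite mule_ge0// lee_fin ?expR_ge0.
have := @fubini_tonelli _ _ _ _ R P mu f mf f0.
have -> : (\int[mu]_t \int[P]_w f (w, t) =
    \int[mu]_(t in Rpos) (expR (- s * t) * tail X t)%:E)%E.
  rewrite [RHS]integral_mkcond; apply: eq_integral => t _; rewrite patchE.
  case: ifPn; rewrite ?inE ?notin_setE/= in_itv/= andbT => t0.
    rewrite EFinM tailE -[in RHS](setIT [set w | t < X w]) -integral_indic//; last exact: measurable_tail_set.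
    rewrite -ge0_integralZl//.
    - apply: eq_integral => w _; rewrite /f/= !indicE; congr (_ * _%:E)%E.
      by congr (nat_of_bool _)%:R; apply/idP/idP; rewrite !inE/= t0.
    - apply/measurable_EFinP; apply: measurable_indic; exact: measurable_tail_set.
  rewrite -[RHS]/(0%E); apply: integral0_eq => w _; rewrite /f/= indicE memNset ?mule0//=.
  by apply/negP; rewrite negb_and (introN idP t0).
move=> <-; apply: ae_eq_integral => //.
- have -> : (fun w => \int[mu]_y f (w, y))%E = fubini_F mu f by [].
  exact: measurable_fun_fubini_tonelli_F.
- apply/measurable_EFinP; apply: measurable_funM => //; apply: measurable_funB => //.
  apply: measurableT_comp; first exact: measurable_expR.
  by apply: measurable_funM.
- apply: filterS X0 => w Xw _.
  have -> : (\int[mu]_t f (w, t) = \int[mu]_(t in `]0%R, X w[) (expR (- s * t))%:E)%E.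
    rewrite [RHS]integral_mkcond; apply: eq_integral => t _; rewrite patchE /f/= indicE.
    have -> : ((w, t) \in [set z : T * R | 0 < z.2 < X z.1]) = (t \in `]0%R, X w[%classic).
      by apply/idP/idP => /set_mem h; apply/mem_set; move: h; rewrite /= in_itv.
    by case: ifPn => _; rewrite ?mule1 ?mule0.
  have dG (t : R) : is_derive t 1 (fun t => - s^-1 * expR (- s * t)) (expR (- s * t)).
    have d1 := is_derive1M (is_derive_cst (- s) t 1) (is_derive_id (t : R^o) 1).
    have d2 := is_derive1_comp (is_derive_expR (- s * t)) d1.
    have d3 := is_derive1M (is_derive_cst (- s^-1) t 1) d2.
    apply: (is_derive_eq d3); rewrite /cst !mul0r !add0r mulr1 mulrCA mulrNN mulVf ?mulr1 ?gt_eqF//.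
  have c (t : R) : {for t, continuous (fun t : R => expR (- s * t))}.
    apply: (@continuous_comp _ _ _ (fun t : R => - s * t) expR).
      by apply: cvgM; [exact: cvg_cst|exact: cvg_id].
    exact: continuous_expR.
  have h := @Rintegral_FTC2 R (fun t => expR (- s * t)) (fun t => - s^-1 * expR (- s * t))
    0 (X w) Xw (fun t _ => dG t) (fun t _ => c t).
  have ic := @continuous_itvcc_integrable R (fun t => expR (- s * t)) 0 (X w) (fun t _ => c t).
  transitivity (\int[mu]_(t in `[0%R, X w]) (expR (- s * t))%:E)%E.
    have mE (A : set R) : measurable_fun A (fun t => (expR (- s * t))%:E).
      apply/measurable_EFinP; apply: measurable_funTS.
      apply: continuous_measurable_fun => t; exact: c.
    by rewrite integral_itv_bndo_bndc// integral_itv_obnd_cbnd.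
  rewrite -[LHS]fineK; last exact: integrable_fin_num.
  rewrite -[fine _]/(Rintegral _ _ _) h mulr0 expR0; congr EFin; ring.
Qed.

Lemma ae_gt0_subordinator D x : strictly_increasing_subordinator D -> 0 < x ->
  {ae P, forall w, 0 < D x w}.
Proof.
move=> [D0 _ _ Dinc _] x0.
by apply: filterS2 D0 Dinc => w e h; have := h 0 x (lexx _) x0; rewrite e.
Qed.

Lemma laplace_tail_tempered lambda beta D x s :
  tempered_stable_subordinator lambda beta D -> 0 < x -> 0 < s ->
  \int[mu]_(t in Rpos) (expR (- s * t) * tail (D x) t) =
  (1 - expR (- x * ((s + lambda) `^ beta - lambda `^ beta))) / s.
Proof.
move=> [HD /(_ s x) HL] x0 s0; have {HL} := HL s0 (ltW x0).
rewrite unlock => HL.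
rewrite /Rintegral laplace_tail//; last exact: ae_gt0_subordinator.
have mexp : measurable_fun setT (fun w => expR (- s * D x w)).
  apply: measurableT_comp; first exact: measurable_expR.
  by apply: measurable_funM.
have iexp : P.-integrable setT (EFin \o (fun w => expR (- s * D x w))).
  apply/integrableP; split; first exact/measurable_EFinP.
  under eq_integral do rewrite /= ger0_norm ?expR_ge0//.
  by rewrite HL ltry.
have i1 : P.-integrable setT (EFin \o (fun=> 1 : R)).
  exact: finite_measure_integrable_cst.
have iB : P.-integrable setT (EFin \o (fun w => 1 - expR (- s * D x w))).
  rewrite (_ : _ \o _ = (fun w => 1%:E - (expR (- s * D x w))%:E)%E).
    exact: integrableB.
  by apply/funext => w.
rewrite -[LHS]/(Rintegral P setT (fun w => (1 - expR (- s * D x w)) / s)).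
rewrite RintegralZr// RintegralB//.
rewrite {2}/Rintegral HL /= Rintegral_cst//.
have e : fine (P setT) = 1 by rewrite probability_setT.
by rewrite mul1r [X in X - _]e.
Qed.

(** If [E t w < x], some [u < x] has [t < D u w], and the path increases from [u] to [x]; if
    [t < D x w], then [x] itself competes in the infimum. Both implications hold almost surely,
    which suffices for the probabilities. *)
Lemma cdf_inverse_subordinator D E x t :
  strictly_increasing_subordinator D -> inverse_subordinator D E ->
  0 < x -> 0 <= t -> (P [set w | (E t w < x)%R] <= P [set w | (t < D x w)%R]
     <= P [set w | (E t w <= x)%R])%E.
Proof.
move=> [_ _ _ Dinc _] HE x0 t0.
have m1 : measurable [set w | E t w < x].
  have -> : [set w | E t w < x] = E t @^-1` `]-oo, x[%classic.
    by apply/seteqP; split => w /=; rewrite in_itv/=.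
  by rewrite -[_ @^-1` _]setTI; exact: measurable_funPT.
have m2 : measurable [set w | E t w <= x].
  have -> : [set w | E t w <= x] = E t @^-1` `]-oo, x]%classic.
    by apply/seteqP; split => w /=; rewrite in_itv/=.
  by rewrite -[_ @^-1` _]setTI; exact: measurable_funPT.
apply/andP; split; apply: ae_le_measure => //; try exact: measurable_tail_set.
- apply: filterS2 Dinc (HE t t0) => w Dw Ew /= Ex.
  have : (ereal_inf [set u%:E | u in [set u | (0 < u)%R /\ (t < D u w)%R]] < x%:E)%E.
    by rewrite -Ew lte_fin.
  move=> /ereal_inf_lt[_ [u [u0 tu] <-]]; rewrite lte_fin => ux.
  exact: lt_trans tu (Dw _ _ (ltW u0) ux).
- apply: filterS (HE t t0) => w Ew /= tD.
  by rewrite -lee_fin Ew; apply: ereal_inf_lbound; exists x.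
Qed.

(** The law of [E t] has a density, hence no atom at [x], and the two bounds of
    [cdf_inverse_subordinator] coincide. Integrability over the half-line is the total mass being
    1. *)
Lemma density_primitive D E (h : R -> R) x t :
  strictly_increasing_subordinator D -> inverse_subordinator D E ->
  continuous_density_pos (E t) h -> 0 < x -> 0 <= t ->
  mu.-integrable Rpos (EFin \o h) /\
  \int[mu]_(u in `]0, x]) h u = tail (D x) t.
Proof.
move=> HD HE [h0 hc hP] x0 t0.
have posP r : Rpos r -> 0 < r by rewrite /= in_itv/= andbT.
have mh : measurable_fun Rpos h.
  by apply: continuous_itvoy_measurable => r r0; exact: hc.
have ih : mu.-integrable Rpos (EFin \o h).
  apply/integrableP; split; first exact/measurable_EFinP.
  rewrite (_ : (\int[_]_(u in _) _)%E = P (E t @^-1` setT)).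
    by rewrite preimage_setT probability_setT ltry.
  rewrite hP// setTI; apply: eq_integral => r /[!inE] /posP r0 /=.
  by rewrite ger0_norm// h0.
split=> //.
have /andP[h1 h2] := cdf_inverse_subordinator HD HE x0 t0.
have e1 : P [set w | E t w <= x] = (\int[mu]_(u in `]0%R, x]) (h u)%:E)%E.
  have -> : [set w | E t w <= x] = E t @^-1` `]-oo, x]%classic.
    by apply/seteqP; split => w /=; rewrite in_itv/=.
  rewrite hP//; congr (integral _ _ _).
  by apply/seteqP; split => r /=; rewrite !in_itv/= andbT; [move=> [? ?]; apply/andP|move=> /andP[]].
have e2 : P [set w | E t w < x] = (\int[mu]_(u in `]0%R, x[) (h u)%:E)%E.
  have -> : [set w | E t w < x] = E t @^-1` `]-oo, x[%classic.
    by apply/seteqP; split => w /=; rewrite in_itv/=.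
  rewrite hP//; congr (integral _ _ _).
  by apply/seteqP; split => r /=; rewrite !in_itv/= andbT; [move=> [? ?]; apply/andP|move=> /andP[]].
have e3 : (\int[mu]_(u in `]0%R, x[) (h u)%:E = \int[mu]_(u in `]0%R, x]) (h u)%:E)%E.
  apply: integral_itv_bndo_bndc; apply/measurable_EFinP.
  by apply: measurable_funS mh => // r; rewrite /= !in_itv/= andbT => /andP[].
have : P [set w | t < D x w] = (\int[mu]_(u in `]0%R, x]) (h u)%:E)%E.
  by apply/eqP; rewrite eq_le -{1}e1 h2 -e3 -e2 h1.
by rewrite /Rintegral /tail => ->.
Qed.

End subordinator_tail.

Lemma is_derive1_divr {R : realType} (f : R -> R) (x l c : R) :
  is_derive x 1 f l -> is_derive x 1 (fun y => f y / c) (l / c).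
Proof.
move=> df; have d := is_derive1M df (is_derive_cst (c^-1) x 1).
by apply: (is_derive_eq d); rewrite mulr0 addr0.
Qed.

(** * Identification of the tail and of the density *)

Section density_as_contour_integral.
Context {R : realType}.
Local Notation C := R[i].
Local Notation mu := (@lebesgue_measure R).
Local Notation Rpos := (`](0 : R), +oo[%classic).
Variables (beta la : R).
Hypotheses (b0 : 0 < beta) (b1 : beta < 1) (la0 : 0 < la).
Local Notation L := (la `^ beta).
Local Notation th := (contour_angle beta).
Local Notation ray := (ray beta).
Local Notation ray_symbol := (ray_symbol beta L).
Local Notation contour_integral := (contour_integral beta L la).
Local Notation contour_integrand := (contour_integrand beta L la).

Let L0 : 0 <= L. Proof. exact: powR_ge0. Qed.

Definition resolvent_ray (s : R) (r : R) : C := ray r * (s%:C%C - ray r)^-1.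

Lemma tame_resolvent_ray s : 0 < s -> tame (resolvent_ray s).
Proof. by move=> s0; apply: tame_resolvent => //; exact: tame_ray_id. Qed.

Lemma contour_integral_resolvent x s : 0 < x -> 0 < s ->
  contour_integral (resolvent_ray s) x 0 = pi * expR (x * (L - s `^ beta)).
Proof.
move=> x0 s0; rewrite -(cauchy_formula L b0 b1 x0 s0).
apply: eq_Rintegral => r _.
rewrite /contour_integrand /cauchy_integrand; congr (complex.Im _ / _).
by rewrite /ray_exp mul0r addr0 mulrAC.
Qed.

(** Partial fractions: [1 / ((la - W) * (s + la - W))] is [1 / s] times the difference of the two
    resolvents. The Cauchy formula applies at the poles [la] and [s + la]; at [la] the exponent
    vanishes, which produces the term 1. *)
Lemma laplace_contour_integral0 x s : 0 < x -> 0 < s ->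
  laplace (contour_integral (resolvent_ray la) x) s =
  pi * ((1 - expR (- x * ((s + la) `^ beta - L))) / s).
Proof.
move=> x0 s0; have sl0 : 0 < s + la by rewrite addr_gt0.
have t1 := tame_resolvent_ray la0; have t2 := tame_resolvent_ray sl0.
have [_ ->] := laplace_contour_integral b0 b1 L0 la0 t1 x0 s0.
have i1 := integrable_contour_integrand b0 b1 L0 la0 t1 x0 (lexx 0).
have i2 := integrable_contour_integrand b0 b1 L0 la0 t2 x0 (lexx 0).
have iB : mu.-integrable Rpos (EFin \o (fun r => contour_integrand (resolvent_ray la) x 0 r -
    contour_integrand (resolvent_ray (s + la)) x 0 r)).
  rewrite (_ : _ \o _ = (fun r => (contour_integrand (resolvent_ray la) x 0 r)%:E -
    (contour_integrand (resolvent_ray (s + la)) x 0 r)%:E)%E); first exact: integrableB.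
  by apply/funext.
transitivity (\int[mu]_(r in Rpos) (s^-1 * (contour_integrand (resolvent_ray la) x 0 r -
    contour_integrand (resolvent_ray (s + la)) x 0 r))).
  apply: eq_Rintegral => r /[!inE]; rewrite /= in_itv/= andbT => r0.
  rewrite /contour_integrand -mulrBl mulrA; congr (_ / _).
  rewrite -cImN -cImD -cImZ; congr complex.Im.
  have n1 : la%:C%C - ray r != 0 by exact: sub_contour_neq0.
  have n2 : (s + la)%:C%C - ray r != 0 by exact: sub_contour_neq0.
  have n3 : s%:C%C != 0 :> C by rewrite -normc_eq0 normcR normr_eq0 gt_eqF.
  rewrite -mulrBl mulrA; congr (_ * _).
  have e1 : (s^-1)%:C%C = (s%:C%C)^-1 :> C by rewrite fmorphV.
  have e2 : (s + la)%:C%C = s%:C%C + la%:C%C :> C by rewrite rmorphD.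
  move: n1 n2; rewrite /resolvent_ray e1 e2.
  move: (ray r) la%:C%C s%:C%C n3 => w y v n3 n1 n2.
  by field; rewrite n1 n2 n3.
rewrite RintegralZl// RintegralB//.
rewrite -[X in s^-1 * (X - _)]/(contour_integral (resolvent_ray la) x 0).
rewrite -[X in s^-1 * (_ - X)]/(contour_integral (resolvent_ray (s + la)) x 0).
rewrite !contour_integral_resolvent// subrr mulr0 expR0.
rewrite (_ : x * (L - (s + la) `^ beta) = - x * ((s + la) `^ beta - L)); last by ring.
ring.
Qed.

Lemma continuous_contour_integral_t A x t : tame A -> 0 < x -> 0 < t ->
  {for t, continuous (contour_integral A x)}.
Proof.
move=> tA x0 t0.
exact: (is_derive1_continuous (is_derive_contour_integral_t b0 b1 L0 la0 tA x0 t0)).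
Qed.

Lemma contour_integral_bounded A x : tame A -> 0 < x ->
  exists B, forall t, 0 < t -> `|contour_integral A x t| <= B.
Proof.
move=> tA x0.
have [G iG hG] := contour_integrand_dominated_x la b0 b1 L0 x tA x0.
exists (\int[mu]_(r in Rpos) G r) => t t0.
have i1 := integrable_contour_integrand b0 b1 L0 la0 tA x0 (ltW t0).
rewrite (le_trans (le_normr_Rintegral _ i1))//.
apply: le_Rintegral => //; first exact: (integrable_abse i1).
move=> r; rewrite /= in_itv/= andbT => r0.
have xx : x <= x <= x by rewrite lexx.
have h := hG x t r xx (ltW t0) r0.
have g0 : 0 <= G r.
  by rewrite -(pmulr_rge0 _ (expR_gt0 (- (t * la)))) (le_trans _ h).
by rewrite (le_trans h)// ler_piMl// -expR0 ler_expR oppr_le0 mulr_ge0 ?ltW.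
Qed.

Context d (T : measurableType d) (P : probability T R).
Variables (D E : R -> {RV P >-> R}) (h : R -> R -> R).
Hypotheses (HD : tempered_stable_subordinator la beta D)
  (HE : inverse_subordinator D E)
  (Hh : forall t : R, 0 < t -> continuous_density_pos (E t) (fun x => h x t)).

(** Both sides have the same Laplace transform. Equality holds at every [t], not only almost
    everywhere, because the tail is nonincreasing and the contour integral continuous: a positive
    difference at [t] persists on an interval to the left of [t], a negative one on an interval to
    the right. *)
Lemma tail_contour x t : 0 < x -> 0 < t ->
  tail (D x) t = contour_integral (resolvent_ray la) x t / pi.
Proof.
move=> x0 t0.
have tA := tame_resolvent_ray la0.
pose c t := contour_integral (resolvent_ray la) x t / pi.
have pi0 : 0 < pi :> R := pi_gt0 _.
have cc u : 0 < u -> {for u, continuous c}.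
  by move=> u0; apply: cvgM; [exact: continuous_contour_integral_t|exact: cvg_cst].
have [B0 hB0] := contour_integral_bounded tA x0.
have cB u : 0 < u -> `|c u| <= B0 / pi.
  move=> u0; rewrite normrM normfV (gtr0_norm pi0) ler_wpM2r ?invr_ge0 ?(ltW pi0)//.
  exact: hB0.
pose g u := tail (D x) u - c u.
have mg : measurable_fun Rpos g.
  apply: measurable_funB; first exact: measurable_tail.
  exact: continuous_itvoy_measurable.
have gB u : 0 < u -> `|g u| <= 1 + B0 / pi.
  move=> u0; rewrite (le_trans (ler_normB _ _))// lerD ?cB//.
  by rewrite ger0_norm ?tail_ge0 ?tail_le1.
have gLi s : 0 < s -> mu.-integrable Rpos (EFin \o (fun u => expR (- s * u) * g u)).
  move=> s0.
  apply: (@le_Rintegrable _ _ _ mu Rpos _ (fun u => (1 + B0 / pi) * expR (- s * u))) => //.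
  - apply: measurable_funM => //.
    apply: measurableT_comp; first exact: measurable_expR.
    by apply: measurable_funM.
  - exact: integrable_expRN.
  - move=> u; rewrite /= in_itv/= andbT => u0.
    by rewrite normrM mulrC ler_pM// ?gB// ger0_norm ?expR_ge0.
have gL s : 0 < s -> \int[mu]_(u in Rpos) (expR (- s * u) * g u) = 0.
  move=> s0.
  have iT : mu.-integrable Rpos (EFin \o (fun u => expR (- s * u) * tail (D x) u)).
    apply: (@le_Rintegrable _ _ _ mu Rpos _ (fun u => 1 * expR (- s * u))) => //.
    - apply: measurable_funM; last exact: measurable_tail.
      apply: measurableT_comp; first exact: measurable_expR.
      by apply: measurable_funM.
    - exact: integrable_expRN.
    - move=> u _; rewrite normrM mulrC ler_pM//.
        by rewrite ger0_norm ?tail_ge0 ?tail_le1.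
      by rewrite ger0_norm ?expR_ge0.
  have [iC _] := laplace_contour_integral b0 b1 L0 la0 tA x0 s0.
  have iC' : mu.-integrable Rpos (EFin \o (fun u => pi^-1 *
      (expR (- s * u) * contour_integral (resolvent_ray la) x u))).
    rewrite (_ : _ \o _ = (fun u => (pi^-1)%:E *
      (expR (- s * u) * contour_integral (resolvent_ray la) x u)%:E)%E).
      exact: integrableZl.
    by apply/funext => u /=; rewrite EFinM.
  transitivity (\int[mu]_(u in Rpos) (expR (- s * u) * tail (D x) u - pi^-1 *
      (expR (- s * u) * contour_integral (resolvent_ray la) x u))).
    by apply: eq_Rintegral => u _; rewrite /g /c; ring.
  rewrite RintegralB// RintegralZl// (laplace_tail_tempered HD x0 s0).
  rewrite -[X in _ - pi^-1 * X]/(laplace (contour_integral (resolvent_ray la) x) s).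
  by rewrite laplace_contour_integral0// mulKf ?gt_eqF// subrr.
(* The condition [dl <= t] keeps the interval on the left of [t] inside the half-line. *)
have near_c e : 0 < e -> exists2 dl, 0 < dl <= t & forall u, `|t - u| < dl -> `|c t - c u| < e.
  move=> e0; have /cvgrPdist_lt /(_ e e0) /nbhs_ballP[dl /= dl0 hdl] := cc t t0.
  exists (Num.min dl t); first by rewrite lt_min dl0 t0/= ge_min lexx orbT.
  by move=> u; rewrite lt_min => /andP[hu _]; exact: hdl.
apply/eqP; rewrite -[_ / _]/(c t) eq_le; apply/andP; split; rewrite leNgt; apply/negP => lt1.
- pose e := (tail (D x) t - c t) / 2.
  have e0 : 0 < e by rewrite divr_gt0// subr_gt0.
  have [dl /andP[dl0 dlt] hdl] := near_c e e0.
  apply: (@laplace_vanish_not_pos _ g _ (t - dl) t e mg gB gL) => //.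
  + by rewrite subr_ge0.
  + by rewrite gtrBl.
  move=> u /andP[u1 u2].
  have h1 := tail_nonincreasing (D x) (ltW u2).
  have : `|c t - c u| < e by apply: hdl; rewrite ltr_norml; apply/andP; split; lra.
  rewrite ltr_norml => /andP[h2 h3].
  move: h1 h2 h3; rewrite /g /e; lra.
- pose e := (c t - tail (D x) t) / 2.
  have e0 : 0 < e by rewrite divr_gt0// subr_gt0.
  have [dl /andP[dl0 dlt] hdl] := near_c e e0.
  have mgN : measurable_fun Rpos (fun u => - g u) by exact: measurable_funN.
  have gBN u : 0 < u -> `|- g u| <= 1 + B0 / pi by move=> u0; rewrite normrN gB.
  have gLN s : 0 < s -> \int[mu]_(u in Rpos) (expR (- s * u) * - g u) = 0.
    move=> s0; have iG := gLi s s0.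
    rewrite (_ : (fun u => _) = (fun u => -1 * (expR (- s * u) * g u))).
      by rewrite RintegralZl// gL// mulr0.
    by apply/funext => u; ring.
  apply: (@laplace_vanish_not_pos _ (fun u => - g u) _ t (t + dl) e mgN gBN gLN) => //.
  + exact: ltW.
  + by rewrite ltrDl.
  move=> u /andP[u1 u2].
  have h1 := tail_nonincreasing (D x) (ltW u1).
  have : `|c t - c u| < e by apply: hdl; rewrite ltr_norml; apply/andP; split; lra.
  rewrite ltr_norml => /andP[h2 h3].
  move: h1 h2 h3; rewrite /g /e; lra.
Qed.

(** The exponent is [k.+1] because [resolvent_ray] alone gives the tail, of which the density is
    already the first derivative in [x]. *)
Definition density_deriv (k : nat) (x t : R) : R :=
  contour_integral (fun r => resolvent_ray la r * ray_symbol r ^+ k.+1) x t / pi.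

(** By continuity [h] is the derivative in [x] of its own primitive, and this primitive is the tail,
    known near [x] as a contour integral. *)
Lemma density_contour (x t : R) : 0 < x -> 0 < t -> h x t = density_deriv 0 x t.
Proof.
move=> x0 t0; have tA := tame_resolvent_ray la0.
have [HDs _] := HD.
have [_ hc _] := Hh t0.
have [ih _] := density_primitive HDs HE (Hh t0) x0 (ltW t0).
have xu : x < x + 1 by rewrite ltrDl.
have ih' : mu.-integrable `]0, x + 1] (EFin \o (fun x => h x t)).
  by apply: integrableS ih => // r; rewrite /= !in_itv/= => /andP[->].
have [dF F'] := @continuous_FTC1 R (fun x => h x t) (BRight 0) x (x + 1) xu ih' x0 (hc x x0).
rewrite -F'; apply: is_derive1_derive1.
have d1 := is_derive_contour_integral_x b0 b1 L0 la0 tA x0 (ltW t0).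
have d2 := is_derive1_divr pi d1.
have -> : density_deriv 0 x t =
    contour_integral (fun r => resolvent_ray la r * ray_symbol r) x t / pi.
  by congr (contour_integral _ _ _ / _); apply/funext => r; rewrite expr1.
apply: near_eq_is_derive d2.
near=> y.
have y0 : 0 < y by near: y; exact: lt_nbhsr.
have [_ ->] := density_primitive HDs HE (Hh t0) y0 (ltW t0).
by rewrite tail_contour.
Unshelve. all: by end_near. Qed.

Lemma tame_density_deriv k : tame (fun r => resolvent_ray la r * ray_symbol r ^+ k).
Proof. apply: (tame_symbolX b0 b1 L0); exact: tame_resolvent_ray. Qed.

Lemma is_derive_density_deriv k (x t : R) : 0 < x -> 0 <= t ->
  is_derive x 1 (fun x => density_deriv k x t) (density_deriv k.+1 x t).
Proof.
move=> x0 t0.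
have d1 := is_derive_contour_integral_x b0 b1 L0 la0 (tame_density_deriv k.+1) x0 t0.
have e : (fun r => resolvent_ray la r * ray_symbol r ^+ k.+2) =
    (fun r => resolvent_ray la r * ray_symbol r ^+ k.+1 * ray_symbol r).
  by apply/funext => r; rewrite (exprSr (ray_symbol r) k.+1) mulrA.
rewrite {2}/density_deriv e; exact: is_derive1_divr.
Qed.

(** The derivative at [x] depends on the values near [x], so the induction carries derivability and
    the formula together, for every positive [x]. *)
Lemma derive1n_density k (x t : R) : 0 < x -> 0 < t ->
  is_derive x 1 (derive1n k (fun z => h z t)) (density_deriv k.+1 x t) /\
  derive1n k (fun z => h z t) x = density_deriv k x t.
Proof.
move=> + t0; elim: k x => [|k IH] x x0.
  split; last by rewrite derive1n0; exact: density_contour.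
  apply: near_eq_is_derive (is_derive_density_deriv 0 x0 (ltW t0)).
  near=> y; rewrite derive1n0 density_contour//.
  by near: y; exact: lt_nbhsr.
rewrite derive1nS; have [d1 _] := IH x x0; split; last exact: is_derive1_derive1.
apply: near_eq_is_derive (is_derive_density_deriv k.+1 x0 (ltW t0)).
near=> y; have y0 : 0 < y by near: y; exact: lt_nbhsr.
by have [dy _] := IH y y0; rewrite (is_derive1_derive1 dy).
Unshelve. all: by end_near. Qed.

End density_as_contour_integral.

(** * The governing equation for beta = 1 / m *)

Section governing_equation.
Context {R : realType}.
Local Notation C := R[i].
Local Notation mu := (@lebesgue_measure R).
Local Notation Rpos := (`](0 : R), +oo[%classic).
Variables (beta la : R).
Hypotheses (b0 : 0 < beta) (b1 : beta < 1) (la0 : 0 < la).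
Local Notation L := (la `^ beta).
Local Notation ray := (ray beta).
Local Notation ray_symbol := (ray_symbol beta L).
Local Notation contour_integral := (contour_integral beta L la).
Local Notation contour_integrand := (contour_integrand beta L la).
Local Notation density_deriv := (density_deriv beta la).
Local Notation A0 := (resolvent_ray beta la).

Let L0 : 0 <= L. Proof. exact: powR_ge0. Qed.

Lemma contour_integral_sum (s : seq nat) (c : nat -> R) (A : nat -> R -> C) (x t : R) :
  (forall j, mu.-integrable Rpos (EFin \o contour_integrand (A j) x t)) ->
  mu.-integrable Rpos (EFin \o
    contour_integrand (fun r => \sum_(j <- s) (c j)%:C%C * A j r) x t) /\
  contour_integral (fun r => \sum_(j <- s) (c j)%:C%C * A j r) x t =
    \sum_(j <- s) c j * contour_integral (A j) x t.
Proof.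
move=> iA; rewrite /contour_integral; elim: s => [|j s [IH1 IH2]].
  have e : contour_integrand (fun r => \sum_(j <- [::]) (c j)%:C%C * A j r) x t = (fun=> 0).
    by apply/funext => r; rewrite /contour_integrand big_nil !mul0r.
  rewrite e big_nil; split; first exact: integrable0.
  by rewrite Rintegral_cst ?mul0r//; exact: measurable_itv.
have iZ : mu.-integrable Rpos (EFin \o (fun r => c j * contour_integrand (A j) x t r)).
  rewrite (_ : _ \o _ = (fun r => (c j)%:E * (contour_integrand (A j) x t r)%:E)%E).
    by apply: integrableZl => //; exact: iA.
  by apply/funext => r /=; rewrite EFinM.
have e : contour_integrand (fun r => \sum_(i <- j :: s) (c i)%:C%C * A i r) x t =
    (fun r => c j * contour_integrand (A j) x t r +
      contour_integrand (fun r => \sum_(i <- s) (c i)%:C%C * A i r) x t r).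
  apply/funext => r; rewrite /contour_integrand big_cons mulrDl cImD mulrDl.
  by rewrite -(mulrA _ (A j r)) cImZ mulrA.
rewrite e big_cons; split.
  rewrite (_ : _ \o _ = (fun r => (c j * contour_integrand (A j) x t r)%:E +
    (contour_integrand (fun r => \sum_(i <- s) (c i)%:C%C * A i r) x t r)%:E)%E).
    exact: integrableD.
  by apply/funext => r.
rewrite RintegralD// IH2; congr (_ + _); apply: RintegralZl => //; exact: iA.
Qed.

(** At [t = 0] the amplitude of the tail integrates, by the Cauchy formula at the pole [la], to
    [pi * exp 0], which does not depend on [x]; its derivative in [x] is 0. In terms of the process,
    [D x > 0] almost surely for each [x > 0]. *)
Lemma density_deriv_initial (x : R) : 0 < x -> density_deriv 0 x 0 = 0.
Proof.
move=> x0; have tA := tame_resolvent_ray b0 b1 la0.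
have d1 := is_derive1_divr pi (is_derive_contour_integral_x b0 b1 L0 la0 tA x0 (lexx 0)).
have e : density_deriv 0 x 0 = contour_integral (fun r => A0 r * ray_symbol r) x 0 / pi.
  by congr (contour_integral _ _ _ / _); apply/funext => r; rewrite expr1.
rewrite e -(is_derive1_derive1 d1); apply: is_derive1_derive1.
apply: near_eq_is_derive (is_derive_cst (1 : R) x 1).
near=> y; have y0 : 0 < y by near: y; exact: lt_nbhsr.
by rewrite contour_integral_resolvent// subrr mulr0 expR0 mulr1 divff ?gt_eqF ?pi_gt0.
Unshelve. all: by end_near. Qed.

Let A1 (r : R) : C := A0 r * ray_symbol r * (ray r - la%:C%C).

Let tA1 : tame A1.
Proof.
apply: (tame_ray _ la0); apply: (tame_symbol b0 b1 L0).
exact: tame_resolvent_ray.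
Qed.

Lemma is_derive_density_t (x t : R) : 0 < x -> 0 < t ->
  is_derive t 1 (density_deriv 0 x) (contour_integral A1 x t / pi).
Proof.
move=> x0 t0; apply: is_derive1_divr.
have tA : tame (fun r => A0 r * ray_symbol r).
  apply: (tame_symbol b0 b1 L0); exact: tame_resolvent_ray.
have := is_derive_contour_integral_t b0 b1 L0 la0 tA x0 t0.
by congr (is_derive _ _ (contour_integral _ _)); apply/funext => r; rewrite expr1.
Qed.

Lemma laplace_divr (f : R -> R) (s c : R) : laplace_integrable f s ->
  laplace_integrable (fun t => f t / c) s /\
  laplace (fun t => f t / c) s = laplace f s / c.
Proof.
move=> fi; have e : (fun t => expR (- s * t) * (f t / c)) =
    (fun t => expR (- s * t) * f t / c) by apply/funext => t; rewrite mulrA.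
split; last by rewrite /laplace e; exact: RintegralZr.
rewrite /laplace_integrable.
have -> : (fun t => (expR (- s * t) * (f t / c))%:E) =
    (fun t => (expR (- s * t) * f t)%:E * (c^-1)%:E)%E.
  by apply/funext => t; rewrite mulrA EFinM.
exact: integrableZr.
Qed.

Lemma eq_laplace (f g : R -> R) (s : R) : (forall t, 0 < t -> f t = g t) ->
  laplace_integrable f s ->
  laplace_integrable g s /\ laplace g s = laplace f s.
Proof.
move=> fg fi.
have posP r : r \in Rpos -> 0 < r by rewrite inE/= in_itv/= andbT.
split.
  by apply: eq_integrable fi => // t /posP t0; rewrite fg.
by apply: eq_Rintegral => t /posP t0; rewrite fg.
Qed.

(** Integration by parts on the transform side: [(W - la) / (s + la - W) = s / (s + la - W) - 1],
    and the amplitude left by [- 1] integrates to 0 by [density_deriv_initial]. *)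
Lemma laplace_density_t (x s : R) : 0 < x -> 0 < s ->
  laplace (fun t => contour_integral A1 x t / pi) s = s * laplace (density_deriv 0 x) s.
Proof.
move=> x0 s0.
have tA := tame_density_deriv b0 b1 la0 1.
have [i1 e1] := laplace_contour_integral b0 b1 L0 la0 tA1 x0 s0.
have [i2 e2] := laplace_contour_integral b0 b1 L0 la0 tA x0 s0.
have [_ ->] := laplace_divr pi i1; have [_ ->] := laplace_divr pi i2.
rewrite e1 e2 mulrA; congr (_ / _).
have sl0 : 0 < s + la by rewrite addr_gt0.
pose B r := A0 r * ray_symbol r ^+ 1 * ((s + la)%:C%C - ray r)^-1.
have tB : tame B by exact: tame_resolvent.
(* A combination of two amplitudes with coefficients [s] and [-1], written as an indexed family for
   [contour_integral_sum]. *)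
pose Af (j : nat) : R -> C := if j is 0%N then B else (fun r => A0 r * ray_symbol r ^+ 1).
pose cf (j : nat) : R := if j is 0%N then s else -1.
have iAf j : mu.-integrable Rpos (EFin \o contour_integrand (Af j) x 0).
  by apply: integrable_contour_integrand => //; case: j.
have [_ h] := contour_integral_sum [:: 0%N; 1%N] cf iAf.
have e3 : contour_integral (fun r => A0 r * ray_symbol r ^+ 1) x 0 = 0.
  have := density_deriv_initial x0; rewrite /density_deriv => /eqP.
  by rewrite mulf_eq0 invr_eq0 (gt_eqF (pi_gt0 _)) orbF => /eqP.
move: h; rewrite !big_cons !big_nil /= e3 mulr0 !addr0 => <-.
apply: eq_Rintegral => r; rewrite inE/= in_itv/= andbT => r0.
rewrite /contour_integrand; congr (complex.Im (_ * _) / _).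
rewrite !big_cons big_nil /= addr0 /B /A1 expr1.
have n2 : (s + la)%:C%C - ray r != 0 by exact: sub_contour_neq0.
have e4 : (s + la)%:C%C = s%:C%C + la%:C%C :> C by rewrite rmorphD.
have e5 : (-1)%:C%C = -1 :> C by rewrite rmorphN rmorph1.
move: n2; rewrite e4 e5; move: (A0 r) (ray_symbol r) (ray r) la%:C%C s%:C%C => a y w l v n2.
by field; rewrite n2.
Qed.

(** Here [L - ray_symbol r] is the power [beta] of the point on the ray, and [polar_pow] is an
    exponential in its exponent, so the [m]-th power is exactly [ray r], with no branch
    condition. *)
Lemma binomial_ray_symbol (m : nat) (r : R) : (0 < m)%N -> beta = m%:R^-1 -> 0 < r ->
  \sum_(1 <= j < m.+1)
    ((-1) ^+ j * 'C(m, j)%:R * la `^ (1 - j%:R / m%:R))%:C%C * ray_symbol r ^+ j =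
  ray r - la%:C%C :> C.
Proof.
move=> m0 bm r0.
have mR : m%:R != 0 :> R by rewrite pnatr_eq0 -lt0n.
have hm : (L%:C%C - ray_symbol r) ^+ m = ray r.
  have -> : L%:C%C - ray_symbol r = polar_pow beta r (contour_angle beta).
    by rewrite /ray_symbol opprD opprK addrA subrr add0r.
  have e : beta *+ m = 1 by rewrite bm -[LHS]mulr_natr mulVf.
  by rewrite -(polar_pow_natmul m beta r (contour_angle beta)) e.
have hL j : (j <= m)%N -> la `^ (1 - j%:R / m%:R) = L ^+ (m - j).
  move=> jm; rewrite -powR_mulrn// -powRrM; congr (_ `^ _).
  by rewrite bm natrB// mulrBr mulVf// mulrC.
rewrite -hm exprBn -(big_mkord xpredT
  (fun i => ((-1) ^+ i * L%:C%C ^+ (m - i) * ray_symbol r ^+ i) *+ 'C(m, i))).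
rewrite big_ltn// expr0 mul1r subn0 expr0 mulr1 bin0 mulr1n.
have -> : L%:C%C ^+ m = la%:C%C :> C.
  by rewrite -rmorphXn/=; have := hL 0%N (leq0n _); rewrite mul0r subr0 powRr1 ?(ltW la0)// subn0 => <-.
rewrite addrC addKr; apply: eq_big_nat => j /andP[_ jm].
rewrite hL// -[RHS]mulr_natl !rmorphM rmorph_nat rmorphXn rmorphN rmorph1 rmorphXn/=.
by rewrite -!mulrA mulrCA.
Qed.

Lemma sum_density_deriv (m : nat) (x t : R) : (0 < m)%N -> beta = m%:R^-1 ->
  0 < x -> 0 <= t ->
  \sum_(1 <= j < m.+1)
    (-1) ^+ j * 'C(m, j)%:R * la `^ (1 - j%:R / m%:R) * density_deriv j x t =
  contour_integral A1 x t / pi.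
Proof.
move=> m0 bm x0 t0.
pose c j : R := (-1) ^+ j * 'C(m, j)%:R * la `^ (1 - j%:R / m%:R).
have iA j := integrable_contour_integrand b0 b1 L0 la0 (tame_density_deriv b0 b1 la0 j.+1) x0 t0.
have [_ h] := contour_integral_sum (index_iota 1 m.+1) c iA.
rewrite (_ : contour_integral A1 x t = \sum_(j <- index_iota 1 m.+1)
  c j * contour_integral (fun r => A0 r * ray_symbol r ^+ j.+1) x t).
  by rewrite mulr_suml; apply: eq_bigr => j _; rewrite /density_deriv mulrA.
rewrite -h; apply: eq_Rintegral => r; rewrite inE/= in_itv/= andbT => r0.
rewrite /contour_integrand; congr (complex.Im (_ * _) / _).
rewrite /A1 -(binomial_ray_symbol m0 bm r0) mulr_sumr; apply: eq_bigr => j _.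
rewrite -/(c j) exprS; move: (A0 r) (ray_symbol r) (_ ^+ j) => a y z; ring.
Qed.

(** The density and its derivatives are replaced by contour integrals. The limit at [t = 0] is 0, so
    [initial_value] is 0 and the right-hand side reduces to the transform of the time derivative,
    which [sum_density_deriv] matches pointwise for [t > 0]. *)
Lemma ITS_governing_equation (h : R -> R -> R) (m : nat) (x : R) :
  (forall k (x t : R), 0 < x -> 0 < t ->
    derive1n k (fun z => h z t) x = density_deriv k x t) ->
  (2 <= m)%N -> beta = m%:R^-1 -> 0 < x ->
  [/\ cvg (h x t @[t --> 0^'+]),
      forall t : R, 0 < t -> derivable (h x) t 1 &
      forall s : R, 0 < s ->
      [/\ forall j : nat, (j <= m)%N ->
            laplace_integrable (fun t => derive1n j (fun z => h z t) x) s,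
          laplace_integrable (derive1 (h x)) s,
          laplace (derive1 (h x)) s
            = s * laplace (h x) s - initial_value h x &
          laplace (fun t => \sum_(1 <= j < m.+1)
              (-1) ^+ j * 'C(m, j)%:R * la `^ (1 - j%:R / m%:R)
                * derive1n j (fun z => h z t) x) s
            = laplace (derive1 (h x)) s
              + initial_value h x * laplace_dirac0 s]].
Proof.
move=> hE m2 bm x0.
have h0 t : 0 < t -> h x t = density_deriv 0 x t by move=> t0; rewrite -hE.
have lim0 : h x t @[t --> 0^'+] --> (0 : R).
  have c1 := contour_integral_cvg_t0 b0 b1 L0 la0 (tame_density_deriv b0 b1 la0 1) x0.
  have c2 : density_deriv 0 x t @[t --> 0^'+] --> density_deriv 0 x 0.
    exact: cvgM c1 (cvg_cst (pi^-1 : R)).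
  rewrite density_deriv_initial// in c2.
  apply: cvg_trans c2; apply: near_eq_cvg; near=> t.
  have t0 : 0 < t by near: t; exact: nbhs_right_gt.
  by rewrite h0.
have dh (t : R) : 0 < t -> is_derive t 1 (h x) (contour_integral A1 x t / pi).
  move=> t0; apply: near_eq_is_derive (is_derive_density_t x0 t0).
  near=> u; have u0 : 0 < u by near: u; exact: lt_nbhsr.
  by rewrite h0.
have iv0 : initial_value h x = 0 by exact: (cvg_lim (@Rhausdorff R) lim0).
split.
- by apply/cvg_ex; exists 0.
- by move=> t /dh d; exact: is_derive1_derivable.
move=> s s0.
have ih k : laplace_integrable (density_deriv k x) s.
  have [i1 _] := laplace_contour_integral b0 b1 L0 la0 (tame_density_deriv b0 b1 la0 k.+1) x0 s0.
  by have [] := laplace_divr pi i1.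
have idt : laplace_integrable (fun t => contour_integral A1 x t / pi) s.
  have [i1 _] := laplace_contour_integral b0 b1 L0 la0 tA1 x0 s0.
  by have [] := laplace_divr pi i1.
have [idh edh] : laplace_integrable (derive1 (h x)) s /\
    laplace (derive1 (h x)) s = laplace (fun t => contour_integral A1 x t / pi) s.
  by apply: eq_laplace => // t t0; rewrite (is_derive1_derive1 (dh t t0)).
have [_ elh] : laplace_integrable (h x) s /\ laplace (h x) s = laplace (density_deriv 0 x) s.
  by apply: eq_laplace => // t t0; rewrite h0.
split.
- move=> j _; apply: (proj1 (@eq_laplace (density_deriv j x) _ s _ (ih j))) => t t0.
  by rewrite hE.
- exact: idh.
- by rewrite iv0 subr0 edh elh laplace_density_t.
- rewrite iv0 mul0r addr0 edh.
  apply: (proj2 (@eq_laplace (fun t => contour_integral A1 x t / pi) _ s _ idt)) => t t0.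
  rewrite -(sum_density_deriv (ltnW m2) bm x0 (ltW t0)).
  by apply: eq_bigr => j _; rewrite hE.
Unshelve. all: by end_near. Qed.

End governing_equation.

(** * Behaviour at x = 0 *)

Section rotation_to_cut.
Context {R : realType}.
Local Notation C := R[i].
Local Notation mu := (@lebesgue_measure R).
Local Notation Rpos := (`](0 : R), +oo[%classic).
Variables (beta la t : R) (k : nat).
Hypotheses (b0 : 0 < beta) (b1 : beta < 1) (la0 : 0 < la) (t0 : 0 < t).
Local Notation L := (la `^ beta).
Local Notation th := (contour_angle beta).
Local Notation W := (@polar_pow R 1).

Let L0 : 0 <= L. Proof. exact: powR_ge0. Qed.

(** The integrand at [x = 0] with the argument left free: [p = th] gives the one of [density_deriv],
    and [p = pi] the cut. *)
Definition rotated_integrand (r p : R) : C :=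
  W r p * (la%:C%C - W r p)^-1 * (L%:C%C - polar_pow beta r p) ^+ k.+1 *
  cexp (t%:C%C * (W r p - la%:C%C)).
Local Notation f := rotated_integrand.

Let cos_le0 (p : R) : pi / 2 < p -> p < 3 * pi / 2 -> cos p <= 0.
Proof.
move=> p1 p2; have -> : p = p - pi + pi by rewrite subrK.
rewrite cosDpi oppr_le0 ltW// cos_gt0_pihalf//; apply/andP; split; lra.
Qed.

(** On this sector the cosine is nonpositive, which keeps the pole at distance at least [la]; the
    sector extends past [pi], so that the rotation may end there. *)
Let regular_f (r0 r1 : R) : 0 < r0 -> polar_regular r0 r1 (pi / 2) (3 * pi / 2) f.
Proof.
move=> r00; apply: regularM.
  apply: regularM.
    apply: regularM; first exact: regular_pow.
    apply: (regularV la0).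
      move=> r p /andP[h _] /andP[p1 p2].
      exact: (normc_sub_polar_ge_cos la0 (lt_le_trans r00 h) (cos_le0 p1 p2)).1.
    apply: regularD; first exact: regular_cst.
    by apply: regularN => //; exact: regular_pow.
  apply: regularX; apply: regularD; first exact: regular_cst.
  by apply: regularN => //; exact: regular_pow.
apply: regular_cexp; apply: regularM; first exact: regular_cst.
by apply: regularD; [exact: regular_pow|exact: regular_cst].
Qed.

Let d : R := - cos th.
Let d0 : 0 < d. Proof. by rewrite oppr_gt0; exact: cos_contour_lt0. Qed.

Let cos_le_th (p : R) : th <= p -> p <= pi -> cos p <= - d.
Proof.
rewrite /d opprK le_eqVlt => /predU1P[->//|thp] ppi.
have h1 := contour_angle_gt0 b0; have h2 := contour_angle_lt b0.
have h3 : p \in `[0, pi] by rewrite in_itv/= (ltW (lt_trans h1 thp)).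
have h4 : th \in `[0, pi] by rewrite in_itv/= !ltW.
by rewrite ltW// ltr_cos.
Qed.

Let K : R := la^-1 * (L + 1) ^+ k.+1.

Let K0 : 0 <= K.
Proof. by rewrite mulr_ge0 ?invr_ge0 ?exprn_ge0 ?addr_ge0// ltW. Qed.

Lemma normc_rotated_integrand (r p : R) : 0 < r -> th <= p -> p <= pi ->
  normc (f r p) <= r * (K * ((1 + r) ^+ k.+1 * expR (- (t * d * r `^ 1)))).
Proof.
move=> r0 p1 p2; have cp := cos_le_th p1 p2.
have cp0 : cos p <= 0 by rewrite (le_trans cp)// oppr_le0 ltW.
rewrite !normcM normcV normcX normc_cexp normc_polar_pow// powRr1 ?(ltW r0)//.
have e1 : (normc (la%:C%C - W r p))^-1 <= la^-1.
  have [h _] := normc_sub_polar_ge_cos la0 r0 cp0.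
  by rewrite lef_pV2 ?posrE// (lt_le_trans la0).
have e2 : normc (L%:C%C - polar_pow beta r p) <= (L + 1) * (1 + r).
  exact: normc_subr_polar_pow_le (ltW b0) (ltW b1) L0 r0.
have e3 : expR (complex.Re (t%:C%C * (W r p - la%:C%C))) <= expR (- (t * d * r)).
  rewrite ler_expR cReZ cReD cReN polar_pow1E//= -mulrA -mulrN ler_wpM2l ?(ltW t0)//.
  have : r * cos p <= r * - d by rewrite ler_wpM2l// ltW.
  move: la0; nra.
rewrite [leRHS](_ : _ = r * la^-1 * ((L + 1) * (1 + r)) ^+ k.+1 * expR (- (t * d * r))); last first.
  by rewrite exprMn /K; ring.
have X0 : 0 <= normc (L%:C%C - polar_pow beta r p) ^+ k.+1 by rewrite exprn_ge0// normc_ge0.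
rewrite ler_pM ?expR_ge0//.
  by rewrite !mulr_ge0 ?invr_ge0 ?normc_ge0// ltW.
rewrite ler_pM//.
- by rewrite mulr_ge0 ?invr_ge0 ?normc_ge0// ltW.
- by rewrite ler_wpM2l// ltW.
- by rewrite lerXn2r ?nnegrE ?normc_ge0// !mulr_ge0 ?addr_ge0// ltW.
Qed.

Let th_pi2 : pi / 2 < th := contour_angle_gt b0 b1.
Let th_pi : th < pi := contour_angle_lt b0.
Let pi_32 : pi < 3 * pi / 2 :> R.
Proof. by have := @pi_gt0 R; lra. Qed.

Let ccont_f (r p : R) : 0 < r -> th <= p -> p <= pi -> ccont (f ^~ p) r.
Proof.
move=> r0 p1 p2.
apply: (polar_regular_ccont (r0 := r) (r1 := r) _ _ (@regular_f r r r0)).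
  by rewrite lexx.
by rewrite (lt_le_trans th_pi2 p1) (le_lt_trans p2 pi_32).
Qed.

Lemma integrable_rotated (p : R) : th <= p -> p <= pi ->
  mu.-integrable Rpos (EFin \o (fun r => complex.Im (f r p) / r)).
Proof.
move=> p1 p2.
apply: (@integrable_le_expRN_powR _ _ K (t * d) 1 k.+1) => //.
- exact: mulr_gt0.
- move=> r r0; apply: cvgM; last by apply: inv_continuous; rewrite gt_eqF.
  by have [_] := ccont_f r0 p1 p2.
- move=> r r0; rewrite normrM normfV (gtr0_norm r0) ler_pdivrMr//.
  rewrite (le_trans (normr_Im_le _))// [leRHS]mulrC.
  exact: normc_rotated_integrand.
Qed.

Lemma Rintegral_rotated :
  \int[mu]_(r in Rpos) (complex.Im (f r th) / r) =
  \int[mu]_(r in Rpos) (complex.Im (f r pi) / r).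
Proof.
have td0 : 0 < t * d by exact: mulr_gt0.
have [K1 K10 hK1] := @expRN_powR_decay R (t * d) 1 k.+1 td0 ltr01.
(* One bound for each arc: [r / (1 + r ^ 2)] is at most [r] and at most [1 / r], hence at most
   [1 / (n + 1)] at both ends of the segment. *)
have nrm (r p : R) : 0 < r -> th <= p -> p <= pi ->
    normc (f r p) <= K * K1 * r /\ normc (f r p) <= K * K1 / r.
  move=> r0 p1 p2; have := normc_rotated_integrand r0 p1 p2.
  have := hK1 r r0; set X := _ * expR _ => hX hf.
  have r2 : 0 < 1 + r ^+ 2 by rewrite ltr_pwDl// sqr_ge0.
  have h : normc (f r p) <= r * (K * (K1 / (1 + r ^+ 2))).
    rewrite (le_trans hf)// ler_wpM2l ?(ltW r0)// ler_wpM2l//.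
  have KK : 0 <= K * K1 by rewrite mulr_ge0// ltW.
  split; rewrite (le_trans h)//.
    rewrite mulrC ler_wpM2r ?(ltW r0)// ler_wpM2l// ler_pdivrMr//.
    by rewrite ler_peMr ?(ltW K10)// lerDl sqr_ge0.
  rewrite ler_pdivlMr// mulrA mulrA -mulrA -mulrA mulrCA.
  rewrite [leLHS](_ : _ = K * K1 * (r ^+ 2 / (1 + r ^+ 2))); last by ring.
  by rewrite ler_piMr// ler_pdivrMr// mul1r lerDr.
have iT := Rintegral_exhaustion (integrable_rotated (lexx th) (ltW th_pi)).
have iP := Rintegral_exhaustion (integrable_rotated (ltW th_pi) (lexx pi)).
have c0 : (\int[mu]_(r in `[n.+1%:R^-1, n.+1%:R]) (complex.Im (f r pi) / r) -
    \int[mu]_(r in `[n.+1%:R^-1, n.+1%:R]) (complex.Im (f r th) / r)) @[n --> \oo] --> (0 : R).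
  have hb : 2 * (K * K1 * n.+1%:R^-1) * (pi - th) @[n --> \oo] --> (0 : R).
    rewrite [X in _ --> X](_ : 0 = 2 * (K * K1 * 0) * (pi - th)); last by rewrite !(mulr0, mul0r).
    apply: cvgM; last exact: cvg_cst.
    apply: cvgM; first exact: cvg_cst.
    apply: cvgM; first exact: cvg_cst.
    exact: cvg_harmonic.
  apply/norm_cvg0P.
  apply: (@squeeze_cvgr _ _ _ _ (fun=> 0) (fun n => 2 * (K * K1 * n.+1%:R^-1) * (pi - th))) => //.
    near=> n; rewrite normr_ge0/=.
    have n1 : 1 < n.+1%:R :> R by rewrite ltr1n ltnS; near: n; exact: nbhs_infty_gt.
    have n0 : 0 < n.+1%:R :> R by rewrite ltr0n.
    have nV : 0 < n.+1%:R^-1 :> R by rewrite invr_gt0.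
    apply: (rotation_bound _ th_pi2 (ltW th_pi) pi_32 (regular_f _ nV)).
      by rewrite nV/= (lt_trans _ n1)// invf_lt1.
    move=> p /andP[p1 p2]; split.
      by have [] := nrm _ p nV p1 p2.
    by have [] := nrm _ p n0 p1 p2.
  exact: cvg_cst.
apply/esym/eqP; rewrite -subr_eq0; apply/eqP.
apply: (cvg_unique (@Rhausdorff R) _ c0); exact: cvgB iP iT.
Unshelve. all: by end_near. Qed.

End rotation_to_cut.

(** De Moivre's formula for [rho * exp (- i * a)]. *)
Lemma cexpX_angle {R : realType} (rho a : R) (n : nat) :
  (((rho * cos a) +i* (- (rho * sin a)))%C : R[i]) ^+ n =
  ((rho ^+ n * cos (n%:R * a)) +i* (- (rho ^+ n * sin (n%:R * a))))%C.
Proof.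
elim: n => [|n IH].
  by rewrite !expr0 mul0r cos0 sin0 mulr0 mulr1 oppr0.
rewrite exprSr IH -natr1 mulrDl mul1r cosD sinD !exprSr.
by apply: complexP; rewrite ?cReM ?cImM /=; ring.
Qed.

(** * The integrand on the cut, with modulus and argument of the symbol *)

Section cut_values.
Context {R : realType}.
Local Notation C := R[i].
Local Notation mu := (@lebesgue_measure R).
Local Notation Rpos := (`](0 : R), +oo[%classic).
Variables (beta la t : R) (k : nat).
Hypotheses (b0 : 0 < beta) (b1 : beta < 1) (la0 : 0 < la) (t0 : 0 < t).
Local Notation L := (la `^ beta).
Local Notation th := (contour_angle beta).
Local Notation f := (rotated_integrand beta la t k).
Local Notation ray := (ray beta).
Local Notation ray_symbol := (ray_symbol beta L).
Local Notation contour_integrand := (contour_integrand beta L la).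

Definition cut_symbol (r : R) : C :=
  ((L - r `^ beta * cos (beta * pi)) +i* (- (r `^ beta * sin (beta * pi))))%C.

Lemma rotated_integrand_pi (r : R) : 0 < r -> complex.Im (f r pi) / r =
  expR (- la * t) * (expR (- t * r) / (r + la) * - complex.Im (cut_symbol r ^+ k.+1)).
Proof.
move=> r0; have lr0 : r + la != 0 by rewrite gt_eqF// addr_gt0.
have -> : f r pi = ((- r) * (la + r)^-1 * expR (t * (- r - la)))%:C%C * cut_symbol r ^+ k.+1.
  have -> : cut_symbol r = L%:C%C - polar_pow beta r pi.
    by apply: complexP; rewrite ?cReD ?cImD ?cReN ?cImN polar_powE//= ?sub0r.
  have W : polar_pow 1 r pi = (- r)%:C%C.
    by rewrite polar_pow1E// cospi sinpi mulr0 mulrN1.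
  rewrite /rotated_integrand W.
  have -> : la%:C%C - (- r)%:C%C = (la + r)%:C%C :> C by rewrite -rmorphB opprK.
  have -> : t%:C%C * ((- r)%:C%C - la%:C%C) = (t * (- r - la))%:C%C :> C.
    by rewrite -rmorphB -rmorphM.
  rewrite cexpR -fmorphV !rmorphM.
  by rewrite mulrAC -!mulrA.
rewrite cImZ; move: (complex.Im _) => z.
rewrite [t * _](_ : _ = - la * t + - t * r); last by ring.
rewrite expRD [la + r]addrC; field.
by rewrite lr0 gt_eqF.
Qed.

(** The cut symbol is [rho * exp (- i * a)]. Only [k] of its [k + 1] factors are put in polar form;
    the last one keeps its cartesian coordinates, which gives the difference of two sines. *)
Lemma Im_cut_symbolX (r a : R) : 0 < r -> is_alpha la beta r a ->
  - complex.Im (cut_symbol r ^+ k.+1) =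
  (la `^ (2 * beta) + r `^ (2 * beta)
      - 2 * la `^ beta * r `^ beta * cos (beta * pi)) `^ (k%:R / 2) *
   (la `^ beta * sin (k%:R * a) - r `^ beta * sin (k%:R * a - beta * pi)).
Proof.
move=> r0 [/andP[a0 api]]; cbv zeta => ha.
have sa0 : 0 < sin a by apply: sin_gt0_pi; rewrite a0.
have sb0 : 0 < sin (beta * pi) by exact: sinM_pi_gt0.
have num0 : 0 < r `^ beta * sin (beta * pi) by rewrite mulr_gt0 ?powR_gt0.
set num := r `^ beta * sin (beta * pi) in ha num0 *.
set den := L - r `^ beta * cos (beta * pi) in ha *.
(* The modulus is defined through the sine, which is positive on []0, pi[], whereas [cos a] vanishes
   when [den] does. *)
pose rho := num / sin a.
have rho0 : 0 < rho by exact: divr_gt0.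
have e1 : rho * sin a = num by rewrite divfK// gt_eqF.
have e2 : rho * cos a = den.
  move: ha; have [d0|d0] := eqVneq den 0.
    by move=> ->; rewrite cos_pihalf mulr0 d0.
  rewrite /tan => ha.
  (* Division by 0 being 0, [cos a = 0] would make [tan a] equal to 0, against [num > 0] and
     [den != 0]. *)
  have ca : cos a != 0.
    apply/eqP => ca; move: ha; rewrite ca invr0 mulr0 => /esym/eqP.
    by rewrite mulf_eq0 invr_eq0 (negbTE d0) orbF gt_eqF.
  have h : sin a * den = num * cos a.
    move/(congr1 (fun x => x * cos a * den)): ha.
    rewrite divfK// => ->; field; exact: d0.
  by rewrite /rho mulrAC -h mulrAC divff ?mul1r// gt_eqF.
have e3 : la `^ (2 * beta) + r `^ (2 * beta)
      - 2 * la `^ beta * r `^ beta * cos (beta * pi) = rho ^+ 2.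
  have -> : rho ^+ 2 = (rho * cos a) ^+ 2 + (rho * sin a) ^+ 2.
    by rewrite !exprMn -mulrDr cos2Dsin2 mulr1.
  rewrite e1 e2 /num /den sqrrB !exprMn -!addrA.
  rewrite [2 * beta]mulrC !powRrM !powR_mulrn ?powR_ge0//.
  by rewrite sin2cos2; ring.
have -> : cut_symbol r = ((rho * cos a) +i* (- (rho * sin a)))%C by rewrite e1 e2.
rewrite exprSr cexpX_angle cImM /= e3.
rewrite -[X in X `^ (k%:R / 2)](powR_mulrn 2 (ltW rho0)) -powRrM.
rewrite [2%:R * _](_ : _ = k%:R); last by field.
rewrite powR_mulrn ?(ltW rho0)// e1 e2 sinB /num /den.
by ring.
Qed.

Lemma rotated_integrand_th (r : R) : 0 < r -> complex.Im (f r th) / r =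
  contour_integrand (fun r => resolvent_ray beta la r * ray_symbol r ^+ k.+1) 0 t r.
Proof.
move=> r0; rewrite /contour_integrand /rotated_integrand /ray_exp mul0r add0r.
by rewrite /resolvent_ray /ray_symbol /ray.
Qed.

Lemma density_deriv_x0 : density_deriv beta la k 0 t =
  expR (- la * t) / pi * \int[mu]_(r in Rpos)
    (expR (- t * r) / (r + la) * - complex.Im (cut_symbol r ^+ k.+1)) /\
  mu.-integrable Rpos (EFin \o (fun r =>
    expR (- t * r) / (r + la) * - complex.Im (cut_symbol r ^+ k.+1))).
Proof.
have i1 : mu.-integrable Rpos (EFin \o (fun r =>
    expR (- t * r) / (r + la) * - complex.Im (cut_symbol r ^+ k.+1))).
  have i0 := integrable_rotated k b0 b1 la0 t0 (ltW (contour_angle_lt b0)) (lexx pi).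
  have : mu.-integrable Rpos
      (fun r => (expR (la * t))%:E * (complex.Im (f r pi) / r)%:E)%E.
    exact: integrableZl.
  apply: eq_integrable => // r; rewrite inE/= in_itv/= andbT => r0.
  rewrite /= rotated_integrand_pi// -EFinM [_ * (expR _ * _)]mulrA -expRD.
  by rewrite mulNr subrr expR0 mul1r.
split=> //.
transitivity ((\int[mu]_(r in Rpos) (complex.Im (f r th) / r)) / pi).
  congr (_ / _); apply: eq_Rintegral => r; rewrite inE/= in_itv/= andbT => r0.
  by rewrite rotated_integrand_th.
rewrite Rintegral_rotated// mulrAC; congr (_ / _).
rewrite -RintegralZl//; apply: eq_Rintegral => r; rewrite inE/= in_itv/= andbT => r0.
exact: rotated_integrand_pi.
Qed.

End cut_values.

(** * Gamma integrals for the limit in (a) *)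

Section gamma_integral.
Context {R : realType}.
Local Notation mu := (@lebesgue_measure R).
Local Notation Rpos := (`](0 : R), +oo[%classic).

Lemma Rintegral_affine_itvoy (G : R -> R) (a b : R) : 0 < a ->
  {within `[b, +oo[, continuous G} -> (forall x, b < x -> 0 <= G x) ->
  mu.-integrable Rpos (EFin \o (fun x => G (a * x + b))) ->
  \int[mu]_(y in `]b, +oo[) G y = a * \int[mu]_(x in Rpos) G (a * x + b).
Proof.
move=> a0 cG G0 iG.
pose F (x : R) := a * x + b.
have dF (x : R) : is_derive x 1 F a.
  have d1 := is_derive1D (is_derive1M (is_derive_cst a x 1) (is_derive_id x 1)) (is_derive_cst b x 1).
  by apply: (is_derive_eq d1); rewrite mul0r add0r addr0 mulr1.
have dFE : derive1 F = cst a by apply/funext => x; exact: is_derive1_derive1.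
have F0 : F 0 = b by rewrite /F mulr0 add0r.
have cG' : {in `]b, +oo[, continuous G} by move/continuous_within_itvcyP: cG => [].
have mG : measurable_fun `]b, +oo[ G.
  apply: continuous_itvoy_measurable => x bx; apply: cG'.
  by rewrite in_itv/= bx.
have Fy : F x @[x --> +oo%R] --> +oo%R.
  apply/cvgryPge => A; near=> x.
  rewrite /F -lerBlDr -(ler_pdivrMl _ _ a0).
  by near: x; apply: nbhs_pinfty_ge; rewrite num_real.
have e := @increasing_ge0_integration_by_substitutiony R F G 0.
rewrite -RintegralZl//; congr fine.
rewrite integral_itv_obnd_cbnd; last exact/measurable_EFinP.
rewrite -[in LHS]F0 e.
- rewrite -integral_itv_obnd_cbnd.
    by apply: eq_integral => x _; rewrite dFE/= mulrC.
  apply/measurable_EFinP; rewrite dFE; apply: measurable_funM; last exact: measurable_cst.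
  by case/integrableP: iG => /measurable_EFinP.
- by move=> x y _ _ xy; rewrite ltrD2r ltr_pM2l.
- by move=> x _; rewrite dFE; exact: cst_continuous.
- by rewrite dFE; exact: is_cvg_cst.
- by rewrite dFE; exact: is_cvg_cst.
- split.
    by move=> x _; exact: (is_derive1_derivable (dF x)).
  apply: cvg_at_right_filter; exact: (is_derive1_continuous (dF 0)).
- exact: Fy.
- by rewrite F0.
- by move=> x; rewrite F0 in_itv/= andbT; exact: G0.
Unshelve. all: by end_near. Qed.


Lemma powR_gt0_continuous (c x : R) : 0 < x -> {for x, continuous (@powR R ^~ c)}.
Proof. by move=> x0; exact: (is_derive1_continuous (is_derive1_powR c x0)). Qed.

Lemma continuous_expRM (a x : R) : {for x, continuous (fun r : R => expR (a * r))}.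
Proof.
apply: (@continuous_comp _ _ _ (fun r : R => a * r) expR).
  by apply: cvgM; [exact: cvg_cst|exact: cvg_id].
exact: continuous_expR.
Qed.

Lemma continuous_expRN (x : R) : {for x, continuous (fun r : R => expR (- r))}.
Proof.
apply: (@continuous_comp _ _ _ -%R expR); first exact: oppr_continuous.
exact: continuous_expR.
Qed.

Section stieltjes.
Variables (beta la t : R).
Hypotheses (b0 : 0 < beta) (b1 : beta < 1) (la0 : 0 < la) (t0 : 0 < t).

Let i_gamma (a : R) : 0 < a ->
  mu.-integrable Rpos (EFin \o (fun r => expR (- a * r) * r `^ beta)).
Proof.
move=> a0; apply: (@integrable_le_expRN_powR _ _ 1 a 1 1) => // r r0.
  by apply: cvgM; [exact: continuous_expRM|exact: powR_gt0_continuous].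
rewrite ger0_norm ?mulr_ge0 ?expR_ge0 ?powR_ge0// mul1r mulrC expr1.
rewrite powRr1 ?(ltW r0)// mulNr ler_wpM2r ?expR_ge0//.
by apply: powR_le_oneD; exact: ltW.
Qed.

Lemma Rintegral_gamma_scale (a : R) : 0 < a ->
  \int[mu]_(r in Rpos) (expR (- a * r) * r `^ beta) =
  a `^ (- beta - 1) * gamma_fun (1 + beta).
Proof.
move=> a0; rewrite /gamma_fun.
have e : 1 + beta - 1 = beta by rewrite addrAC subrr add0r.
have E (x : R) : 0 < x -> (a * x + 0) `^ (1 + beta - 1) * expR (- (a * x + 0)) =
    a `^ beta * (expR (- a * x) * x `^ beta).
  by move=> x0; rewrite e addr0 powRM ?ltW// mulNr; ring.
rewrite (@Rintegral_affine_itvoy (fun y => y `^ (1 + beta - 1) * expR (- y)) a 0 a0).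
- rewrite [X in _ = _ * (_ * X)](_ : _ =
      a `^ beta * \int[mu]_(r in Rpos) (expR (- a * r) * r `^ beta)); last first.
    rewrite -RintegralZl//; last exact: i_gamma.
    by apply: eq_Rintegral => x; rewrite inE/= in_itv/= andbT => /E.
  set J := LHS.
  rewrite -[X in _ = _ * (_ * (_ * X))]/J.
  rewrite [RHS](_ : _ = a `^ (- beta - 1) * a `^ beta * a * J); last by ring.
  rewrite -powRD ?(gt_eqF a0) ?implybT// addrAC addNr add0r powRN powRr1 ?(ltW a0)//.
  by rewrite mulVf ?gt_eqF// mul1r.
- apply/continuous_within_itvcyP; split.
    move=> x; rewrite in_itv/= andbT => x0; apply: cvgM.
      exact: powR_gt0_continuous.
    exact: continuous_expRN.
  rewrite e powR0 ?gt_eqF// mul0r.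
  rewrite -[X in _ --> X](mul0r (expR (- 0))); apply: cvgM; first exact: powR_cvg0.
  apply: cvg_at_right_filter.
  exact: continuous_expRN.
- by move=> x _; rewrite mulr_ge0 ?powR_ge0 ?expR_ge0.
- have : mu.-integrable Rpos (fun r => (a `^ beta)%:E * (expR (- a * r) * r `^ beta)%:E)%E.
    by apply: integrableZl => //; exact: i_gamma.
  apply: eq_integrable => // r; rewrite inE/= in_itv/= andbT => r0.
  by rewrite /= E.
Qed.

Let i_shift : mu.-integrable Rpos (EFin \o (fun v => expR (- la * v) * (v + t) `^ (- beta - 1))).
Proof.
apply: (@integrable_le_expRN_powR _ _ (t `^ (- beta - 1)) la 1 0) => // v v0.
  apply: cvgM; first exact: continuous_expRM.
  apply: (@continuous_comp _ _ _ (fun v : R => v + t) (@powR R ^~ _)).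
    by apply: cvgD; [exact: cvg_id|exact: cvg_cst].
  by apply: powR_gt0_continuous; exact: addr_gt0.
rewrite ger0_norm ?mulr_ge0 ?expR_ge0 ?powR_ge0// expr0 mul1r mulrC.
rewrite powRr1 ?(ltW v0)// mulNr ler_wpM2r ?expR_ge0//.
rewrite -opprD !powRN lef_pV2 ?posrE ?powR_gt0 ?addr_gt0//.
by rewrite ge0_ler_powR ?nnegrE ?addr_ge0 ?(ltW v0) ?(ltW t0) ?(ltW b0)// lerDr ltW.
Qed.

(** Substitution [y = la * (v + t)]. As [v + t > t > 0], the negative exponent meets no
    singularity. *)
Lemma inc_gamma_shift : \int[mu]_(v in Rpos) (expR (- la * v) * (v + t) `^ (- beta - 1)) =
  la `^ beta * expR (la * t) * inc_gamma (- beta) (la * t).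
Proof.
have lt0 : 0 < la * t by exact: mulr_gt0.
have E (v : R) : 0 < v ->
    (la * v + la * t) `^ (- beta - 1) * expR (- (la * v + la * t)) =
    (la `^ (- beta - 1) * expR (- (la * t))) * (expR (- la * v) * (v + t) `^ (- beta - 1)).
  move=> v0; rewrite -mulrDr powRM ?(ltW la0) ?addr_ge0 ?(ltW v0) ?(ltW t0)//.
  by rewrite mulrDr opprD expRD mulNr; ring.
rewrite /inc_gamma.
rewrite (@Rintegral_affine_itvoy (fun y => y `^ (- beta - 1) * expR (- y)) la (la * t) la0).
- rewrite [X in _ = _ * (_ * X)](_ : _ = la `^ (- beta - 1) * expR (- (la * t)) *
      \int[mu]_(v in Rpos) (expR (- la * v) * (v + t) `^ (- beta - 1))); last first.
    by rewrite -RintegralZl//; apply: eq_Rintegral => x; rewrite inE/= in_itv/= andbT => /E.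
  set J := LHS; rewrite -[X in _ = _ * (_ * (_ * X))]/J expRN.
  rewrite -opprD powRN powRD ?(gt_eqF la0) ?implybT// powRr1 ?(ltW la0)//.
  by field; rewrite !gt_eqF ?powR_gt0 ?expR_gt0.
- apply/continuous_within_itvcyP.
  have c (y : R) : 0 < y -> {for y, continuous (fun y => y `^ (- beta - 1) * expR (- y))}.
    by move=> y0; apply: cvgM; [exact: powR_gt0_continuous|exact: continuous_expRN].
  split; first by move=> y; rewrite in_itv/= andbT => ly; apply: c; exact: lt_trans ly.
  by apply: cvg_at_right_filter; exact: c.
- by move=> x _; rewrite mulr_ge0 ?powR_ge0 ?expR_ge0.
- have : mu.-integrable Rpos (fun r => (la `^ (- beta - 1) * expR (- (la * t)))%:E *
      (expR (- la * r) * (r + t) `^ (- beta - 1))%:E)%E.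
    exact: integrableZl.
  apply: eq_integrable => // r; rewrite inE/= in_itv/= andbT => r0.
  by rewrite /= E.
Qed.

Lemma Rintegral_expRN_pos (a : R) : 0 < a -> \int[mu]_(v in Rpos) expR (- a * v) = a^-1.
Proof.
(* With amplitude [i] and a real rate, the imaginary part is the real exponential itself. *)
move=> a0; have [_ h] := @Rintegral_cexpN R 'i%C a%:C%C a0.
rewrite -[RHS](_ : complex.Im ('i%C / a%:C%C) = _); last first.
  by rewrite -fmorphV mulrC cImZ /= mulr1.
rewrite -h; apply: eq_Rintegral => v _.
by rewrite -rmorphN -rmorphM cexpR ['i%C * _]mulrC cImZ /= mulr1 mulNr mulrN [v * a]mulrC.
Qed.

(* Write 1/(r + la) as the integral of expR (- (r + la) * v) over v > 0 and
   exchange the integrals. *)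
Lemma stieltjes_powR :
  \int[mu]_(r in Rpos) (expR (- t * r) * r `^ beta / (r + la)) =
  la `^ beta * gamma_fun (1 + beta) * expR (la * t) * inc_gamma (- beta) (la * t).
Proof.
pose H (r v : R) := expR (- t * r) * r `^ beta * expR (- (r + la) * v).
have := @Rintegral_fubini_pos R H (fun r => expR (- t * r) * r `^ beta)
  (fun v => 1 * expR (- la * v)) _ (i_gamma t0) (integrable_expRN 1 la0) _.
rewrite (_ : (\int[mu]_(r in Rpos) \int[mu]_(v in Rpos) H r v) =
    \int[mu]_(r in Rpos) (expR (- t * r) * r `^ beta / (r + la))); last first.
  apply: eq_Rintegral => r; rewrite inE/= in_itv/= andbT => r0.
  have rl0 : 0 < r + la by exact: addr_gt0.
  rewrite -Rintegral_expRN_pos// -RintegralZl//.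
  have := integrable_expRN 1 rl0; apply: eq_integrable => // v _.
  by rewrite /= mul1r.
move=> ->.
(* After the exchange the [r]-integral is a complete gamma integral of rate [v + t]; the remaining
   integral in [v] is that of [inc_gamma_shift]. *)
- transitivity (\int[mu]_(v in Rpos)
      (gamma_fun (1 + beta) * (expR (- la * v) * (v + t) `^ (- beta - 1)))).
    apply: eq_Rintegral => v; rewrite inE/= in_itv/= andbT => v0.
    have vt0 : 0 < v + t by exact: addr_gt0.
    rewrite mulrCA [gamma_fun _ * _]mulrC -Rintegral_gamma_scale// -RintegralZl//.
      apply: eq_Rintegral => r _; rewrite /H.
      rewrite [RHS]mulrA -expRD mulrAC -expRD; congr (expR _ * _); ring.
    exact: i_gamma.
  rewrite RintegralZl//.
    rewrite inc_gamma_shift; ring.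
- have mfst : measurable_fun (Rpos `*` Rpos) (fun z : R * R => z.1).
    by apply: measurable_funTS; exact: measurable_fst.
  have msnd : measurable_fun (Rpos `*` Rpos) (fun z : R * R => z.2).
    by apply: measurable_funTS; exact: measurable_snd.
  apply: measurable_funM.
    apply: measurable_funM.
      apply: measurableT_comp; first exact: measurable_expR.
      exact: measurable_funM.
    apply: (measurableT_comp (f := @powR R ^~ beta)) mfst.
    exact: measurable_powR.
  apply: measurableT_comp; first exact: measurable_expR.
  apply: measurable_funM => //; apply: measurableT_comp => //.
  exact: measurable_funD.
- move=> r v r0 v0; rewrite /H mul1r ger0_norm; last first.
    by rewrite !mulr_ge0 ?expR_ge0 ?powR_ge0.
  rewrite ler_wpM2l ?mulr_ge0 ?expR_ge0 ?powR_ge0// ler_expR ler_wpM2r ?(ltW v0)//.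
  by rewrite lerN2 lerDr ltW.
Qed.

End stieltjes.
End gamma_integral.

Lemma density_deriv_cvg_x0 {R : realType} (beta la t : R) (k : nat) :
  0 < beta -> beta < 1 -> 0 < la -> 0 < t ->
  density_deriv beta la k x t @[x --> 0^'+] --> density_deriv beta la k 0 t.
Proof.
move=> b0 b1 la0 t0; apply: cvgM; last exact: cvg_cst.
exact: (contour_integral_cvg_x0 b0 b1 (powR_ge0 _ _) la0
  (tame_density_deriv b0 b1 la0 k.+1) t0).
Qed.

Theorem proposition4p1 (R : realType) (d : measure_display)
    (T : measurableType d) (P : probability T R) (lambda beta : R)
    (D E : R -> {RV P >-> R}) (h : R -> R -> R)
    (lambda_gt0 : 0 < lambda) (beta_gt0 : 0 < beta) (beta_lt1 : beta < 1)
    (HD : tempered_stable_subordinator lambda beta D)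
    (HE : inverse_subordinator D E)
    (Hh : forall t : R, 0 < t -> continuous_density_pos (E t) (fun x => h x t)) :
  [/\ (* (a) *)
      forall t : R, 0 < t ->
        h x t @[x --> 0^'+] -->
          sin (beta * pi) / pi * lambda `^ beta * gamma_fun (1 + beta)
            * inc_gamma (- beta) (lambda * t),
      (* (b) *)
      forall (t : R) (k : nat) (alpha : R -> R), 0 < t ->
        (forall y : R, 0 < y -> is_alpha lambda beta y (alpha y)) ->
        [/\ forall (j : nat) (x : R), (j < k)%N -> 0 < x ->
              derivable (derive1n j (fun z => h z t)) x 1,
            (@lebesgue_measure R).-integrable `]0, +oo[
              (fun y => (deriv0_integrand lambda beta t k alpha y)%:E) &
            derive1n k (fun z => h z t) x @[x --> 0^'+] -->
              expR (- lambda * t) / pi *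
              \int[lebesgue_measure]_(y in `]0, +oo[)
                 deriv0_integrand lambda beta t k alpha y] &
      (* (c) *)
      forall m : nat, (2 <= m)%N -> beta = m%:R^-1 ->
        forall x : R, 0 < x ->
        [/\ cvg (h x t @[t --> 0^'+]),
            forall t : R, 0 < t -> derivable (h x) t 1 &
            forall s : R, 0 < s ->
            [/\ forall j : nat, (j <= m)%N ->
                  laplace_integrable (fun t => derive1n j (fun z => h z t) x) s,
                laplace_integrable (derive1 (h x)) s,
                laplace (derive1 (h x)) s
                  = s * laplace (h x) s - initial_value h x &
                laplace (fun t => \sum_(1 <= j < m.+1)
                    (-1) ^+ j * 'C(m, j)%:R * lambda `^ (1 - j%:R / m%:R)
                      * derive1n j (fun z => h z t) x) s
                  = laplace (derive1 (h x)) s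
                    + initial_value h x * laplace_dirac0 s]]].
Proof.
have hE k (x t : R) : 0 < x -> 0 < t ->
    derive1n k (fun z => h z t) x = density_deriv beta lambda k x t.
  by move=> x0 t0; have [] := derive1n_density beta_gt0 beta_lt1 lambda_gt0 HD HE Hh k x0 t0.
have lim0 k (t : R) : 0 < t ->
    derive1n k (fun z => h z t) x @[x --> 0^'+] --> density_deriv beta lambda k 0 t.
  move=> t0; have := @density_deriv_cvg_x0 R beta lambda t k beta_gt0 beta_lt1 lambda_gt0 t0.
  apply: cvg_trans; apply: near_eq_cvg; near=> x.
  have x0 : 0 < x by near: x; exact: nbhs_right_gt.
  exact/esym/hE.
split.
- move=> t t0; have := lim0 0%N t t0.
  have [-> i0] := density_deriv_x0 0 beta_gt0 beta_lt1 lambda_gt0 t0.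
  set rhs := (X in _ --> X -> _); set rhs' := (X in _ -> _ --> X).
  suff -> : rhs = rhs' by [].
  rewrite /rhs /rhs'.
  (* For [k = 0] no angle is involved: minus the imaginary part of the cut symbol is
     [r ^ beta * sin (beta * pi)], which leaves the integral of [stieltjes_powR]. *)
  have e1 : sin (beta * pi) * \int[lebesgue_measure]_(r in `](0:R), +oo[)
      (expR (- t * r) * r `^ beta / (r + lambda)) =
      \int[lebesgue_measure]_(r in `]0, +oo[)
      (expR (- t * r) / (r + lambda) * - complex.Im (cut_symbol beta lambda r ^+ 1)).
    have sb0 : 0 < sin (beta * pi) by exact: sinM_pi_gt0.
    have ptw r : expR (- t * r) / (r + lambda) * - complex.Im (cut_symbol beta lambda r ^+ 1) =
        sin (beta * pi) * (expR (- t * r) * r `^ beta / (r + lambda)).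
      by rewrite expr1 /= opprK; ring.
    rewrite -RintegralZl//; first by apply: eq_Rintegral => r _; rewrite ptw.
    (* Integrability without the sine is recovered from that of the cut integrand by dividing by
       this nonzero constant. *)
    have : (@lebesgue_measure R).-integrable `](0:R), +oo[ (fun r => (sin (beta * pi))^-1%:E *
        (expR (- t * r) / (r + lambda) * - complex.Im (cut_symbol beta lambda r ^+ 1))%:E)%E.
      exact: integrableZl.
    apply: eq_integrable => // r _.
    by rewrite ptw -EFinM mulKf// gt_eqF.
  rewrite -e1 stieltjes_powR//.
  rewrite [- lambda * t]mulNr expRN.
  have p0 : pi != 0 :> R by rewrite gt_eqF ?pi_gt0.
  have e0 : expR (lambda * t) != 0 by rewrite gt_eqF ?expR_gt0.
  move: (sin _) (inc_gamma _ _) (gamma_fun _) => a b c.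
  move: (expR _) e0 (@pi R) p0 => w w0 p p0.
  by field; rewrite p0 w0.
- move=> t k alpha t0 ha; split.
  + move=> j x _ x0.
    have [dj _] := derive1n_density beta_gt0 beta_lt1 lambda_gt0 HD HE Hh j x0 t0.
    exact: (is_derive1_derivable dj).
  + have [_] := density_deriv_x0 k beta_gt0 beta_lt1 lambda_gt0 t0.
    apply: eq_integrable => // r; rewrite inE/= in_itv/= andbT => r0.
    by rewrite /= (Im_cut_symbolX k beta_gt0 beta_lt1 r0 (ha r r0)).
  + have := lim0 k t t0.
    have [-> _] := density_deriv_x0 k beta_gt0 beta_lt1 lambda_gt0 t0.
    set rhs := (X in _ --> X -> _); set rhs' := (X in _ -> _ --> X).
    suff -> : rhs = rhs' by [].
    congr (_ * _); apply: eq_Rintegral => r; rewrite inE/= in_itv/= andbT => r0.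
    by rewrite (Im_cut_symbolX k beta_gt0 beta_lt1 r0 (ha r r0)).
- move=> m m2 bm x x0.
  exact: (ITS_governing_equation beta_gt0 beta_lt1 lambda_gt0 hE m2 bm x0).
Unshelve. all: by end_near. Qed.
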